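(* Any extension $K\leq M$ of $\mathcal L_{\mathfrak d}$-structures, with both $K$ and $M$ perfect fields in $\mathrm{P}I\mathrm{C}_{\mathfrak d}$, is $\mathcal L_{\mathfrak d}$-elementary.
   Context: Setting. $I$ is a finite set of theories $T_i$ of large fields; $T_i$ eliminates quantifiers in a relational expansion $\mathcal L_i$ of the ring language, these expansions being pairwise disjoint. (A field $K$ is large if every irreducible variety over $K$ with a smooth $K$-point has a Zariski dense set of $K$-points.) All $\mathcal L_i$-formulas are taken quantifier-free. $\mathcal L_I=\bigcup_i\mathcal L_i$, $T_{i,\forall}$ is the set of universal consequences of $T_i$, $T_I=\bigcup_iT_{i,\forall}$; $\mathrm{dcl}_i$ is the definable closure in models of $T_i$. $F^{\mathrm a}$ is the field-theoretic algebraic closure of $F$. A subset $I_\tau\subseteq I$ is fixed. For every $i\in I_\tau$, (H$_i$) holds: $T_i$ admits a definable non-discrete Henselian $V$-topology $\tau_i$ and, for every $N\models T_i$, any $\mathcal L_i(N)$-definable set has non-empty $\tau_i$-interior in the $N$-points of its Zariski closure. For $i\notin I_\tau$, (Z$_i$) holds: for all $\mathcal L_i$-definable $X\subseteq\mathbb A^{n+m}$, $\{s\in\mathbb A^n:\dim X_s=m\}$ is $\mathcal L_i$-definable (algebraic dimension of fibers); and a theory $T'_i\supseteq T_{i,\forall}$ is fixed such that $\mathrm{dcl}_i(F)\subseteq F^{\mathrm a}$ for every $F\models T_i'$. (A non-discrete field topology is a $V$-topology if $S$ is bounded whenever $S^{-1}$ is bounded away from $0$; it is Henselian if for every $n\geq1$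 there is a neighborhood $U$ of $0$ such that every $X^{n+1}+X^n+\sum_{j<n}u_jX^j$ with $u_j\in U$ has a zero; definable if it has a uniformly definable basis.) A field $K\models T_I$ is pseudo $I$-closed (PIC) if $K$ is $\mathcal L_I$-existentially closed in every extension $K\le F\models T_I$ of $\mathcal L_I$-structures such that the field extension $K\le F$ is regular. Fix $\mathfrak d:\mathbb Z_{>0}\to\mathbb Z_{>0}$. $\mathcal L_{\mathfrak d}=\mathcal L_I\cup\{c_n:n>0\}$ where $c_n=(c_{n,j})_{j<\mathfrak d(n)}$ is a tuple of $\mathfrak d(n)$ constants. $T_{\mathfrak d}$ is the $\mathcal L_{\mathfrak d}$-theory of fields such that, for every $n>0$, $P_n:=X^{\mathfrak d(n)}+\sum_{j<\mathfrak d(n)}c_{n,j}X^j$ is irreducible and every separable polynomial of degree $n$ splits modulo $P_n$ (i.e. in the extension generated by a root of $P_n$). $\mathrm{P}I\mathrm{C}_{\mathfrak d}$ is the class of PIC models of $T_{\mathfrak d}\cup\bigcup_{i\notin I_\tau}T_i'$. *)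

(* Defs.v *)
(* Base structures are fields: the ring symbols are always interpreted by    *)
(* the field operations, so only the relation symbols and constants carry an *)
(* interpretation, and the field axioms are implicit in every theory.        *)
From HB Require Import structures.
From mathcomp Require Export all_boot all_algebra.
From mathcomp Require Export separable.
From mathcomp Require Export mpoly.

Set Implicit Arguments.
Unset Strict Implicit.
Unset Printing Implicit Defensive.

Import GRing.Theory.
Local Open Scope ring_scope.

Record signature := Signature { rsym : Type; arity : rsym -> nat }.

Inductive term (C : Type) :=
| tvar of nat
| tcst of C
| tzero
| tone
| tadd of term C & term C
| topp of term C
| tmul of term C & term C.

(* [fall x f] and [fex x f] bind the named variable [x]. *)
Inductive formula (R : signature) (C : Type) :=
| feq of term C & term C
| frel (r : rsym R) of ('I_(arity r) -> term C)
| fnot of formula R C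
| fand of formula R C & formula R C
| fall of nat & formula R C
| fex of nat & formula R C.

Record struct (R : signature) (C : Type) (K : fieldType) := Struct {
  rint : forall r : rsym R, ('I_(arity r) -> K) -> Prop;
  cint : C -> K }.

Fixpoint teval (C : Type) (K : fieldType) (c : C -> K) (v : nat -> K)
    (t : term C) : K :=
  match t with
  | tvar x => v x
  | tcst a => c a
  | tzero => 0
  | tone => 1
  | tadd t1 t2 => teval c v t1 + teval c v t2
  | topp t1 => - teval c v t1
  | tmul t1 t2 => teval c v t1 * teval c v t2
  end.

Definition upd (K : Type) (v : nat -> K) (x : nat) (a : K) : nat -> K :=
  fun y => if y == x then a else v y.

Fixpoint sat (R : signature) (C : Type) (K : fieldType) (S : struct R C K)
    (v : nat -> K) (f : formula R C) : Prop :=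
  match f with
  | feq t1 t2 => teval (cint S) v t1 = teval (cint S) v t2
  | frel r ts => rint S (fun i => teval (cint S) v (ts i))
  | fnot g => ~ sat S v g
  | fand g1 g2 => sat S v g1 /\ sat S v g2
  | fall x g => forall a : K, sat S (upd v x a) g
  | fex x g => exists a : K, sat S (upd v x a) g
  end.

Fixpoint occurs (C : Type) (t : term C) (x : nat) : Prop :=
  match t with
  | tvar y => x = y
  | tcst _ | tzero | tone => False
  | tadd t1 t2 | tmul t1 t2 => occurs t1 x \/ occurs t2 x
  | topp t1 => occurs t1 x
  end.

Fixpoint free (R : signature) (C : Type) (f : formula R C) (x : nat) : Prop :=
  match f with
  | feq t1 t2 => occurs t1 x \/ occurs t2 x
  | frel r ts => exists i, occurs (ts i) x
  | fnot g => free g x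
  | fand g1 g2 => free g1 x \/ free g2 x
  | fall y g | fex y g => x <> y /\ free g x
  end.

Fixpoint qf (R : signature) (C : Type) (f : formula R C) : Prop :=
  match f with
  | feq _ _ | frel _ _ => True
  | fnot g => qf g
  | fand g1 g2 => qf g1 /\ qf g2
  | fall _ _ | fex _ _ => False
  end.

Fixpoint universal (R : signature) (C : Type) (f : formula R C) : Prop :=
  if f is fall _ g then universal g else qf f.

Fixpoint existential (R : signature) (C : Type) (f : formula R C) : Prop :=
  if f is fex _ g then existential g else qf f.

Definition sentence (R : signature) :=
  {f : formula R void | forall x, ~ free f x}.

Definition theory (R : signature) := sentence R -> Prop.

Definition models (R : signature) (K : fieldType) (S : struct R void K)
    (T : theory R) : Prop :=
  forall f : sentence R, T f -> forall v, sat S v (sval f).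

Definition univ_conseq (R : signature) (T : theory R) : theory R :=
  fun f => universal (sval f) /\
    forall (N : fieldType) (S : struct R void N),
      models S T -> forall v, sat S v (sval f).

Definition elim_quantifiers (R : signature) (T : theory R) : Prop :=
  forall f : formula R void, exists g : formula R void,
    [/\ qf g, (forall x, free g x -> free f x)
      & forall (N : fieldType) (S : struct R void N),
          models S T -> forall v, sat S v f <-> sat S v g].

(* Extensions are given by embeddings; ring morphisms between fields are     *)
(* injective.                                                                *)
Definition extension (R : signature) (C : Type) (K F : fieldType)
    (SK : struct R C K) (SF : struct R C F) (h : {rmorphism K -> F}) : Prop :=
  (forall (r : rsym R) (a : 'I_(arity r) -> K),
      rint SK a <-> rint SF (fun i => h (a i))) /\
  (forall c : C, cint SF c = h (cint SK c)).

Definition exist_closed (R : signature) (C : Type) (K F : fieldType)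
    (SK : struct R C K) (SF : struct R C F) (h : {rmorphism K -> F}) : Prop :=
  forall (f : formula R C) (v : nat -> K), existential f ->
    sat SF (fun x => h (v x)) f -> sat SK v f.

Definition elementary (R : signature) (C : Type) (K F : fieldType)
    (SK : struct R C K) (SF : struct R C F) (h : {rmorphism K -> F}) : Prop :=
  forall (f : formula R C) (v : nat -> K),
    sat SK v f <-> sat SF (fun x => h (v x)) f.

(* [fcat a e] assigns [a] to the variables [0, ..., n-1] and [e 0], [e 1],   *)
(* ... to the following ones.                                                *)
Definition fcat (K : Type) (n : nat) (a : 'I_n -> K) (e : nat -> K) :
    nat -> K :=
  fun x => oapp a (e (x - n)%N) (insub x : option 'I_n).

Definition fzero (K : fieldType) : nat -> K := fun _ => 0.
Arguments fzero : clear implicits.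

(* All the formulas defining sets are quantifier free. *)
Definition pdefinable (R : signature) (N : fieldType) (S : struct R void N)
    (n : nat) (X : ('I_n -> N) -> Prop) : Prop :=
  exists (f : formula R void) (e : nat -> N),
    qf f /\ forall a, X a <-> sat S (fcat a e) f.

Definition vanishing (K : fieldType) (n : nat) (X : ('I_n -> K) -> Prop) :
    {mpoly K[n]} -> Prop :=
  fun p => forall a, X a -> p.@[a] = 0.

(* The zeros, in an extension of [K], of a set of polynomials over [K]. *)
Definition zeros (K F : fieldType) (h : {rmorphism K -> F}) (n : nat)
    (J : {mpoly K[n]} -> Prop) : ('I_n -> F) -> Prop :=
  fun a => forall p, J p -> (map_mpoly h p).@[a] = 0.

Definition rat_zeros (K : fieldType) (n : nat) (J : {mpoly K[n]} -> Prop) :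
    ('I_n -> K) -> Prop :=
  fun a => forall p, J p -> p.@[a] = 0.

Definition zariski_closure (K : fieldType) (n : nat)
    (X : ('I_n -> K) -> Prop) : ('I_n -> K) -> Prop :=
  rat_zeros (vanishing X).

Definition alg_independent (K F : fieldType) (h : {rmorphism K -> F})
    (n : nat) (a : 'I_n -> F) : Prop :=
  forall p : {mpoly K[n]}, (map_mpoly h p).@[a] = 0 -> p = 0.

(* The dimension of an algebraic set over [K] is the largest transcendence   *)
(* degree over [K] of its points in extensions of [K]; the transcendence     *)
(* degree of a point is the largest number of algebraically independent      *)
(* coordinates.  The empty set has no dimension.                             *)
Definition dim_ge (K : fieldType) (n : nat) (J : {mpoly K[n]} -> Prop)
    (d : nat) : Prop :=
  exists (F : fieldType) (h : {rmorphism K -> F}) (a : 'I_n -> F)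
         (s : 'I_d -> 'I_n),
    zeros h J a /\ alg_independent h (fun i => a (s i)).

Definition dim_is (K : fieldType) (n : nat) (J : {mpoly K[n]} -> Prop)
    (d : nat) : Prop :=
  dim_ge J d /\ ~ dim_ge J d.+1.

(* The dimension of a set of rational points is that of its Zariski closure. *)
Definition set_dim_is (K : fieldType) (n : nat) (X : ('I_n -> K) -> Prop)
    (d : nat) : Prop :=
  dim_is (vanishing X) d.

Definition prime_ideal (K : fieldType) (n : nat) (J : {mpoly K[n]} -> Prop) :
    Prop :=
  [/\ J 0, (forall p q, J p -> J q -> J (p + q)),
      (forall p q, J q -> J (p * q)), ~ J 1
    & forall p q, J (p * q) -> J p \/ J q].

(* Jacobian criterion. *)
Definition smooth_at (K : fieldType) (n : nat) (J : {mpoly K[n]} -> Prop)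
    (a : 'I_n -> K) : Prop :=
  rat_zeros J a /\
  exists (r d : nat) (g : 'I_r -> {mpoly K[n]}),
    [/\ (forall p, J p <->
           exists q : 'I_r -> {mpoly K[n]}, p = \sum_(i < r) q i * g i),
        dim_is J d
      & (\rank (\matrix_(i < r, j < n) ((g i)^`M(j)).@[a]) + d = n)%N].

(* Smoothness and Zariski density being local, it suffices to consider       *)
(* affine irreducible varieties, that is, prime ideals.                      *)
Definition large (K : fieldType) : Prop :=
  forall (n : nat) (J : {mpoly K[n]} -> Prop), prime_ideal J ->
    (exists a, smooth_at J a) ->
    forall p : {mpoly K[n]}, vanishing (rat_zeros J) p -> J p.

Definition perfect_field (K : fieldType) : Prop :=
  forall p : nat, p \in [pchar K] -> forall x : K, exists y : K, y ^+ p = x.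

Definition lin_independent (K F : fieldType) (h : {rmorphism K -> F})
    (n : nat) (a : 'I_n -> F) : Prop :=
  forall b : 'I_n -> K, \sum_(j < n) h (b j) * a j = 0 -> forall j, b j = 0.

(* [F] is linearly disjoint from the algebraic closure of [K] over [K]; the  *)
(* closure is taken inside an arbitrary common overfield.                    *)
Definition regular_extension (K F : fieldType) (h : {rmorphism K -> F}) :
    Prop :=
  forall (E : fieldType) (g : {rmorphism F -> E}) (n : nat) (a : 'I_n -> F),
    lin_independent h a ->
    forall c : 'I_n -> E, (forall j, algebraicOver (g \o h) (c j)) ->
      \sum_(j < n) c j * g (a j) = 0 -> forall j, c j = 0.

(* A topology is given by its open sets. *)
Definition topology (N : Type) (op : (N -> Prop) -> Prop) : Prop :=
  [/\ op (fun _ => True),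
      (forall U V, op U -> op V -> op (fun x => U x /\ V x))
    & forall A : (N -> Prop) -> Prop, (forall U, A U -> op U) ->
        op (fun x => exists U, A U /\ U x)].

Definition hausdorff (N : Type) (op : (N -> Prop) -> Prop) : Prop :=
  forall x y : N, x <> y -> exists U V : N -> Prop,
    [/\ op U, op V, U x, V y & forall z, ~ (U z /\ V z)].

(* Open neighborhoods. *)
Definition nbhd_of (N : Type) (op : (N -> Prop) -> Prop) (x : N)
    (U : N -> Prop) : Prop := op U /\ U x.

Definition field_topology (N : fieldType) (op : (N -> Prop) -> Prop) : Prop :=
  [/\ topology op /\ hausdorff op,
      (forall (x y : N) W, nbhd_of op (x + y) W -> exists U V,
         [/\ nbhd_of op x U, nbhd_of op y V
           & forall u v, U u -> V v -> W (u + v)]),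
      (forall (x : N) W, nbhd_of op (- x) W -> exists U,
         nbhd_of op x U /\ forall u, U u -> W (- u)),
      (forall (x y : N) W, nbhd_of op (x * y) W -> exists U V,
         [/\ nbhd_of op x U, nbhd_of op y V
           & forall u v, U u -> V v -> W (u * v)])
    & (forall (x : N) W, x != 0 -> nbhd_of op x^-1 W -> exists U,
         nbhd_of op x U /\ forall u, u != 0 -> U u -> W u^-1)].

Definition nondiscrete (N : Type) (op : (N -> Prop) -> Prop) : Prop :=
  ~ forall U : N -> Prop, op U.

Definition bounded (N : fieldType) (op : (N -> Prop) -> Prop)
    (S : N -> Prop) : Prop :=
  forall U, nbhd_of op 0 U -> exists V, nbhd_of op 0 V /\
    forall v s, V v -> S s -> U (v * s).

Definition inv_away_from_zero (N : fieldType) (op : (N -> Prop) -> Prop)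
    (S : N -> Prop) : Prop :=
  exists U, nbhd_of op 0 U /\ forall s, S s -> s != 0 -> ~ U s^-1.

Definition V_topology (N : fieldType) (op : (N -> Prop) -> Prop) : Prop :=
  [/\ field_topology op, nondiscrete op
    & forall S, inv_away_from_zero op S -> bounded op S].

Definition henselian (N : fieldType) (op : (N -> Prop) -> Prop) : Prop :=
  forall n : nat, (0 < n)%N -> exists U, nbhd_of op 0 U /\
    forall u : 'I_n -> N, (forall j, U (u j)) ->
      exists x : N, x ^+ n.+1 + x ^+ n + \sum_(j < n) u j * x ^+ j = 0.

Definition basis_of_topology (N I : Type) (op : (N -> Prop) -> Prop)
    (B : I -> N -> Prop) : Prop :=
  (forall i, op (B i)) /\
  forall U x, op U -> U x -> exists i, B i x /\ forall y, B i y -> U y.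

(* [X] has an interior point in [Z], for the topology induced on [Z] by the  *)
(* product topology.                                                         *)
Definition has_interior_in (N : Type) (op : (N -> Prop) -> Prop) (n : nat)
    (X Z : ('I_n -> N) -> Prop) : Prop :=
  exists (a : 'I_n -> N) (U : 'I_n -> N -> Prop),
    [/\ X a, (forall j, nbhd_of op (a j) (U j))
      & forall b, Z b -> (forall j, U j (b j)) -> X b].

(* The formula [f] defines, uniformly in the models of [T], a basis of the   *)
(* topology: variable [0] is the element, the others are parameters.         *)
Definition cond_H (R : signature) (T : theory R) : Prop :=
  exists f : formula R void, qf f /\
    forall (N : fieldType) (S : struct R void N), models S T ->
    exists op : (N -> Prop) -> Prop,
      [/\ basis_of_topology op
            (fun (e : nat -> N) (x : N) => sat S (fcat (fun _ : 'I_1 => x) e) f),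
          V_topology op, henselian op
        & forall (n : nat) (X : ('I_n -> N) -> Prop), pdefinable S X ->
            (exists a, X a) -> has_interior_in op X (zariski_closure X)].

(* Variables beyond the [n + m] first ones are evaluated at [0], so [f]      *)
(* defines a subset of the affine space of dimension [n + m], and [g] one of *)
(* the affine space of dimension [n], both without parameters.               *)
Definition cond_Z (R : signature) (T : theory R) : Prop :=
  forall (n m : nat) (f : formula R void), qf f ->
    exists g : formula R void, qf g /\
      forall (N : fieldType) (S : struct R void N), models S T ->
      forall s : 'I_n -> N,
        sat S (fcat s (fzero N)) g <->
        set_dim_is (fun y : 'I_m -> N => sat S (fcat s (fcat y (fzero N))) f) m.

(* [a] belongs to the definable closure of the subset [h(F)] of [N]. *)
Definition dcl (R : signature) (F N : fieldType) (S : struct R void N)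
    (h : F -> N) (a : N) : Prop :=
  exists (f : formula R void) (e : nat -> F),
    qf f /\ forall x : N,
      sat S (fcat (fun _ : 'I_1 => x) (fun k => h (e k))) f <-> x = a.

(* The definable closure of [F] is computed in models of [T] extending [F]. *)
Definition dcl_algebraic (R : signature) (T T' : theory R) : Prop :=
  forall (F : fieldType) (SF : struct R void F), models SF T' ->
  forall (N : fieldType) (SN : struct R void N) (h : {rmorphism F -> N}),
    models SN T -> extension SF SN h ->
    forall a : N, dcl SN h a -> algebraicOver h a.

Definition large_fields_theory (R : signature) (T : theory R) : Prop :=
  forall (N : fieldType) (S : struct R void N), models S T -> large N.

(* The union of the languages, made disjoint apart from the ring language. *)
Definition sig_union (I : finType) (L : I -> signature) : signature :=
  @Signature {i : I & rsym (L i)} (fun r => arity (tagged r)).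

Definition reduct_i (I : finType) (L : I -> signature) (C : Type)
    (K : fieldType) (S : struct (sig_union L) C K) (i : I) :
    struct (L i) void K :=
  @Struct (L i) void K
    (fun r a => @rint _ _ _ S (Tagged (fun i => rsym (L i)) r) a)
    (fun c : void => match c with end).

Definition reduct_I (R : signature) (C : Type) (K : fieldType)
    (S : struct R C K) : struct R void K :=
  @Struct R void K (@rint _ _ _ S) (fun c : void => match c with end).

Definition models_TI (I : finType) (L : I -> signature)
    (T : forall i, theory (L i)) (C : Type) (K : fieldType)
    (S : struct (sig_union L) C K) : Prop :=
  forall i : I, models (reduct_i S i) (univ_conseq (@T i)).

Definition PIC (I : finType) (L : I -> signature)
    (T : forall i, theory (L i)) (K : fieldType)
    (S : struct (sig_union L) void K) : Prop :=
  models_TI T S /\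
  forall (F : fieldType) (SF : struct (sig_union L) void F)
         (h : {rmorphism K -> F}),
    extension S SF h -> models_TI T SF -> regular_extension h ->
    exist_closed S SF h.

Definition posnat := {n : nat | (0 < n)%N}.

Definition cst_d (d : posnat -> posnat) : Type :=
  {n : posnat & 'I_(val (d n))}.

Definition P_ (d : posnat -> posnat) (R : signature) (K : fieldType)
    (S : struct R (cst_d d) K) (n : posnat) : {poly K} :=
  'X^(val (d n)) +
  \sum_(j < val (d n))
    (cint S (existT (fun n : posnat => 'I_(val (d n))) n j))%:P * 'X^j.

(* [q] is a product of linear factors over the subfield generated by a root  *)
(* of [P] in an extension of [K].                                            *)
Definition splits_modulo (K : fieldType) (P q : {poly K}) : Prop :=
  forall (E : fieldType) (g : {rmorphism K -> E}) (alpha : E),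
    root (map_poly g P) alpha ->
    exists rs : seq {poly K},
      map_poly g q = (g (lead_coef q))%:P *
        \prod_(r <- rs) ('X - ((map_poly g r).[alpha])%:P).

Definition models_Td (d : posnat -> posnat) (R : signature) (K : fieldType)
    (S : struct R (cst_d d) K) : Prop :=
  forall n : posnat,
    irreducible_poly (P_ S n) /\
    forall q : {poly K}, separable_poly q -> size q = (val n).+1 ->
      splits_modulo (P_ S n) q.

Definition PIC_d (I : finType) (L : I -> signature)
    (T T' : forall i, theory (L i)) (Itau : {set I}) (d : posnat -> posnat)
    (K : fieldType) (S : struct (sig_union L) (cst_d d) K) : Prop :=
  [/\ PIC T (reduct_I S), models_Td S
    & forall i, i \notin Itau -> models (reduct_i S i) (@T' i)].

(* Main.v *)
From HB Require Import structures.
Require Import Defs.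
From mathcomp Require Import boolp zify ring fieldext fraction generic_quotient.
From mathcomp Require filter.
From Stdlib Require Import Lia.

Set Implicit Arguments.
Unset Strict Implicit.
Unset Printing Implicit Defensive.
Import GRing.Theory.
Local Open Scope ring_scope.

(** * Formulas and definable predicates *)

(** The frame is Robinson's test. Let K <= M be an extension of perfect fields of the class. The
    polynomials P_n have the same coefficients in K and in M and stay irreducible over M, while
    every irreducible polynomial of degree n over K has a root modulo P_n. By linear disjointness an
    element of M algebraic over K lies in K ([closed_of_root]), so M is regular over the perfect
    field K ([regular_of_closed], [good_regular]). As K is PIC, it is existentially closed in M, and
    M embeds over K into an elementary extension N of K ([ec_embed]). If N is again in the class,
    then M <= N is an extension of the same kind as K <= M, and an induction on formulas, for all
    such extensions at once, gives elementarity ([good_extension_elementary]).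

    It remains to see that an elementary extension M of a field K of the class is in the class
    ([good_elementary]). Everything but the PIC property is a first-order scheme; PIC is
    [elementary_PIC]. Let F be a regular extension of M and a model of T_I, in which a
    quantifier-free formula g over M has a solution a. Since M is perfect, a consists of quotients
    p_k(t,s)/q(t), where t is algebraically independent over M and s is a root of a monic f
    irreducible over M(t) ([normal_form]). The formula [theta] records this in terms of the
    coefficients of f, q and the p_k: f factors neither over the base field nor modulo P_j for 1 < j
    <= deg f; the equations and inequations chosen from g hold on the hypersurface f = 0; for each
    i, the points x above which the hypersurface has a point satisfying the L_i-part of g are
    Zariski dense; and g has no solution in the base field. If g had no solution in M, such
    coefficients would exist in M, hence in K, and [theta_false] excludes them there. Indeed an
    element of K(t,s) algebraic over K has degree j <= deg f; since f does not factor modulo P_j,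
    Gauss's lemma shows that P_j remains irreducible over K(t,s), and the element lies in K
    ([function_field_regular]). So K(t,s) is regular over K. By density and compactness its generic
    point is realised in a model of each T_i with the L_i-part of g true ([generic_point]); this
    makes K(t,s) a model of T_I in which g has a solution, and K is PIC.

    Density has to be first order, and it has to hold for the data coming from F. Under (Z) it is a
    condition on dimension; under (H) it says that the set contains a product of non-empty basic
    open sets ([dense_definable_Z], [dense_definable_H]). A set that is definable over a field with
    algebraic definable closure and has a generic point is dense, because the coefficients of a
    normalized polynomial of minimal support vanishing on it are definable ([dense_of_generic]). For
    i outside I_tau this applies over M, a model of T'_i. For i in I_tau the definable closure is
    controlled over K, which is PIC ([dcl_PIC]); the parameters from M are absorbed into the generic
    point by means of a transcendence basis over K, and openness concludes ([generic_dense_H]). *)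

Section Renaming.
Variables (R : signature) (C : Type).

Fixpoint trename (r : nat -> nat) (t : term C) : term C :=
  match t with
  | tvar x => tvar _ (r x)
  | tcst a => tcst a
  | tzero => tzero _
  | tone => tone _
  | tadd t1 t2 => tadd (trename r t1) (trename r t2)
  | topp t1 => topp (trename r t1)
  | tmul t1 t2 => tmul (trename r t1) (trename r t2)
  end.

(** Bound variables are renamed as well; this preserves the meaning when [r] is injective or when
    there is no quantifier. *)
Fixpoint frename (r : nat -> nat) (f : formula R C) : formula R C :=
  match f with
  | feq t1 t2 => feq R (trename r t1) (trename r t2)
  | frel s ts => frel (fun i => trename r (ts i))
  | fnot g => fnot (frename r g)
  | fand g1 g2 => fand (frename r g1) (frename r g2)
  | fall x g => fall (r x) (frename r g)
  | fex x g => fex (r x) (frename r g)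
  end.

Lemma teval_trename (K : fieldType) (c : C -> K) r v t :
  teval c v (trename r t) = teval c (v \o r) t.
Proof. by elim: t => //= [t1 -> t2 ->|t ->|t1 -> t2 ->]. Qed.

Lemma upd_comp (K : Type) (v : nat -> K) r x a :
  injective r -> upd v (r x) a \o r = upd (v \o r) x a.
Proof. by move=> rI; apply/funext => y; rewrite /upd /= (inj_eq rI). Qed.

Lemma sat_frename (K : fieldType) (S : struct R C K) r v f :
  injective r \/ qf f -> sat S v (frename r f) <-> sat S (v \o r) f.
Proof.
elim: f v => [t1 t2|s ts|g IH|g1 IH1 g2 IH2|x g IH|x g IH] v //= H.
- by rewrite !teval_trename.
- by under eq_fun do rewrite teval_trename.
- by rewrite IH.
- by rewrite IH1 ?IH2; tauto.
- by case: H => // rI; split=> + a => /(_ a); rewrite IH ?upd_comp //; left.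
- case: H => // rI; split=> -[a]; rewrite ?IH ?upd_comp //; try by left.
    by exists a.
  by rewrite -upd_comp // -IH; [exists a | left].
Qed.

Lemma qf_frename r f : qf f -> qf (frename r f).
Proof. by elim: f => //= g1 IH1 g2 IH2 [/IH1 ? /IH2]. Qed.

Lemma teval_occurs (K : fieldType) (c : C -> K) v w t :
  (forall x, occurs t x -> v x = w x) -> teval c v t = teval c w t.
Proof.
elim: t => //= [x|t1 IH1 t2 IH2|t IH|t1 IH1 t2 IH2] H; first exact: H.
- by rewrite IH1 ?IH2 // => x ?; apply: H; [right|left].
- by rewrite IH.
- by rewrite IH1 ?IH2 // => x ?; apply: H; [right|left].
Qed.

Lemma sat_free (K : fieldType) (S : struct R C K) v w f :
  (forall x, free f x -> v x = w x) -> sat S v f <-> sat S w f.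
Proof.
elim: f v w => [t1 t2|s ts|g IH|g1 IH1 g2 IH2|y g IH|y g IH] v w /= H.
- by rewrite !(@teval_occurs _ _ v w) // => x ?; apply: H; [right|left].
- suff -> : (fun i => teval (cint S) v (ts i)) = (fun i => teval (cint S) w (ts i)) by [].
  by apply/funext => i; apply: teval_occurs => x ox; apply: H; exists i.
- by rewrite (IH v w).
- by rewrite (IH1 v w) ?(IH2 v w) // => x ?; apply: H; [right|left].
- have E a x : free g x -> upd v y a x = upd w y a x.
    by move=> fx; rewrite /upd; case: eqP => // nxy; apply: H.
  by split=> Hs a; [apply/(IH _ _ (E a)) | apply/(IH _ _ (E a))].
- have E a x : free g x -> upd v y a x = upd w y a x.
    by move=> fx; rewrite /upd; case: eqP => // nxy; apply: H.
  by split=> -[a Hs]; exists a; [apply/(IH _ _ (E a)) | apply/(IH _ _ (E a))].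
Qed.

Lemma occurs_bound (t : term C) : exists B, forall x, occurs t x -> (x < B)%N.
Proof.
elim: t => [y|a|||t1 [B1 H1] t2 [B2 H2]|t1 [B1 H1]|t1 [B1 H1] t2 [B2 H2]] /=;
  try by exists 0%N.
- by exists y.+1 => x ->.
- by exists (maxn B1 B2) => x [/H1|/H2]; lia.
- by exists B1.
- by exists (maxn B1 B2) => x [/H1|/H2]; lia.
Qed.

Lemma free_bound (f : formula R C) : exists B, forall x, free f x -> (x < B)%N.
Proof.
elim: f => [t1 t2|s ts|g [B H]|g1 [B1 H1] g2 [B2 H2]|y g [B H]|y g [B H]] /=.
- have [B1 H1] := occurs_bound t1; have [B2 H2] := occurs_bound t2.
  by exists (maxn B1 B2) => x [/H1|/H2]; lia.
- have /choice [B HB] := fun i => occurs_bound (ts i).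
  exists (\max_i B i)%N => x [i /HB lt_x]; apply: leq_trans lt_x _.
  exact: leq_bigmax i.
- by exists B.
- by exists (maxn B1 B2) => x [/H1|/H2]; lia.
- by exists B => x [_ /H].
- by exists B => x [_ /H].
Qed.

Lemma sat_bound (f : formula R C) : exists B,
  (forall (K : fieldType) (S : struct R C K) v w,
    (forall x, (x < B)%N -> v x = w x) -> sat S v f <-> sat S w f) /\
  forall x, free f x -> (x < B)%N.
Proof.
have [B HB] := free_bound f; exists B; split=> // K S v w H.
by apply: sat_free => x /HB; apply: H.
Qed.

Definition fallb B (f : formula R C) := foldr (@fall R C) f (iota 0 B).
Definition fexs (s : seq nat) (f : formula R C) := foldr (@fex R C) f s.

Lemma sat_foldr_fall (K : fieldType) (S : struct R C K) v s f :
  sat S v (foldr (@fall R C) f s) <->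
  forall w : nat -> K, (forall x : nat, x \notin s -> w x = v x) -> sat S w f.
Proof.
elim: s v => [|x s IH] v /=.
  split=> [H w vw|]; last exact.
  by have -> : w = v by apply/funext => x; apply: vw.
split=> [H w vw|H a].
  have /IH := H (w x); apply=> y ys; rewrite /upd; case: eqP => [-> //|/eqP nyx].
  by apply: vw; rewrite inE negb_or nyx.
apply/IH => w vw; apply: H => y; rewrite inE negb_or => /andP[nyx ys].
by rewrite vw // /upd (negPf nyx).
Qed.

Lemma sat_fexs (K : fieldType) (S : struct R C K) v s f :
  sat S v (fexs s f) <->
  exists w : nat -> K, (forall x : nat, x \notin s -> w x = v x) /\ sat S w f.
Proof.
elim: s v => [|x s IH] v /=.
  split=> [H|[w [vw]]]; first by exists v.
  by have -> : w = v by apply/funext => x; apply: vw.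
split=> [[a /IH[w [vw H]]]|[w [vw H]]].
  exists w; split=> // y; rewrite inE negb_or => /andP[nyx ys].
  by rewrite vw // /upd (negPf nyx).
exists (w x); apply/IH; exists w; split=> // y ys; rewrite /upd.
by case: eqP => [-> //|/eqP nyx]; apply: vw; rewrite inE negb_or nyx.
Qed.

Lemma free_foldr_fall s f x :
  free (foldr (@fall R C) f s) x <-> x \notin s /\ free f x.
Proof.
elim: s => [|y s IH] //=; first by split=> [|[]].
rewrite inE negb_or IH; split=> [[/eqP -> [-> ?]] //|[/andP[/eqP ? ?] ?]].
by split.
Qed.

Lemma universal_foldr_fall s f : qf f -> universal (foldr (@fall R C) f s).
Proof. by move=> qff; elim: s => //=; case: f qff. Qed.

Lemma existential_fexs s f : qf f -> existential (fexs s f).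
Proof. by move=> qff; elim: s => //=; case: f qff. Qed.

Lemma existential_fexsP f : existential f -> exists s g, f = fexs s g /\ qf g.
Proof.
elim: f => //= [t1 t2|s ts|g IH|g1 IH1 g2 IH2|x g IH] H.
- by exists [::], (feq _ t1 t2).
- by exists [::], (frel ts).
- by exists [::], (fnot g).
- by exists [::], (fand g1 g2).
by have [s [g' [-> qfg]]] := IH H; exists (x :: s), g'.
Qed.

End Renaming.

(* The interleaving of two valuations; it makes quantification over tuples   *)
(* of unspecified length first order.                                        *)
Definition vmix (K : Type) (v w : nat -> K) : nat -> K :=
  fun x => if odd x then w x./2 else v x./2.
Definition vfst (K : Type) (u : nat -> K) : nat -> K := fun x => u x.*2.
Definition vsnd (K : Type) (u : nat -> K) : nat -> K := fun x => u x.*2.+1.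

Lemma vfst_mix (K : Type) (v w : nat -> K) : vfst (vmix v w) = v.
Proof. by apply/funext => x; rewrite /vfst /vmix odd_double doubleK. Qed.

Lemma vsnd_mix (K : Type) (v w : nat -> K) : vsnd (vmix v w) = w.
Proof. by apply/funext => x; rewrite /vsnd /vmix /= odd_double /= uphalf_double. Qed.

Lemma vmix_eta (K : Type) (u : nat -> K) : vmix (vfst u) (vsnd u) = u.
Proof.
apply/funext => x; rewrite /vmix /vfst /vsnd.
by have := odd_double_half x; case: (odd x) => <- /=; rewrite ?add0n ?add1n ?doubleK ?uphalf_double.
Qed.

Lemma vmix_comp (K L : Type) (h : K -> L) (v w : nat -> K) : h \o vmix v w = vmix (h \o v) (h \o w).
Proof. by apply/funext => x; rewrite /vmix /=; case: ifP. Qed.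

Section Definable.
Variables (R : signature) (T : theory R).

(** Definability is semantic: a predicate given uniformly on all structures, up to equivalence in
    the models of [T]. The closure properties below then produce formulas from mathematical
    statements. *)
Definition vpred := forall K : fieldType, struct R void K -> (nat -> K) -> Prop.

Definition definable (P : vpred) : Prop := exists f : formula R void,
  forall (K : fieldType) (S : struct R void K), models S T -> forall v, sat S v f <-> P K S v.

Lemma definable_ext (P Q : vpred) :
  (forall K S, models S T -> forall v, P K S v <-> Q K S v) -> definable P -> definable Q.
Proof. by move=> PQ [f Hf]; exists f => K S mS v; rewrite Hf // PQ. Qed.

Lemma definable_sat f : definable (fun K S v => sat S v f).
Proof. by exists f. Qed.

Lemma definable_not (P : vpred) : definable P -> definable (fun K S v => ~ P K S v).
Proof. by case=> f Hf; exists (fnot f) => K S mS v /=; rewrite Hf. Qed.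

Lemma definable_and (P Q : vpred) :
  definable P -> definable Q -> definable (fun K S v => P K S v /\ Q K S v).
Proof.
by case=> f Hf [g Hg]; exists (fand f g) => K S mS v /=; rewrite Hf // Hg.
Qed.

Lemma definable_imp (P Q : vpred) :
  definable P -> definable Q -> definable (fun K S v => P K S v -> Q K S v).
Proof.
move=> dP dQ; apply: definable_ext (definable_not (definable_and dP (definable_not dQ))).
move=> K S _ v; split=> [H p|H [p]]; last by apply; apply: H.
by apply: contrapT => q; apply: H.
Qed.

Lemma definable_true : definable (fun _ _ _ => True).
Proof. by exists (feq R (tzero _) (tzero _)). Qed.

Lemma definable_const (p : Prop) : definable (fun _ _ _ => p).
Proof.
case: (pselect p) => Hp; first by apply: definable_ext definable_true.
by apply: definable_ext (definable_not definable_true) => K S _ v; split.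
Qed.

Lemma definable_or (P Q : vpred) :
  definable P -> definable Q -> definable (fun K S v => P K S v \/ Q K S v).
Proof.
move=> dP dQ; apply: definable_ext (definable_imp (definable_not dP) dQ).
by move=> K S _ v; split=> [H|[p /(_ p)|q _] //]; case: (pselect (P K S v)); auto.
Qed.

Lemma definable_all_lt (n : nat) (P : nat -> vpred) :
  (forall j, (j < n)%N -> definable (P j)) ->
  definable (fun K S v => forall j, (j < n)%N -> P j K S v).
Proof.
elim: n => [|n IH] dP; first by apply: definable_ext definable_true.
have dn : definable (P n) by apply: dP.
have dlt : forall j, (j < n)%N -> definable (P j) by move=> j jn; apply: dP; apply: leqW.
apply: definable_ext (definable_and (IH dlt) dn) => K S _ v; split.
  by move=> [H1 H2] j; rewrite ltnS leq_eqVlt => /orP[/eqP ->|/H1].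
by move=> H; split=> [j jn|]; apply: H; lia.
Qed.

Lemma definable_all_fin (J : finType) (P : J -> vpred) :
  (forall j, definable (P j)) -> definable (fun K S v => forall j, P j K S v).
Proof.
move=> dP.
have := @definable_all_lt #|J| (fun k K S v => forall h : (k < #|J|)%N, P (enum_val (Ordinal h)) K S v).
case=> [j jn|f Hf].
  apply: definable_ext (dP (enum_val (Ordinal jn))) => K S _ v.
  by split=> [H h|/(_ jn)] //; rewrite (bool_irrelevance h jn).
exists f => K S mS v; rewrite Hf //; split=> [H j|H j jn h] //.
have := H _ (ltn_ord (enum_rank j)) (ltn_ord (enum_rank j)).
by rewrite (_ : Ordinal _ = enum_rank j) ?enum_rankK //; apply/val_inj.
Qed.


(** As [r] need not be injective, the formula is shifted by [M], beyond every value of [r] that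
    matters, and the values are copied into the shifted variables by existential quantifiers. *)
Lemma definable_rename (r : nat -> nat) (P : vpred) :
  definable P -> definable (fun K S v => P K S (v \o r)).
Proof.
case=> f Hf; have [B [HB _]] := sat_bound f.
pose M := (\max_(x < B) r x).+1.
have rM x : (x < B)%N -> (r x < M)%N.
  by move=> xB; rewrite ltnS; apply: (leq_bigmax (Ordinal xB)).
have [|e He] := @definable_all_lt B (fun x K S v => v (M + x)%N = v (r x)).
  by move=> j _; exists (feq R (tvar _ (M + j)) (tvar _ (r j))).
exists (fexs (iota M B) (fand e (frename (addn M) f))) => K S mS v.
rewrite sat_fexs -Hf //; split=> [[w [vw /= [/He-/(_ mS) Hw]]]|H].
  rewrite sat_frename; last by left; apply: addnI.
  rewrite (HB _ _ _ (v \o r)) // => x xB /=; rewrite Hw // vw //.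
  by rewrite mem_iota; have := rM _ xB; lia.
pose w x := if (M <= x < M + B)%N then v (r (x - M)%N) else v x.
have Mw x : (x < B)%N -> w (M + x)%N = v (r x).
  by move=> xB; rewrite /w addKn; case: ifP => //; lia.
exists w; split=> [x|/=]; first by rewrite mem_iota /w => /negPf ->.
split.
  apply/He => // x xB; rewrite Mw // /w; case: ifP => //.
  by have := rM _ xB; lia.
rewrite sat_frename; last by left; apply: addnI.
by rewrite (HB _ _ _ (v \o r)) // => x xB /=; rewrite Mw.
Qed.

(** A formula mentions finitely many variables, so quantifying over the sequence [w] amounts to
    quantifying over the odd variables below a bound; the even variable [2k] is read from [v k]. *)
Lemma definable_exv (Q : forall K : fieldType, struct R void K -> (nat -> K) -> (nat -> K) -> Prop) :
  definable (fun K S u => Q K S (vfst u) (vsnd u)) ->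
  definable (fun K S v => exists w, Q K S v w).
Proof.
case=> f Hf; have [B [HB _]] := sat_bound f.
apply: (@definable_ext (fun K S v => sat S (v \o half) (fexs [seq x <- iota 0 B | odd x] f))).
  move=> K S mS v; rewrite sat_fexs; split=> [[u [Hu /Hf-/(_ mS) HQ]]|[w Qw]].
    exists (vsnd u).
    pose u' := vmix v (vsnd u).
    have : sat S u' f.
      rewrite (HB _ _ _ u) ?Hf // => x xB; rewrite /u' /vmix; case: ifP => ox.
        by rewrite /vsnd; congr u; have := odd_double_half x; rewrite ox; lia.
      by rewrite Hu // mem_filter ox.
    by rewrite Hf // /u' vfst_mix vsnd_mix.
  have : sat S (vmix v w) f by rewrite Hf // vfst_mix vsnd_mix.
  exists (fun x => if x < B then vmix v w x else v x./2)%N; split.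
    move=> x; rewrite mem_filter mem_iota add0n /=; case: (ltnP x B) => // _.
    by rewrite andbT /vmix => /negPf ->.
  rewrite (HB _ _ _ (vmix v w)) // => x xB /=; by rewrite xB.
exact: (definable_rename half (definable_sat _)).
Qed.

Lemma definable_allv (Q : forall K : fieldType, struct R void K -> (nat -> K) -> (nat -> K) -> Prop) :
  definable (fun K S u => Q K S (vfst u) (vsnd u)) ->
  definable (fun K S v => forall w, Q K S v w).
Proof.
move=> dQ; apply: definable_ext (definable_not (definable_exv
  (Q := fun K S v w => ~ Q K S v w) (definable_not dQ))).
move=> K S _ v; split=> [H w|H [w]]; last by apply.
by apply: contrapT => nQ; apply: H; exists w.
Qed.

Definition tdefinable (g : forall K : fieldType, (nat -> K) -> K) : Prop :=
  exists t : term void, forall (K : fieldType) (c : void -> K) v, teval c v t = g K v.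

Lemma definable_eq g1 g2 : tdefinable g1 -> tdefinable g2 ->
  definable (fun K S v => g1 K v = g2 K v).
Proof. by case=> t1 H1 [t2 H2]; exists (feq R t1 t2) => K S _ v /=; rewrite H1 H2. Qed.

Lemma tdefinable_var x : tdefinable (fun K v => v x).
Proof. by exists (tvar _ x). Qed.

Lemma tdefinable_term t : tdefinable (fun K v => teval (of_void K) v t).
Proof.
by exists t => K c v; congr teval; apply/funext; case.
Qed.

Lemma tdefinable0 : tdefinable (fun K v => 0).
Proof. by exists (tzero _). Qed.

Lemma tdefinable1 : tdefinable (fun K v => 1).
Proof. by exists (tone _). Qed.

Lemma tdefinableD g1 g2 : tdefinable g1 -> tdefinable g2 -> tdefinable (fun K v => g1 K v + g2 K v).
Proof. by case=> t1 H1 [t2 H2]; exists (tadd t1 t2) => K c v /=; rewrite H1 H2. Qed.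

Lemma tdefinableN g : tdefinable g -> tdefinable (fun K v => - g K v).
Proof. by case=> t H; exists (topp t) => K c v /=; rewrite H. Qed.

Lemma tdefinableM g1 g2 : tdefinable g1 -> tdefinable g2 -> tdefinable (fun K v => g1 K v * g2 K v).
Proof. by case=> t1 H1 [t2 H2]; exists (tmul t1 t2) => K c v /=; rewrite H1 H2. Qed.

Lemma tdefinableX g n : tdefinable g -> tdefinable (fun K v => g K v ^+ n).
Proof.
move=> dg; elim: n => [|n [t Ht]].
  by case: tdefinable1 => t Ht; exists t => K c v; rewrite Ht expr0.
have [t' Ht'] := tdefinableM dg (ex_intro _ t Ht).
by exists t' => K c v; rewrite Ht' exprS.
Qed.

Lemma tdefinable_sum (J : Type) (s : seq J) (g : J -> forall K : fieldType, (nat -> K) -> K) :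
  (forall j, tdefinable (g j)) -> tdefinable (fun K v => \sum_(j <- s) g j K v).
Proof.
move=> dg; elim: s => [|j s [t Ht]].
  by case: tdefinable0 => t Ht; exists t => K c v; rewrite Ht big_nil.
have [t' Ht'] := tdefinableD (dg j) (ex_intro _ t Ht).
by exists t' => K c v; rewrite Ht' big_cons.
Qed.

Lemma tdefinable_prod (J : Type) (s : seq J) (g : J -> forall K : fieldType, (nat -> K) -> K) :
  (forall j, tdefinable (g j)) -> tdefinable (fun K v => \prod_(j <- s) g j K v).
Proof.
move=> dg; elim: s => [|j s [t Ht]].
  by case: tdefinable1 => t Ht; exists t => K c v; rewrite Ht big_nil.
have [t' Ht'] := tdefinableM (dg j) (ex_intro _ t Ht).
by exists t' => K c v; rewrite Ht' big_cons.
Qed.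

Lemma tdefinable_rename (r : nat -> nat) g : tdefinable g -> tdefinable (fun K v => g K (v \o r)).
Proof. by case=> t Ht; exists (trename r t) => K c v; rewrite teval_trename Ht. Qed.

End Definable.

Lemma fcat_comp (K L : Type) (h : K -> L) n (a : 'I_n -> K) (e : nat -> K) :
  h \o fcat a e = fcat (h \o a) (h \o e).
Proof. by apply/funext => x; rewrite /fcat /=; case: insub. Qed.

Lemma fcat_lt (K : Type) n (a : 'I_n -> K) (e : nat -> K) (i : 'I_n) : fcat a e i = a i.
Proof. by rewrite /fcat valK. Qed.

Lemma fcat_ge (K : Type) n (a : 'I_n -> K) (e : nat -> K) x : fcat a e (n + x)%N = e x.
Proof. by rewrite /fcat insubN ?addKn //; lia. Qed.

Definition qequiv (R : signature) (T : theory R) (f g : formula R void) : Prop :=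
  forall (K : fieldType) (S : struct R void K), models S T -> forall v, sat S v f <-> sat S v g.

Lemma definable_qf (R : signature) (T : theory R) (P : vpred R) :
  elim_quantifiers T -> definable T P ->
  exists f, qf f /\ forall K (S : struct R void K), models S T -> forall v, sat S v f <-> P K S v.
Proof.
move=> qe [f Hf]; have [g [qg _ Hg]] := qe f.
by exists g; split=> // K S mS v; rewrite -Hg // Hf.
Qed.

(** * Changes of language *)

Section Languages.

Fixpoint tembed (C : Type) (t : term void) : term C :=
  match t with
  | tvar x => tvar C x
  | tcst a => match a with end
  | tzero => tzero C
  | tone => tone C
  | tadd t1 t2 => tadd (tembed C t1) (tembed C t2)
  | topp t1 => topp (tembed C t1)
  | tmul t1 t2 => tmul (tembed C t1) (tembed C t2)
  end.

Lemma teval_tembed (C : Type) (K : fieldType) (c : C -> K) c' v t :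
  teval c v (tembed C t) = teval c' v t.
Proof. by elim: t => //= [t1 -> t2 ->|t ->|t1 -> t2 ->]. Qed.

Variables (I : finType) (L : I -> signature) (C : Type).

Fixpoint lembed (i : I) (f : formula (L i) void) : formula (sig_union L) C :=
  match f with
  | feq t1 t2 => feq _ (tembed C t1) (tembed C t2)
  | frel s ts => @frel (sig_union L) C (Tagged (fun i => rsym (L i)) s)
                   (fun k => tembed C (ts k))
  | fnot g => fnot (lembed g)
  | fand g1 g2 => fand (lembed g1) (lembed g2)
  | fall x g => fall x (lembed g)
  | fex x g => fex x (lembed g)
  end.

Lemma sat_lembed (K : fieldType) (S : struct (sig_union L) C K) i v (f : formula (L i) void) :
  sat S v (lembed f) <-> sat (reduct_i S i) v f.
Proof.
elim: f v => [t1 t2|s ts|g IH|g1 IH1 g2 IH2|x g IH|x g IH] v /=.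
- by rewrite !(teval_tembed _ (cint (reduct_i S i))).
- suff -> : (fun k => teval (cint S) v (tembed C (ts k))) =
      (fun k => teval (cint (reduct_i S i)) v (ts k)) by [].
  by apply/funext => k; apply: teval_tembed.
- by rewrite IH.
- by rewrite IH1 IH2.
- by split=> H a; apply/IH.
- by split=> -[a /IH]; exists a.
Qed.

Lemma qf_lembed i (f : formula (L i) void) : qf f -> qf (lembed f).
Proof. by elim: f => //= g1 IH1 g2 IH2 [/IH1 ? /IH2]. Qed.

End Languages.

Section Constants.
Variables (R : signature) (C : countType).

Definition cval (K : fieldType) (S : struct R C K) : nat -> K :=
  fun x => oapp (cint S) 0 (unpickle x).

(** Variables move to the even places, and a constant becomes the odd variable given by its code,
    which no quantifier of [fparam] binds. *)
Fixpoint tparam (t : term C) : term void :=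
  match t with
  | tvar x => tvar _ x.*2
  | tcst a => tvar _ (pickle a).*2.+1
  | tzero => tzero _
  | tone => tone _
  | tadd t1 t2 => tadd (tparam t1) (tparam t2)
  | topp t1 => topp (tparam t1)
  | tmul t1 t2 => tmul (tparam t1) (tparam t2)
  end.

Fixpoint fparam (f : formula R C) : formula R void :=
  match f with
  | feq t1 t2 => feq R (tparam t1) (tparam t2)
  | frel s ts => frel (fun i => tparam (ts i))
  | fnot g => fnot (fparam g)
  | fand g1 g2 => fand (fparam g1) (fparam g2)
  | fall x g => fall x.*2 (fparam g)
  | fex x g => fex x.*2 (fparam g)
  end.

Lemma teval_tparam (K : fieldType) (S : struct R C K) c v t :
  teval c (vmix v (cval S)) (tparam t) = teval (cint S) v t.
Proof.
elim: t => [x|a|||t1 /= -> t2 ->|t /= ->|t1 /= -> t2 ->] //=.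
  by rewrite -/(vfst (vmix v (cval S)) x) vfst_mix.
by rewrite -/(vsnd (vmix v (cval S)) (pickle a)) vsnd_mix /cval pickleK.
Qed.

Lemma upd_vmix (K : Type) (v c : nat -> K) x a :
  upd (vmix v c) x.*2 a = vmix (upd v x a) c.
Proof.
apply/funext => y; rewrite /upd /vmix; case oy: (odd y).
  by case: eqP => // yx; move: oy; rewrite yx odd_double.
suff -> : (y == x.*2) = (y./2 == x) by [].
by apply/eqP/eqP; have := odd_double_half y; rewrite oy; lia.
Qed.

Lemma sat_fparam (K : fieldType) (S : struct R C K) v f :
  sat (reduct_I S) (vmix v (cval S)) (fparam f) <-> sat S v f.
Proof.
elim: f v => [t1 t2|s ts|g IH|g1 IH1 g2 IH2|x g IH|x g IH] v /=.
- by rewrite !teval_tparam.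
- by under eq_fun do rewrite teval_tparam.
- by rewrite IH.
- by rewrite IH1 IH2.
- by split=> H a; move: (H a); rewrite upd_vmix IH.
- by split=> -[a H]; exists a; move: H; rewrite upd_vmix IH.
Qed.

(** The values of the constants are preserved by the embedding, hence may be treated as parameters
    of a formula of the reduct. *)
Lemma elementary_reduct (K M : fieldType) (SK : struct R C K) (SM : struct R C M)
    (h : {rmorphism K -> M}) :
  extension SK SM h -> elementary (reduct_I SK) (reduct_I SM) h -> elementary SK SM h.
Proof.
move=> [_ hc] el f v; rewrite -sat_fparam el -[X in _ <-> X]sat_fparam.
suff -> : (fun x => h (vmix v (cval SK) x)) = vmix (fun x => h (v x)) (cval SM) by [].
apply/funext => x; rewrite /vmix; case: ifP => // _; rewrite /cval.
by case: unpickle => [c|] /=; rewrite ?hc ?rmorph0.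
Qed.

End Constants.

(** * Ultraproducts and compactness *)

Record ultra (J : Type) := Ultra {
  umem :> (J -> Prop) -> Prop;
  ultraS : forall A B : J -> Prop, (forall j, A j -> B j) -> umem A -> umem B;
  ultraI : forall A B : J -> Prop, umem A -> umem B -> umem (fun j => A j /\ B j);
  ultraN : forall A : J -> Prop, umem (fun j => ~ A j) <-> ~ umem A }.

Lemma ultra_exists (J : Type) (F : (J -> Prop) -> Prop) :
  (exists A, F A) ->
  (forall A B, F A -> F B -> exists C, F C /\ forall j, C j -> A j /\ B j) ->
  (forall A, F A -> exists j, A j) ->
  exists U : ultra J, forall A, F A -> U A.
Proof.
move=> F0 FI Fne.
pose G : classical_sets.set_system J := fun B => exists A, F A /\ forall j, A j -> B j.
have GF : filter.ProperFilter G.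
  apply: filter.Build_ProperFilter_ex.
    by move=> B [A [/Fne[j Aj] AB]]; exists j; apply: AB.
  split.
  - by case: F0 => A FA; exists A.
  - move=> A B [A' [FA AA]] [B' [FB BB]]; have [C [FC HC]] := FI _ _ FA FB.
    by exists C; split=> // j /HC[/AA ? /BB].
  - by move=> A B AB [A' [FA AA]]; exists A'; split=> // j /AA /AB.
have [H [UH GH]] := filter.ultraFilterLemma GF.
have pH := @filter.ultra_proper _ _ UH.
have HI : forall A B : J -> Prop, H A -> H B -> H (fun j => A j /\ B j).
  by move=> A B HA HB; apply: filter.filterI.
have HS : forall A B : J -> Prop, (forall j, A j -> B j) -> H A -> H B.
  by move=> A B AB HA; apply: filter.filterS HA.
have H0 : ~ H (fun=> False) by move=> /filter.filter_ex[].
have HN : forall A : J -> Prop, H (fun j => ~ A j) <-> ~ H A.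
  move=> A; split=> [nA /(HI _ _ nA) HA|nA].
    by apply: H0; apply: HS HA => j [].
  by case: (filter.in_ultra_setVsetC A UH).
exists (Ultra HS HI HN) => A FA; apply: GH.
by exists A.
Qed.

Section UltraOps.
Variables (J : Type) (U : ultra J).
Implicit Types A B : J -> Prop.

Lemma ultraT A : (forall j, A j) -> U A.
Proof.
move=> HA; apply: contrapT => /ultraN nA; apply: (proj1 (ultraN U A) nA).
exact: ultraS nA.
Qed.

Lemma ultra_iff A B : U (fun j => A j <-> B j) -> U A <-> U B.
Proof.
by move=> AB; split=> H; apply: ultraS (ultraI AB H) => j [[]]; auto.
Qed.

Lemma ultra_ex A : U A -> exists j, A j.
Proof.
move=> UA; apply: contrapT => nA.
by apply: (proj1 (ultraN U A)) UA; apply: ultraT => j Aj; apply: nA; exists j.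
Qed.

Lemma ultra_and A B : U (fun j => A j /\ B j) <-> U A /\ U B.
Proof.
split=> [H|[]]; last exact: ultraI.
by split; apply: ultraS H => j [].
Qed.

Lemma ultra_all_fin (X : finType) (A : X -> J -> Prop) :
  (forall x, U (A x)) -> U (fun j => forall x, A x j).
Proof.
move=> HA; suff : U (fun j => forall x, x \in enum X -> A x j).
  by apply: ultraS => j H x; apply: H; rewrite mem_enum.
elim: (enum X) => [|y s IH]; first exact: ultraT.
apply: ultraS (ultraI (HA y) IH) => j [H1 H2] x.
by rewrite inE => /orP[/eqP ->|/H2].
Qed.

End UltraOps.

Section Ultraproduct.
Variables (J : Type) (K : J -> fieldType) (U : ultra J).

Let X := forall j, K j.

Definition ueq (x y : X) := U (fun j => x j = y j).

(** A chosen representative of each class: the ultraproduct is the type of families fixed by [urep],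
    so that equality of classes is equality. *)
Definition urep (x : X) : X :=
  if pselect (exists y, ueq x y) is left e then projT1 (cid e) else x.

Lemma ueq_refl x : ueq x x.
Proof. exact: ultraT. Qed.

Lemma ueq_urep x : ueq x (urep x).
Proof.
rewrite /urep; case: pselect => [e|n]; first by case: (cid e).
exact: ueq_refl.
Qed.

Lemma ueq_sym x y : ueq x y -> ueq y x.
Proof. exact: ultraS. Qed.

Lemma ueq_trans x y z : ueq x y -> ueq y z -> ueq x z.
Proof. by move=> xy yz; apply: ultraS (ultraI xy yz) => j [->]. Qed.

Lemma urep_eq x y : ueq x y -> urep x = urep y.
Proof.
move=> xy; have E : ueq x = ueq y.
  apply/funext => z; apply/propext; split; last exact: ueq_trans.
  by apply: ueq_trans; apply: ueq_sym.
rewrite /urep E; case: pselect => // n.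
by exfalso; apply: n; exists y; apply: ueq_refl.
Qed.

Record uprod := UProd { uval : X; _ : urep uval = uval }.

HB.instance Definition _ := gen_eqMixin uprod.
HB.instance Definition _ := gen_choiceMixin uprod.

Lemma urepK x : urep (urep x) = urep x.
Proof. by apply/urep_eq/ueq_sym/ueq_urep. Qed.

Definition ucls (x : X) : uprod := UProd (urepK x).

Lemma ucls_eq x y : ucls x = ucls y <-> ueq x y.
Proof.
split=> [[E]|/urep_eq E]; last first.
  rewrite /ucls; move: (urepK x) (urepK y); rewrite E => p q.
  by congr UProd; apply: Prop_irrelevance.
by apply: ueq_trans (ueq_urep x) _; rewrite E; apply/ueq_sym/ueq_urep.
Qed.

Lemma uvalK z : ucls (uval z) = z.
Proof.
case: z => x p; rewrite /ucls /=; move: (urepK x); rewrite p => q.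
by congr UProd; apply: Prop_irrelevance.
Qed.

Lemma uclsK x : ueq (uval (ucls x)) x.
Proof. exact/ueq_sym/ueq_urep. Qed.

Definition uzero := ucls (fun=> 0).
Definition uone := ucls (fun=> 1).
Definition uadd x y := ucls (fun j => uval x j + uval y j).
Definition uopp x := ucls (fun j => - uval x j).
Definition umul x y := ucls (fun j => uval x j * uval y j).
Definition uinv x := ucls (fun j => (uval x j)^-1).

Lemma uaddE x y : uadd (ucls x) (ucls y) = ucls (fun j => x j + y j).
Proof. by apply/ucls_eq; apply: ultraS (ultraI (uclsK x) (uclsK y)) => j [-> ->]. Qed.
Lemma umulE x y : umul (ucls x) (ucls y) = ucls (fun j => x j * y j).
Proof. by apply/ucls_eq; apply: ultraS (ultraI (uclsK x) (uclsK y)) => j [-> ->]. Qed.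
Lemma uoppE x : uopp (ucls x) = ucls (fun j => - x j).
Proof. by apply/ucls_eq; apply: ultraS (uclsK x) => j ->. Qed.
Lemma uinvE x : uinv (ucls x) = ucls (fun j => (x j)^-1).
Proof. by apply/ucls_eq; apply: ultraS (uclsK x) => j ->. Qed.

Lemma uaddA : associative uadd.
Proof.
move=> x y z; rewrite -(uvalK x) -(uvalK y) -(uvalK z) !uaddE.
by congr ucls; apply: functional_extensionality_dep => j; rewrite addrA.
Qed.
Lemma uaddC : commutative uadd.
Proof.
move=> x y; rewrite -(uvalK x) -(uvalK y) !uaddE.
by congr ucls; apply: functional_extensionality_dep => j; rewrite addrC.
Qed.
Lemma uadd0 : left_id uzero uadd.
Proof.
move=> x; rewrite -(uvalK x) /uzero !uaddE.
by congr ucls; apply: functional_extensionality_dep => j; rewrite add0r.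
Qed.
Lemma uaddN : left_inverse uzero uopp uadd.
Proof.
move=> x; rewrite -(uvalK x) uoppE !uaddE.
by congr ucls; apply: functional_extensionality_dep => j; rewrite addNr.
Qed.
HB.instance Definition _ := GRing.isZmodule.Build uprod uaddA uaddC uadd0 uaddN.

Lemma umulA : associative umul.
Proof.
move=> x y z; rewrite -(uvalK x) -(uvalK y) -(uvalK z) !umulE.
by congr ucls; apply: functional_extensionality_dep => j; rewrite mulrA.
Qed.
Lemma umulC : commutative umul.
Proof.
move=> x y; rewrite -(uvalK x) -(uvalK y) !umulE.
by congr ucls; apply: functional_extensionality_dep => j; rewrite mulrC.
Qed.
Lemma umul1 : left_id uone umul.
Proof.
move=> x; rewrite -(uvalK x) /uone !umulE.
by congr ucls; apply: functional_extensionality_dep => j; rewrite mul1r.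
Qed.
Lemma umulD : left_distributive umul (+%R : uprod -> uprod -> uprod).
Proof.
move=> x y z; change (umul (uadd x y) z = uadd (umul x z) (umul y z)).
rewrite -(uvalK x) -(uvalK y) -(uvalK z) (uaddE (uval x)) !umulE uaddE.
by congr ucls; apply: functional_extensionality_dep => j; rewrite mulrDl.
Qed.
Lemma uone_neq0 : uone != 0.
Proof.
apply/eqP => /ucls_eq/ultra_ex[j /eqP].
by rewrite oner_eq0.
Qed.
HB.instance Definition _ :=
  GRing.Zmodule_isComNzRing.Build uprod umulA umulC umul1 umulD uone_neq0.

Lemma umulVf (x : uprod) : x != 0 -> umul (uinv x) x = 1.
Proof.
rewrite -(uvalK x) => nz; rewrite uinvE umulE; apply/ucls_eq.
apply: (@ultraS _ U (fun j => ~ uval x j = 0)) => [j /eqP ?|]; first by rewrite mulVf.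
by apply/ultraN => /ucls_eq E; move/eqP: nz.
Qed.
Lemma uinv0 : uinv 0 = 0.
Proof. by rewrite -[0]/uzero uinvE; congr ucls; apply: functional_extensionality_dep => j; rewrite invr0. Qed.
HB.instance Definition _ := GRing.ComNzRing_isField.Build uprod umulVf uinv0.

Variables (R : signature) (C : Type) (S : forall j, struct R C (K j)).

Definition ustruct : struct R C uprod :=
  Struct (fun r a => U (fun j => rint (S j) (fun k => uval (a k) j)))
         (fun c => ucls (fun j => cint (S j) c)).

Lemma ueval v (t : term C) :
  U (fun j => uval (teval (cint ustruct) v t) j = teval (cint (S j)) (fun x => uval (v x) j) t).
Proof.
elim: t => [x|c|||t1 H1 t2 H2|t H|t1 H1 t2 H2] /=; try exact: uclsK.
- exact: ultraT.
- have H3 := uclsK (fun j => uval (teval (cint ustruct) v t1) j + uval (teval (cint ustruct) v t2) j).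
  by apply: ultraS (ultraI (ultraI H1 H2) H3) => j [[<- <-] <-].
- have H3 := uclsK (fun j => - uval (teval (cint ustruct) v t) j).
  by apply: ultraS (ultraI H H3) => j [<- <-].
- have H3 := uclsK (fun j => uval (teval (cint ustruct) v t1) j * uval (teval (cint ustruct) v t2) j).
  by apply: ultraS (ultraI (ultraI H1 H2) H3) => j [[<- <-] <-].
Qed.

Lemma Los v (f : formula R C) :
  sat ustruct v f <-> U (fun j => sat (S j) (fun x => uval (v x) j) f).
Proof.
have key (g : formula R C) w x a : U (fun j => sat (S j) (fun y => uval (upd w x a y) j) g)
    <-> U (fun j => sat (S j) (upd (fun y => uval (w y) j) x (uval a j)) g).
  suff E j : (fun y => uval (upd w x a y) j) = upd (fun y => uval (w y) j) x (uval a j).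
    by apply: ultra_iff; apply: ultraT => j; rewrite E.
  by apply/funext => y; rewrite /upd; case: eqP.
elim: f v => [t1 t2|r ts|g IH|g1 IH1 g2 IH2|x g IH|x g IH] v /=.
- rewrite -(uvalK (teval _ v t1)) -(uvalK (teval _ v t2)) ucls_eq.
  apply: ultra_iff; apply: ultraS (ultraI (ueval v t1) (ueval v t2)) => j [-> ->] //.
- apply: ultra_iff; have H := ultra_all_fin (fun k => ueval v (ts k)).
  by apply: ultraS H => j H; rewrite (funext H).
- by rewrite IH ultraN.
- by rewrite IH1 IH2 ultra_and.
- split=> [H|H a]; last first.
    by apply/IH/key; apply: ultraS H => j.
  apply: contrapT => /ultraN H'.
  (* A counterexample in each factor that has one, and 0 in the others. *)
  pose b j : K j := if pselect (exists c, ~ sat (S j) (upd (fun y => uval (v y) j) x c) g)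
    is left e then projT1 (cid e) else 0.
  have /IH/key Hb := H (ucls b).
  have [j [[Hj nHj] E]] := ultra_ex (ultraI (ultraI Hb H') (uclsK b)).
  move: Hj; rewrite E /b; case: pselect => [e|]; first by case: (cid e).
  by move=> + _; apply; apply: contrapT => ne; apply: nHj => c; apply: contrapT => nc; apply: ne; exists c.
- split=> [[a /IH/key H]|H]; first by apply: ultraS H => j; exists (uval a j).
  pose b j : K j := if pselect (exists c, sat (S j) (upd (fun y => uval (v y) j) x c) g)
    is left e then projT1 (cid e) else 0.
  exists (ucls b); apply/IH/key; apply: ultraS (ultraI H (uclsK b)) => j [[c Hc] ->].
  rewrite /b; case: pselect => [e|]; first by case: (cid e).
  by case; exists c.
Qed.

End Ultraproduct.

(** The elements of [A] serve as names, so that diagrams can be used without enlarging the language.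
    The model is an ultraproduct indexed by the finite subsets of [G], along an ultrafilter
    containing, for each finite [s], the set of those that include [s]. *)
Theorem compactness (R : signature) (C A : Type)
    (G : formula R C -> (nat -> A) -> Prop) :
  (forall s : seq (formula R C * (nat -> A)),
    (forall x, List.In x s -> G x.1 x.2) ->
    exists (K : fieldType) (S : struct R C K) (h : A -> K),
      forall x, List.In x s -> sat S (h \o x.2) x.1) ->
  exists (K : fieldType) (S : struct R C K) (h : A -> K),
    forall f e, G f e -> sat S (h \o e) f.
Proof.
move=> fin; pose X := (formula R C * (nat -> A))%type.
pose J := {s : seq X | forall x, List.In x s -> G x.1 x.2}.
pose model (j : J) (M : {K : fieldType & (struct R C K * (A -> K))%type}) :=
  forall x, List.In x (sval j) -> sat (projT2 M).1 ((projT2 M).2 \o x.2) x.1.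
have /choice[M HM] : forall j : J, exists M, model j M.
  by move=> [s gs]; have [K [S [h H]]] := fin s gs; exists (existT _ K (S, h)).
pose above (s : seq X) (j : J) := forall x, List.In x s -> List.In x (sval j).
pose F (B : J -> Prop) := exists s : seq X, (forall x, List.In x s -> G x.1 x.2) /\ B = above s.
have [U HU] : exists U : ultra J, forall B, F B -> U B.
  apply: ultra_exists.
  - by exists (above [::]), [::].
  - move=> _ _ [s1 [g1 ->]] [s2 [g2 ->]]; exists (above (s1 ++ s2)); split.
      by exists (s1 ++ s2); split=> // x /List.in_app_iff[/g1|/g2].
    by move=> j H; split=> x xs; apply/H/List.in_app_iff; [left|right].
  - by move=> _ [s [gs ->]]; exists (exist _ s gs).
pose KK j := projT1 (M j); pose SS j := (projT2 (M j)).1.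
exists (uprod KK U), (ustruct U SS), (fun a => ucls U (fun j => (projT2 (M j)).2 a)).
move=> f e Gfe; apply/Los.
have [B [HB _]] := sat_bound f.
have Hval : U (fun j => forall x : 'I_B,
    uval (ucls U (fun j => (projT2 (M j)).2 (e x))) j = (projT2 (M j)).2 (e x)).
  by apply: ultra_all_fin => x; apply: uclsK.
have Hin : U (above [:: (f, e)]).
  by apply: HU; exists [:: (f, e)]; split=> // x [<-|].
apply: ultraS (ultraI Hval Hin) => j [Hj Hin'].
rewrite (HB _ _ _ ((projT2 (M j)).2 \o e)) => [|x xB]; last exact: (Hj (Ordinal xB)).
by apply: (HM j (f, e)); apply: Hin'; left.
Qed.

(** * Extensions and models *)

Section Diagrams.
Variable R : signature.

(* A finite part of the diagram of [K]; the map [i] names the elements.      *)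
Lemma diag_point (K : fieldType) (S : struct R void K) f e : qf f -> sat S e f ->
  exists g v0 (i : K -> nat), [/\ qf g, sat S v0 g &
    forall (N : fieldType) (SN : struct R void N) v, sat SN v g -> sat SN ((v \o i) \o e) f].
Proof.
move=> qff Hf; have [B [HB _]] := sat_bound f.
pose us := undup [seq e x | x <- iota 0 B].
exists (frename (fun x => index (e x) us) f), (nth 0 us), (fun b => index b us); split.
- exact: qf_frename.
- apply/sat_frename; first by right.
  rewrite (HB _ _ _ e) // => x xB /=; apply: nth_index.
  by rewrite mem_undup map_f // mem_iota.
- by move=> N SN v /sat_frename; apply; right.
Qed.

Definition diagram (K : fieldType) (S : struct R void K) (A : Type) (i : K -> A)
    (f : formula R void) (e : nat -> A) :=
  exists e', [/\ e = i \o e', qf f & sat S e' f].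

Lemma diagram_embed (K N : fieldType) (SK : struct R void K) (SN : struct R void N)
    (A : Type) (i : K -> A) (h : A -> N) :
  (forall f e, diagram SK i f e -> sat SN (h \o e) f) ->
  exists k : {rmorphism K -> N}, (forall x, k x = h (i x)) /\ extension SK SN k.
Proof.
move=> H; have D f e : qf f -> sat SK e f -> sat SN (h \o i \o e) f.
  by move=> qff Hf; apply: (H f (i \o e)); exists e.
pose k := h \o i.
have kB : zmod_morphism k.
  move=> x y; have := D (feq R (tvar _ 0) (tadd (tvar _ 1) (topp (tvar _ 2))))
    (nth 0 [:: x - y; x; y]) I erefl; exact.
have kM : monoid_morphism k.
  split; first by have := D (feq R (tvar _ 0) (tone _)) (fun=> 1) I erefl.
  move=> x y; have := D (feq R (tvar _ 0) (tmul (tvar _ 1) (tvar _ 2)))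
    (nth 0 [:: x * y; x; y]) I erefl; exact.
pose ka := GRing.isZmodMorphism.Build K N k kB.
pose km := GRing.isMonoidMorphism.Build K N k kM.
pose kr : {rmorphism K -> N} := HB.pack k ka km.
exists kr; split=> //; split=> [r a|[]].
pose e x := if insub x is Some j then a j else 0.
have Ea (j : 'I_(arity r)) : e j = a j by rewrite /e valK.
have D1 : ~ rint SK (fun j : 'I_(arity r) => e j) -> ~ rint SN (fun j : 'I_(arity r) => k (e j)).
  exact: (D (fnot (frel (fun j : 'I__ => tvar void j))) e I).
have D2 : rint SK (fun j : 'I_(arity r) => e j) -> rint SN (fun j : 'I_(arity r) => k (e j)).
  exact: (D (frel (fun j : 'I__ => tvar void j)) e I).
move: D1 D2; rewrite (_ : (fun j : 'I__ => k (e j)) = fun j => kr (a j)); last first.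
  by apply/funext => j /=; rewrite Ea.
rewrite (_ : (fun j : 'I__ => e j) = a); last exact: funext.
by move=> D1 D2; split=> // ra; apply: contrapT => /D1.
Qed.

Lemma extension_sat (K N : fieldType) (SK : struct R void K) (SN : struct R void N)
    (h : {rmorphism K -> N}) v f :
  extension SK SN h -> qf f -> sat SK v f <-> sat SN (h \o v) f.
Proof.
move=> [hr hc]; have ht t : teval (cint SN) (h \o v) t = h (teval (cint SK) v t).
  elim: t => [x|[]|||t1 /= -> t2 ->|t /= ->|t1 /= -> t2 ->] //=;
    by rewrite ?(rmorph0, rmorph1, rmorphD, rmorphN, rmorphM).
elim: f => //= [t1 t2 _|r ts _|g IH /IH -> //|g1 IH1 g2 IH2 [/IH1 -> /IH2 -> //]].
  by rewrite !ht; split=> [->|/fmorph_inj].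
by rewrite hr; under eq_fun do rewrite -ht.
Qed.

Lemma models_sub (T : theory R) (K N : fieldType) (SK : struct R void K) (SN : struct R void N)
    (h : {rmorphism K -> N}) :
  extension SK SN h -> models SN (univ_conseq T) -> models SK (univ_conseq T).
Proof.
move=> ext mN f Tf v; have := mN f Tf (h \o v); case: Tf => + _.
elim: (sval f) v => [t1 t2|s ts|g _|g1 _ g2 _|x g IH|x g _] v //=.
- by move=> u; apply: (proj2 (extension_sat v (f := feq R t1 t2) ext u)).
- by move=> u; apply: (proj2 (extension_sat v (f := frel ts) ext u)).
- by move=> u; apply: (proj2 (extension_sat v (f := fnot g) ext u)).
- by move=> u; apply: (proj2 (extension_sat v (f := fand g1 g2) ext u)).
move=> ug H a; apply: IH => //; have := H (h a).
by congr sat; apply/funext => y; rewrite /upd /=; case: eqP.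
Qed.

Lemma models_univ (T : theory R) (N : fieldType) (S : struct R void N) :
  models S T -> models S (univ_conseq T).
Proof. by move=> mS f [_ Hf] v; apply: Hf. Qed.


(* The formulas of the diagram occurring in a finite set amount to one.      *)
Lemma diagram_merge (K : fieldType) (SK : struct R void K) (A : Type) (i : K -> A)
    (G : formula R void -> (nat -> A) -> Prop) s :
  (forall x, List.In x s -> G x.1 x.2 \/ diagram SK i x.1 x.2) ->
  exists f e, [/\ qf f, sat SK e f & forall (N : fieldType) (SN : struct R void N) (h : A -> N),
    sat SN (h \o i \o e) f -> forall x, List.In x s -> ~ G x.1 x.2 -> sat SN (h \o x.2) x.1].
Proof.
elim: s => [|[f e] s IH] H; first by exists (feq R (tzero _) (tzero _)), (fun=> 0).
have [g [e' [qg He' Hg]]] := IH (fun x xs => H x (or_intror xs)).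
have [/= Gf|[/= e0 [-> qff Hf]]] := H _ (or_introl erefl).
  by exists g, e'; split=> // N SN h /Hg Hs x [<- //|/Hs].
exists (fand (frename double f) (frename (fun x => x.*2.+1) g)), (vmix e0 e'); split.
- by split; apply: qf_frename.
- split; apply/sat_frename; try by right.
    by rewrite -[_ \o _]/(vfst _) vfst_mix.
  by rewrite -[_ \o _]/(vsnd _) vsnd_mix.
move=> N SN h [/sat_frename H1 /sat_frename H2] x [<- _|xs] /=; last first.
  apply: (Hg N SN h) => //; have := H2 (or_intror qg).
  by rewrite vmix_comp -[_ \o (fun _ => _)]/(vsnd _) vsnd_mix.
by have := H1 (or_intror qff); rewrite vmix_comp -[_ \o double]/(vfst _) vfst_mix.
Qed.

(** If the diagram of K were inconsistent with T, some quantifier-free [g] true at a tuple of K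
    would be refuted by T; the universal closure of its negation would then be a universal
    consequence of T that fails in K. *)
Lemma univ_model (T : theory R) (K : fieldType) (S : struct R void K) :
  models S (univ_conseq T) ->
  exists (N : fieldType) (SN : struct R void N) (h : {rmorphism K -> N}),
    models SN T /\ extension S SN h.
Proof.
move=> mK; pose G f (e : nat -> K) := exists s : sentence R, T s /\ f = sval s.
have [|N [SN [h H]]] := @compactness R void K (fun f e => G f e \/ diagram S id f e).
  move=> s Hs; have [f [e [qff He Hf]]] := diagram_merge Hs.
  have [g [v0 [i [qg Hg Hi]]]] := diag_point qff He.
  suff [N [SN [mN [v Hv]]]] : exists (N : fieldType) (SN : struct R void N),
      models SN T /\ exists v, sat SN v g.
    exists N, SN, (v \o i) => x xs; case: (pselect (G x.1 x.2)) => [[t [Tt ->]]|nG].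
      exact: mN.
    by apply: Hf => //; apply: Hi.
  apply: contrapT => no; have [B [HB FB]] := sat_bound (fnot g).
  have cl x : ~ free (fallb B (fnot g)) x.
    by move=> /free_foldr_fall[]; rewrite mem_iota /= add0n => /negP + /FB.
  have Tu : univ_conseq T (exist _ _ cl).
    split; first exact: universal_foldr_fall.
    move=> N SN mN v; apply/sat_foldr_fall => w _ Hw.
    by apply: no; exists N, SN; split=> //; exists w.
  have /sat_foldr_fall Hn := mK _ Tu v0.
  by apply: (Hn v0 (fun _ _ => erefl)).
have [k [hk ext]] := diagram_embed (fun f e D => H f e (or_intror D)).
exists N, SN, k; split=> // s Ts v.
have := H (sval s) (fun=> 0) (or_introl (ex_intro _ s (conj Ts erefl))).
by apply: (proj1 (sat_free _ _)) => x fx; case: (proj2_sig s x fx).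
Qed.

(* Existential closedness, for a single block of quantifiers.                *)
Definition ec (K F : fieldType) (SK : struct R void K) (SF : struct R void F)
    (h : K -> F) :=
  forall g n v, qf g -> (exists a : 'I_n -> F, sat SF (fcat a (h \o v)) g) ->
    exists a : 'I_n -> K, sat SK (fcat a v) g.

Lemma exist_closed_ec (K F : fieldType) (SK : struct R void K) (SF : struct R void F)
    (h : {rmorphism K -> F}) : exist_closed SK SF h <-> ec SK SF h.
Proof.
split=> H.
  move=> g n v qg [a Ha].
  have := H _ (fcat (fun _ : 'I_n => 0) v) (existential_fexs (iota 0 n) qg).
  case/(_ _)/sat_fexs => [|w [Hw sw]].
    apply/sat_fexs; exists (fcat a (h \o v)); split=> // x.
    by rewrite mem_iota add0n /fcat /=; case: insubP => [[j jn] /= _ <-|//]; rewrite jn.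
  exists (fun i : 'I_n => w i); suff -> : fcat (fun i : 'I_n => w i) v = w by [].
  apply/funext => x; rewrite /fcat /=; case: insubP => [j _ <- //|nx].
  by rewrite Hw ?mem_iota ?add0n // /fcat insubN.
move=> f v /existential_fexsP[s [g [-> qg]]] /sat_fexs[w [Hw sw]].
pose r x := if x \in s then index x s else (size s + x)%N.
have [||a] := H (frename r g) (size s) v.
- exact: qf_frename.
- exists (fun i => w (nth 0%N s i)); apply/sat_frename; first by right.
  suff -> : fcat (fun i : 'I_(size s) => w (nth 0%N s i)) (h \o v) \o r = w by [].
  apply/funext => x; rewrite /= /r; case: ifP => xs; last by rewrite fcat_ge Hw ?xs.
  have lt_x : (index x s < size s)%N by rewrite index_mem.
  by rewrite (fcat_lt _ _ (Ordinal lt_x)) /= nth_index.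
move=> /sat_frename Ha; apply/sat_fexs; exists (fcat a v \o r); split; last by apply: Ha; right.
by move=> x xs; rewrite /= /r (negPf xs) fcat_ge.
Qed.

(** Elements coming from A stay parameters; the finitely many other values of [e] are existentially
    quantified and realised in A. The assignment is only a map, but a retraction of [h]. *)
Lemma ec_assign (A B : fieldType) (SA : struct R void A) (SB : struct R void B)
    (h : {rmorphism A -> B}) f e : ec SA SB h -> qf f -> sat SB e f ->
  exists k : B -> A, (forall a, k (h a) = a) /\ sat SA (k \o e) f.
Proof.
move=> Hec qf_f Hf; have [N [HN _]] := sat_bound f.
pose base b := exists a, h a = b.
pose pre b : A := if pselect (base b) is left p then projT1 (cid p) else 0.
have preK a : pre (h a) = a.
  rewrite /pre; case: pselect => [p|]; last by case; exists a.
  by apply: (fmorph_inj h); case: (cid p).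
pose us := undup [seq e x | x <- iota 0 N & ~~ `[< base (e x) >]].
pose r x := if `[< base (e x) >] then (size us + x)%N else index (e x) us.
have [||a] := Hec (frename r f) (size us) (pre \o e).
- exact: qf_frename.
- exists (fun i => nth 0 us i); apply/sat_frename; first by right.
  rewrite (HN _ _ _ e) // => x xN; rewrite /= /r; case: ifP => [/asboolP[a ea]|/negbT nb].
    by rewrite fcat_ge /= -ea preK.
  have xu : e x \in us.
    by rewrite mem_undup; apply/mapP; exists x => //; rewrite mem_filter nb mem_iota.
  have lt_x : (index (e x) us < size us)%N by rewrite index_mem.
  by rewrite (fcat_lt _ _ (Ordinal lt_x)) /= nth_index.
move=> /sat_frename Ha.
exists (fun b => if `[< base b >] then pre b else fcat a (pre \o e) (index b us)); split.
  move=> x; case: ifP => [_|/asboolP[]]; [exact: preK | by exists x].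
suff -> : (fun b => if `[< base b >] then pre b else fcat a (pre \o e) (index b us)) \o e
    = fcat a (pre \o e) \o r by apply: Ha; right.
by apply/funext => x; rewrite /= /r; case: ifP => // _; rewrite fcat_ge.
Qed.

(** By existential closedness, a finite part of the diagram of B is satisfied in A itself by an
    assignment fixing A, hence is compatible with the elementary diagram of A. *)
Lemma ec_embed (A B : fieldType) (SA : struct R void A) (SB : struct R void B)
    (h : {rmorphism A -> B}) : ec SA SB h ->
  exists (N : fieldType) (SN : struct R void N) (k : {rmorphism B -> N}),
    extension SB SN k /\ elementary SA SN (k \o h).
Proof.
move=> Hec; pose G f (e : nat -> B) := exists e', e = h \o e' /\ sat SA e' f.
have [|N [SN [k H]]] := @compactness R void B (fun f e => G f e \/ diagram SB id f e).
  move=> s Hs; have [f [e [qf_f He Hf]]] := diagram_merge Hs.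
  have [k [hk Hk]] := ec_assign Hec qf_f He.
  exists A, SA, k => x xs; case: (pselect (G x.1 x.2)) => [[e' [-> H]]|nG].
    by rewrite (_ : k \o (h \o e') = e') //; apply/funext => y /=.
  exact: Hf.
have [k' [hk ext]] := diagram_embed (fun f e D => H f e (or_intror D)).
exists N, SN, k'; split=> // f v.
have key g : sat SA v g -> sat SN (fun x => k' (h (v x))) g.
  move=> Hg; rewrite (_ : (fun _ => _) = k \o (h \o v)); last by apply/funext => x; apply: hk.
  by apply: H; left; exists v.
split; first exact: key.
by move=> Hf; apply: contrapT => /(key (fnot f)).
Qed.

End Diagrams.

(** * Subfields and algebraic elements *)

Record subfield (E : fieldType) := Subfield {
  sfmem :> E -> Prop;
  sfmem1 : sfmem 1;
  sfmemB : forall x y, sfmem x -> sfmem y -> sfmem (x - y);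
  sfmem_div : forall x y, sfmem x -> sfmem y -> sfmem (x / y) }.

Definition sfpred (E : fieldType) (P : subfield E) : {pred E} := fun x => `[< P x >].

Lemma sfpred_closed (E : fieldType) (P : subfield E) : divring_closed (sfpred P).
Proof.
split=> [|x y /asboolP Px /asboolP Py|x y /asboolP Px /asboolP Py]; apply/asboolP.
- exact: sfmem1.
- exact: sfmemB.
- exact: sfmem_div.
Qed.

HB.instance Definition _ (E : fieldType) (P : subfield E) :=
  GRing.isDivringClosed.Build E (sfpred P) (sfpred_closed P).

Definition sfsub (E : fieldType) (P : subfield E) := {x : E | x \in sfpred P}.

HB.instance Definition _ (E : fieldType) (P : subfield E) := SubType.on (sfsub P).
HB.instance Definition _ (E : fieldType) (P : subfield E) :=
  [Choice of sfsub P by <:].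
HB.instance Definition _ (E : fieldType) (P : subfield E) :=
  [SubChoice_isSubComUnitRing of sfsub P by <:].
HB.instance Definition _ (E : fieldType) (P : subfield E) :=
  [SubComUnitRing_isSubIntegralDomain of sfsub P by <:].
HB.instance Definition _ (E : fieldType) (P : subfield E) :=
  [SubIntegralDomain_isSubField of sfsub P by <:].

Fact sf_subproof (E : fieldType) (P : subfield E) :
  {F : fieldType & {f : {rmorphism F -> E} | forall x, P x <-> exists y, f y = x}}.
Proof.
exists (sfsub P : fieldType), (val : {rmorphism sfsub P -> E}) => x.
split=> [Px|[[y py] <-]]; last exact/asboolP.
by have xP : x \in sfpred P by [apply/asboolP]; exists (exist _ x xP).
Qed.

(* A subfield as a field in its own right, kept opaque.                      *)
Definition sftype (E : fieldType) (P : subfield E) : fieldType := projT1 (sf_subproof P).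
Definition sfval (E : fieldType) (P : subfield E) : {rmorphism sftype P -> E} :=
  sval (projT2 (sf_subproof P)).

Lemma sfvalP (E : fieldType) (P : subfield E) x : P x <-> exists y, sfval P y = x.
Proof. exact: svalP (projT2 (sf_subproof P)) x. Qed.

Notation ev h a p := ((map_mpoly h p).@[a]).

Definition evr (K : fieldType) (E : comNzRingType) (h : {rmorphism K -> E}) n (a : 'I_n -> E) :
  {rmorphism {mpoly K[n]} -> E} := meval a \o map_mpoly h.
Arguments evr : simpl never.

Section Evaluation.
Variables (K : fieldType) (E : comNzRingType) (h : {rmorphism K -> E}) (n : nat) (a : 'I_n -> E).

Lemma evB p q : ev h a (p - q) = ev h a p - ev h a q.
Proof. by rewrite !rmorphB. Qed.
Lemma evD p q : ev h a (p + q) = ev h a p + ev h a q.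
Proof. by rewrite !rmorphD. Qed.
Lemma evM p q : ev h a (p * q) = ev h a p * ev h a q.
Proof. by rewrite !rmorphM. Qed.
Lemma evC c : ev h a c%:MP = h c.
Proof. by rewrite map_mpolyC mevalC. Qed.
Lemma evX i : ev h a 'X_i = a i.
Proof. by rewrite map_mpolyX mevalXU. Qed.
Lemma ev0 : ev h a 0 = 0. Proof. by rewrite !rmorph0. Qed.
Lemma ev1 : ev h a 1 = 1. Proof. by rewrite !rmorph1. Qed.

Lemma evE p : ev h a p = \sum_(m <- msupp p) h p@_m * \prod_i a i ^+ m i.
Proof.
rewrite {1}[p]mpolyE -[ev h a _]/(evr h a _) rmorph_sum; apply: eq_bigr => m _ /=.
by rewrite map_mpolyZ mevalZ map_mpolyX mevalX.
Qed.

Lemma ev_comp (F : comNzRingType) (k : {rmorphism E -> F}) p :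
  ev (k \o h) (k \o a) p = k (ev h a p).
Proof.
rewrite [ev h a p]evE (rmorph_sum k) -[LHS]/(ev _ _ _).
transitivity (\sum_(m <- msupp p) k (h p@_m) * \prod_i k (a i) ^+ m i).
  rewrite {1}[p]mpolyE -[LHS]/(evr _ _ _) rmorph_sum; apply: eq_bigr => m _ /=.
  by rewrite map_mpolyZ mevalZ map_mpolyX mevalX.
apply: eq_bigr => m _; rewrite rmorphM rmorph_prod; congr (_ * _).
by apply: eq_bigr => i _; rewrite rmorphXn.
Qed.

End Evaluation.

Section Generated.
Variables (K E : fieldType) (h : {rmorphism K -> E}) (n : nat) (a : 'I_n -> E).

(* The subfield generated by [K] and [a]. *)
Definition genmem (x : E) := exists p q, ev h a q != 0 /\ x = ev h a p / ev h a q.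

Fact genmem1 : genmem 1.
Proof. by exists 1, 1; rewrite ev1 divr1 oner_neq0. Qed.
Fact genmemB x y : genmem x -> genmem y -> genmem (x - y).
Proof.
case=> [p [q [nq ->]]] [p' [q' [nq' ->]]].
exists (p * q' - p' * q), (q * q'); rewrite evB !evM mulf_neq0 //; split=> //.
by rewrite -mulNr addf_div // mulNr.
Qed.
Fact genmem_div x y : genmem x -> genmem y -> genmem (x / y).
Proof.
case=> [p [q [nq ->]]] [p' [q' [nq' ->]]].
have [p0|np] := eqVneq (ev h a p') 0.
  by exists 0, 1; rewrite ev0 ev1 p0 !mul0r invr0 mulr0 oner_neq0.
exists (p * q'), (q * p'); rewrite !evM mulf_neq0 //; split=> //.
by rewrite invf_div mulf_div.
Qed.

Definition gen := Subfield genmem1 genmemB genmem_div.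

Lemma gen_ev p : gen (ev h a p).
Proof. by exists p, 1; rewrite ev1 divr1 oner_neq0. Qed.
Lemma gen_base c : gen (h c).
Proof. by rewrite -(evC h a); apply: gen_ev. Qed.
Lemma gen_var i : gen (a i).
Proof. by rewrite -(evX h); apply: gen_ev. Qed.

End Generated.

Lemma algebraic_trans (K L E : fieldType) (i : {rmorphism K -> E}) (j : {rmorphism L -> E}) x :
  (forall y, algebraicOver i (j y)) -> algebraicOver j x -> algebraicOver i x.
Proof.
move=> Lalg [p nz_p px]; apply/integral_algebraic.
apply: (integral_root _ px); first by rewrite map_poly_eq0.
by apply/integral_poly => k; rewrite coef_map; apply/integral_algebraic/Lalg.
Qed.

Lemma algebraic_sum (K E : fieldType) (i : {rmorphism K -> E}) (J : Type) (s : seq J) (F : J -> E) :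
  (forall j, algebraicOver i (F j)) -> algebraicOver i (\sum_(j <- s) F j).
Proof.
move=> HF; elim: s => [|j s IH]; first by rewrite big_nil; apply: algebraic0.
by rewrite big_cons; apply: algebraic_add.
Qed.

Lemma algebraic_prodX (K E : fieldType) (i : {rmorphism K -> E}) n (a : 'I_n -> E) (m : 'X_{1..n}) :
  (forall j, algebraicOver i (a j)) -> algebraicOver i (\prod_j a j ^+ m j).
Proof.
move=> Ha; elim/big_ind: _ => [|x y|j _]; [exact: algebraic1|exact: algebraic_mul|].
elim: (m j) => [|k IH]; first by rewrite expr0; apply: algebraic1.
by rewrite exprS; apply: algebraic_mul.
Qed.

(* Elements algebraic over the subfield generated by a tuple.                *)
Definition algOn (K E : fieldType) (h : {rmorphism K -> E}) n (a : 'I_n -> E) (x : E) :=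
  algebraicOver (sfval (gen h a)) x.

Section AlgOn.
Variables (K E : fieldType) (h : {rmorphism K -> E}).

Lemma algOn_gen n (a : 'I_n -> E) x : gen h a x -> algOn h a x.
Proof. by move=> /sfvalP[y <-]; apply: algebraic_id. Qed.

Lemma algOn_trans n (a : 'I_n -> E) m (b : 'I_m -> E) x :
  (forall j, algOn h a (b j)) -> algOn h b x -> algOn h a x.
Proof.
move=> Hb; apply: algebraic_trans => y.
have evb p : algOn h a (ev h b p).
  rewrite evE; apply: algebraic_sum => k.
  by apply: algebraic_mul; [apply/algOn_gen/gen_base | apply: algebraic_prodX].
have : gen h b (sfval _ y) by apply/sfvalP; exists y.
by case=> p [q [_ ->]]; apply: algebraic_div; apply: evb.
Qed.

Lemma algOn_base n (a : 'I_n -> E) x : algebraicOver h x -> algOn h a x.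
Proof.
apply: algebraic_trans => c; exact/algOn_gen/gen_base.
Qed.

(* Clearing denominators. *)
Lemma gen_denominators n (a : 'I_n -> E) (p : {poly sftype (gen h a)}) :
  exists (d : {mpoly K[n]}) (P : {poly {mpoly K[n]}}), ev h a d != 0 /\
    map_poly (evr h a) P = ev h a d *: map_poly (sfval (gen h a)) p.
Proof.
elim/poly_ind: p => [|p c [d [P [nd HP]]]].
  by exists 1, 0; rewrite ev1 oner_neq0 !rmorph0 scaler0.
have : gen h a (sfval _ c) by apply/sfvalP; exists c.
case=> [u [w [nw Hc]]].
exists (d * w), (w *: P * 'X + (d * u)%:P); split; first by rewrite evM mulf_neq0.
rewrite rmorphD rmorphM /= map_polyZ map_polyX map_polyC /= HP.
have -> : map_poly (sfval (gen h a)) (p * 'X + c%:P) =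
    map_poly (sfval (gen h a)) p * 'X + (sfval (gen h a) c)%:P.
  by rewrite rmorphD rmorphM /= map_polyX map_polyC.
rewrite Hc.
rewrite !evM scalerDr -!mul_polyC; congr (_ + _).
  by rewrite polyCM; ring.
by rewrite -polyCM; congr (_%:P); field.
Qed.

Lemma algOnP n (a : 'I_n -> E) x : algOn h a x <->
  exists P : {poly {mpoly K[n]}}, map_poly (evr h a) P != 0 /\ root (map_poly (evr h a) P) x.
Proof.
split=> [[p nz_p px]|[P [nz_P Px]]].
  have [d [P [nd HP]]] := gen_denominators p.
  exists P; rewrite HP scaler_eq0 negb_or nd map_poly_eq0 nz_p; split=> //.
  by rewrite rootE hornerZ (rootP px) mulr0.
apply/integral_algebraic; apply: (integral_root nz_P Px); apply/integral_poly => k.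
by rewrite coef_map; apply/integral_algebraic/algOn_gen/gen_ev.
Qed.

End AlgOn.

(** * Roots in extensions *)

Lemma irreducible_factor (F : fieldType) (p : {poly F}) : size p != 1 ->
  exists q, irreducible_poly q /\ (q %| p).
Proof.
elim/(@ltn_ind): {p}(size p) {-2}p (erefl (size p)) => n IH p sp p1.
have [-> |nz_p] := eqVneq p 0; first by exists 'X; rewrite dvdp0 -['X]subr0; split=> //; apply: irredp_XsubC.
have n1 : (1 < size p)%N.
  by move: p1; rewrite -size_poly_gt0 in nz_p; rewrite ltn_neqAle eq_sym nz_p andbT.
case: (pselect (irreducible_poly p)) => [irr|nirr]; first by exists p; rewrite dvdpp.
have [q [q1 [qp nqp]]] : exists q : {poly F}, size q != 1 /\ q %| p /\ ~~ (q %= p).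
  apply: contrapT => no; apply: nirr; split=> // q q1 qp.
  by apply: contrapT => /negP nq; apply: no; exists q.
have ltq : (size q < n)%N.
  rewrite -sp ltn_neqAle dvdp_leq // andbT; apply: contra nqp => /eqP E.
  by rewrite -dvdp_size_eqp // E.
have [r [ir rq]] := IH _ ltq q erefl q1.
by exists r; split=> //; apply: dvdp_trans rq qp.
Qed.

Lemma root_extension (F : fieldType) (p : {poly F}) : size p != 1 ->
  exists (E : fieldType) (g : {rmorphism F -> E}) (x : E), root (map_poly g p) x.
Proof.
move=> /irreducible_factor[q [irr qp]].
have [L _ [z qz _]] := irredp_FAdjoin irr.
exists L, (in_alg L), z; have /dvdpP[r ->] := qp.
by rewrite rmorphM rootM qz orbT.
Qed.

Lemma splitting_extension (F : fieldType) (p : {poly F}) : p != 0 ->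
  exists (E : fieldType) (g : {rmorphism F -> E}) (rs : seq E),
    map_poly g p = g (lead_coef p) *: \prod_(r <- rs) ('X - r%:P).
Proof.
move: {2}(size p) (leqnn (size p)) => n; elim: n => [|n IH] in F p *.
  by rewrite leqn0 size_poly_eq0 => /eqP -> /eqP.
move=> sp nz_p; have [/eqP/size_poly1P[c nc ->]|p1] := eqVneq (size p) 1.
  by exists F, idfun, [::]; rewrite big_nil lead_coefC map_polyC /= alg_polyC.
have [E1 [g1 [x px]]] := root_extension p1.
have /factor_theorem[q Dq] := px.
have nz_gp : map_poly g1 p != 0 by rewrite map_poly_eq0.
have nz_q : q != 0 by apply: contraNneq nz_gp => q0; rewrite Dq q0 mul0r.
have sq : (size q <= n)%N.
  rewrite -ltnS; apply: leq_trans sp; rewrite -(size_map_poly g1 p) Dq.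
  by rewrite size_Mmonic ?monicXsubC // size_XsubC addn2.
have [E [g [rs Hrs]]] := IH E1 q sq nz_q.
exists E, (g \o g1), (g x :: rs).
have -> : map_poly (g \o g1) p = map_poly g (map_poly g1 p) by rewrite map_poly_comp.
rewrite {1}Dq rmorphM /= Hrs rmorphB /= map_polyX map_polyC /= big_cons.
have -> : g1 (lead_coef p) = lead_coef q.
  by rewrite -lead_coef_map Dq lead_coef_Mmonic ?monicXsubC.
by rewrite -scalerAl mulrC.
Qed.

(** * Minimal polynomials *)

Lemma minimal_polynomial (F E : fieldType) (g : {rmorphism F -> E}) x : algebraicOver g x ->
  exists m : {poly F}, [/\ m \is monic, irreducible_poly m, root (map_poly g m) x &
    forall q, root (map_poly g q) x -> m %| q].
Proof.
case=> p nz_p px.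
pose P k := `[< exists q : {poly F}, [/\ q != 0, root (map_poly g q) x & size q = k] >].
have [|k /asboolP[m0 [nz_m0 m0x sm0]] Hmin] := @ex_minnP P.
  by exists (size p); apply/asboolP; exists p.
have {}Hmin q : root (map_poly g q) x -> (size q < size m0)%N -> q = 0.
  move=> qx ltq; apply/eqP; apply: contraTT ltq => nz_q; rewrite -leqNgt sm0.
  by apply: Hmin; apply/asboolP; exists q.
have lc0 : (lead_coef m0)^-1 != 0 by rewrite invr_eq0 lead_coef_eq0.
exists ((lead_coef m0)^-1 *: m0); set m := _ *: _.
have sm : size m = size m0 by rewrite size_scale.
have mx : root (map_poly g m) x by rewrite rootE map_polyZ hornerZ (rootP m0x) mulr0.
have nz_m : m != 0 by rewrite -size_poly_eq0 sm size_poly_eq0.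
have Hdvd q : root (map_poly g q) x -> m %| q.
  move=> qx; apply/eqP/Hmin; last by rewrite -sm ltn_modp.
  have := qx; rewrite {1}(divp_eq q m) rmorphD rmorphM /= rootE hornerD hornerM.
  by rewrite (rootP mx) mulr0 add0r.
split=> //; first by rewrite monicE lead_coefZ mulVf // lead_coef_eq0.
split=> [|q q1 qm].
  rewrite ltnNge; apply/negP => /size1_polyC mC; have := mx.
  rewrite mC map_polyC rootC fmorph_eq0 => /eqP c0.
  by move: nz_m; rewrite mC c0 eqxx.
have [r Dm] := dvdpP _ _ qm.
have nz_q : q != 0 by apply: contraNneq nz_m => q0; rewrite Dm q0 mulr0.
have nz_r : r != 0 by apply: contraNneq nz_m => r0; rewrite Dm r0 mul0r.
have := mx; rewrite {1}Dm rmorphM rootM => /orP[rx|/Hdvd mq]; last by rewrite /eqp qm.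
have := Hdvd _ rx => /(dvdp_leq nz_r); rewrite Dm size_mul //.
by move: q1 nz_q nz_r; rewrite -!size_poly_gt0; lia.
Qed.

Lemma separable_root (F E : fieldType) (g : {rmorphism F -> E}) (q : {poly F}) x :
  root (map_poly g q) x -> ~~ root (map_poly g q^`()) x ->
  exists q', separable_poly q' /\ root (map_poly g q') x.
Proof.
move=> qx nqx; have nz_q : q != 0.
  by apply: contraNneq nqx => ->; rewrite deriv0 rmorph0 root0.
have [|m [mm mi mx Hm]] := @minimal_polynomial F E g x; first by exists q.
exists m; split=> //; have nz_m := irredp_neq0 mi.
have nmx : ~~ root (map_poly g m^`()) x.
  apply: contra nqx => m'x; have /dvdpP[r ->] := Hm _ qx.
  by rewrite derivM rmorphD !rmorphM /= rootE !hornerE (rootP mx) (rootP m'x) !mulr0 addr0.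
rewrite unlock /coprimep; apply/eqP/anti_leq.
rewrite size_poly_gt0 gcdp_eq0 negb_and nz_m andbT leqNgt; apply/negP => gt1.
have /andP[_ mg] := mi.2 _ (negbT (gtn_eqF gt1)) (dvdp_gcdl m m^`()).
have /dvdpP[r Hr] := dvdp_trans mg (dvdp_gcdr m m^`()).
by move: nmx; rewrite Hr rmorphM rootM mx orbT.
Qed.

Lemma poly_sfval (E : fieldType) (P : subfield E) (p : {poly E}) :
  (forall k, P p`_k) -> exists q, map_poly (sfval P) q = p.
Proof.
move=> Hp; have /choice[c Hc] : forall k, exists y, sfval P y = p`_k by move=> k; apply/sfvalP.
exists (\poly_(i < size p) c i); apply/polyP => k.
rewrite coef_map coef_poly; case: ltnP => [_|le_k]; first exact: Hc.
by rewrite raddf0 nth_default.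
Qed.

(** * Multivariate polynomials *)

Lemma mpoly_rmorph_ext (R : fieldType) (A : comNzRingType) n (f g : {rmorphism {mpoly R[n]} -> A}) :
  (forall c, f c%:MP = g c%:MP) -> (forall i, f 'X_i = g 'X_i) -> f =1 g.
Proof.
move=> fC fX p; rewrite [p]mpolyE !rmorph_sum; apply: eq_bigr => m _.
rewrite -mul_mpolyC !rmorphM fC; congr (_ * _).
rewrite mpolyXE_id !rmorph_prod; apply: eq_bigr => i _.
by rewrite !rmorphXn fX.
Qed.

Section Peel.
Variables (R : fieldType) (n : nat).

Definition widen1 (i : 'I_n) : 'I_n.+1 := widen_ord (leqnSn n) i.

Lemma muniX (i : 'I_n.+1) : @muni n R 'X_i = if unlift ord_max i is Some j then ('X_j)%:P else 'X.
Proof.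
rewrite muniE msuppX big_seq1 mcoeffX eqxx scale1r.
case: unliftP => [j ->|->].
  rewrite mnm1E eq_sym (negPf (neq_lift _ _)) expr0 alg_polyC; congr _%:P.
  congr (mpolyX _ _); apply/mnmP => k; rewrite mnmE !mnm1E.
  by rewrite -!val_eqE /= /bump leqNgt ltn_ord add0n.
rewrite mnm1E eqxx expr1 (_ : [multinom _ | i < n] = 0%MM) ?mpolyX0 ?scale1r //.
by apply/mnmP => k; rewrite mnmE mnm1E mnm0E -val_eqE /= gtn_eqF.
Qed.

Lemma lift_widen1 j : lift ord_max j = widen1 j.
Proof. by apply/val_inj; rewrite /= /bump leqNgt ltn_ord add0n. Qed.

Lemma unlift_widen1 j : unlift ord_max (widen1 j) = Some j.
Proof. by rewrite -lift_widen1 liftK. Qed.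

(** The inverse of [muni], which takes the last variable as main variable. *)
Definition mback (P : {poly {mpoly R[n]}}) : {mpoly R[n.+1]} :=
  (map_poly (@mwiden n R) P).['X_ord_max].

Lemma mwidenXU i : @mwiden n R 'X_i = 'X_(widen1 i).
Proof. by rewrite mwidenX mnmwiden1. Qed.

Lemma muni_mwiden p : muni (@mwiden n R p) = p%:P.
Proof.
apply: (@mpoly_rmorph_ext R _ n (@muni n R \o @mwiden n R) polyC) => [c|i] /=.
  by rewrite mwidenC muniC.
by rewrite mwidenXU muniX unlift_widen1.
Qed.

Lemma mbackK : cancel mback (@muni n R).
Proof.
move=> P; rewrite /mback -horner_map /= -map_poly_comp muniX unlift_none.
rewrite (eq_map_poly (g := polyC)) => [|p /=]; last exact: muni_mwiden.
by rewrite -[RHS]comp_polyXr.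
Qed.

Lemma muniK : cancel (@muni n R) mback.
Proof.
pose f : {rmorphism {mpoly R[n.+1]} -> {mpoly R[n.+1]}} :=
  horner_eval 'X_ord_max \o map_poly (@mwiden n R) \o @muni n R.
have fE p : f p = mback (muni p) by [].
move=> p; rewrite -fE; apply: (mpoly_rmorph_ext (g := idfun)) => [c|i]; rewrite fE /mback.
  by rewrite muniC map_polyC hornerC /= mwidenC.
rewrite muniX; case: unliftP => [j ->|->]; rewrite ?map_polyC ?map_polyX ?hornerC ?hornerX //=.
by rewrite mwidenXU lift_widen1.
Qed.

Lemma muni_eq0 p : (@muni n R p == 0) = (p == 0).
Proof. by rewrite -[RHS](inj_eq (can_inj muniK)) rmorph0. Qed.

End Peel.

Lemma ev_muni (K : fieldType) (E : comNzRingType) (h : {rmorphism K -> E}) n (t : 'I_n.+1 -> E) p :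
  ev h t p = (map_poly (evr h (t \o @widen1 n)) (muni p)).[t ord_max].
Proof.
apply: (@mpoly_rmorph_ext K E n.+1 (evr h t)
  (horner_eval (t ord_max) \o map_poly (evr h (t \o @widen1 n)) \o @muni n K)) => [c|i].
  by rewrite /= /horner_eval muniC map_polyC hornerC /= -!/(ev _ _ _) !evC.
rewrite /= /horner_eval muniX; case: unliftP => [j ->|->].
  by rewrite map_polyC hornerC /= -!/(ev _ _ _) !evX lift_widen1.
by rewrite map_polyX hornerX -/(ev _ _ _) evX.
Qed.

Definition snoc (T : Type) n (a : 'I_n -> T) (x : T) : 'I_n.+1 -> T :=
  fun i => if unlift ord_max i is Some j then a j else x.

Lemma snoc_widen T n (a : 'I_n -> T) x : snoc a x \o @widen1 n = a.
Proof. by apply/funext => j; rewrite /snoc /= unlift_widen1. Qed.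

Lemma snoc_max T n (a : 'I_n -> T) x : snoc a x ord_max = x.
Proof. by rewrite /snoc unlift_none. Qed.

Lemma snoc_comp (T U : Type) (f : T -> U) n (a : 'I_n -> T) x : f \o snoc a x = snoc (f \o a) (f x).
Proof. by apply/funext => j; rewrite /snoc /=; case: unlift. Qed.

(** * Infinite fields *)

Definition infinite (K : fieldType) := forall s : seq K, exists x, x \notin s.

Lemma poly_infinite (K E : fieldType) (h : K -> E) (p : {poly E}) :
  injective h -> infinite K -> (forall x, p.[h x] = 0) -> p = 0.
Proof.
move=> hI infK p0; apply/eqP; apply: contraT => nz_p.
have many m : exists s : seq K, uniq s /\ size s = m.
  elim: m => [|m [s [us <-]]]; first by exists [::].
  by have [x xs] := infK s; exists (x :: s); rewrite /= xs us.
have [s [us ss]] := many (size p).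
have := max_poly_roots (rs := map h s) nz_p; rewrite size_map ss ltnn; apply.
  by apply/allP => _ /mapP[x _ ->]; apply/rootP.
by rewrite map_inj_uniq.
Qed.

Lemma mpoly_infinite (K E : fieldType) (h : {rmorphism K -> E}) n (p : {mpoly E[n]}) :
  infinite K -> (forall a : 'I_n -> K, p.@[h \o a] = 0) -> p = 0.
Proof.
move=> infK; elim: n p => [|n IH] p p0.
  have pC : p = (p@_0)%:MP by rewrite mpolyKC.
  have := p0 (fun=> 0); rewrite {1}pC mevalC => pz.
  by rewrite pC pz mpolyC0.
have evid m (b : 'I_m -> E) q : ev idfun b q = q.@[b].
  by rewrite (_ : map_mpoly idfun q = q) //; apply/mpolyP => m'; rewrite mcoeff_map_mpoly.
apply/eqP; rewrite -muni_eq0; apply/eqP/polyP => k; rewrite coef0; apply: IH => a.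
have : map_poly (evr idfun (h \o a)) (muni p) = 0.
  apply: (poly_infinite (@fmorph_inj _ _ h) infK) => x.
  have := p0 (snoc a x); rewrite -evid ev_muni snoc_comp snoc_widen snoc_max.
  exact.
move=> /polyP/(_ k); rewrite coef_map coef0 => <-.
by rewrite -evid.
Qed.

Lemma mpoly_infinite_neq (K : fieldType) n (p : {mpoly K[n]}) :
  infinite K -> p != 0 -> exists a : 'I_n -> K, p.@[a] != 0.
Proof.
move=> infK nz_p; apply: contrapT => no; move/eqP: nz_p; apply.
apply: (@mpoly_infinite K K idfun) => // a; apply/eqP; apply: contraT => na.
by case: no; exists a.
Qed.

(** * Algebraic independence *)

Section Independence.
Variables (K E : fieldType) (h : {rmorphism K -> E}).

Lemma indep_widen n (t : 'I_n.+1 -> E) :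
  alg_independent h t -> alg_independent h (t \o @widen1 n).
Proof.
move=> it p p0; have := it (mback p%:P).
rewrite ev_muni mbackK map_polyC hornerC /= => /(_ p0) /(congr1 (@muni n K)).
by rewrite mbackK rmorph0 => /eqP; rewrite polyC_eq0 => /eqP.
Qed.

Lemma indep_last n (t : 'I_n.+1 -> E) :
  alg_independent h t -> ~ algOn h (t \o @widen1 n) (t ord_max).
Proof.
move=> it /algOnP[P [/negP nz_P /rootP Px]]; apply: nz_P.
have /(congr1 (@muni n K)) : mback P = 0 by apply: it; rewrite ev_muni mbackK.
by rewrite mbackK rmorph0 => ->; rewrite rmorph0.
Qed.

Lemma indep_snoc n (t : 'I_n.+1 -> E) :
  alg_independent h (t \o @widen1 n) -> ~ algOn h (t \o @widen1 n) (t ord_max) ->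
  alg_independent h t.
Proof.
move=> it nalg p; rewrite ev_muni => p0; apply/eqP; rewrite -muni_eq0; apply/eqP/polyP => k.
rewrite coef0; apply: it; have [P0|nz_P] := eqVneq (map_poly (evr h (t \o @widen1 n)) (muni p)) 0.
  by have := congr1 (fun q : {poly E} => q`_k) P0; rewrite coef_map coef0.
by case: nalg; apply/algOnP; exists (muni p); split=> //; apply/rootP.
Qed.

(* Independence over [K] is independence over its relative algebraic closure. *)
Lemma indep_algebraic n (t : 'I_n -> E) (p : {mpoly E[n]}) :
  alg_independent h t -> (forall m, algebraicOver h p@_m) -> p.@[t] = 0 -> p = 0.
Proof.
have evid m (b : 'I_m -> E) q : ev idfun b q = q.@[b].
  by rewrite (_ : map_mpoly idfun q = q) //; apply/mpolyP => m'; rewrite mcoeff_map_mpoly.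
elim: n t p => [|n IH] t p it Hp; rewrite -evid.
  have pC : p = (p@_0)%:MP by rewrite mpolyKC.
  by rewrite {1}pC evC /= => p0; rewrite pC p0 mpolyC0.
rewrite ev_muni => p0; apply/eqP; rewrite -muni_eq0; apply/eqP/polyP => k; rewrite coef0.
have Hk j m : algebraicOver h ((muni p)`_j)@_m.
  rewrite muniE coef_sum raddf_sum.
  apply: algebraic_sum => m'; rewrite coefZ coefXn.
  case: (j == _); rewrite /= ?mulr1 ?mulr0 ?mcoeff0; last exact: algebraic0.
  rewrite mcoeffZ mcoeffX; apply: algebraic_mul => //.
  by case: (_ == _); [apply: algebraic1 | apply: algebraic0].
apply: IH (indep_widen it) (Hk k) _; rewrite -evid.
set P := map_poly _ _ in p0; have [P0|nz_P] := eqVneq P 0.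
  by have := congr1 (fun q : {poly E} => q`_k) P0; rewrite coef_map coef0.
case: (indep_last it); apply/integral_algebraic.
apply: (integral_root nz_P); first exact/rootP.
apply/integral_poly => j; rewrite coef_map; apply/integral_algebraic.
rewrite /= -/(ev _ _ _) evE; apply: algebraic_sum => m.
apply: algebraic_mul; first exact/algOn_base/Hk.
by apply: algebraic_prodX => i; apply/algOn_gen/gen_var.
Qed.

End Independence.

(** * Separating transcendence bases *)

(** All exponents vanish in K; unless p is constant, the characteristic is a prime l dividing all of
    them, and l-th roots of the coefficients exist by perfectness. *)
Lemma mderiv_all0 (K : fieldType) n (p : {mpoly K[n]}) :
  perfect_field K -> (forall i, p^`M(i) = 0) ->
  (exists c, p = c%:MP) \/ exists l r, (1 < l)%N /\ p = r ^+ l.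
Proof.
move=> perfK dp.
have m0 m i : m \in msupp p -> (m i)%:R = 0 :> K.
  move=> mp; have [->//|mi] := posnP (m i).
  have := congr1 (mcoeff (m - U_(i))%MM) (dp i).
  rewrite mcoeff_deriv mcoeff0 submK; last by apply/mnm_lepP => j; rewrite mnm1E; case: eqP => // <-.
  rewrite mnmBE mnm1E eqxx subn1 prednK // -[_ *+ m i]mulr_natr => /eqP.
  by rewrite mulf_eq0 mcoeff_eq0 mp => /eqP.
case: (pselect (exists m i, m \in msupp p /\ (0 < m i)%N)) => [[m [i [mp mi]]]|no]; last first.
  left; exists p@_0; apply: msize1_polyC; rewrite msizeE; apply/bigmax_leqP_seq => m mp _.
  suff -> : m = 0%MM by rewrite mdeg0.
  apply/mnmP => i; rewrite mnm0E; apply/eqP; rewrite eqn0Ngt; apply/negP => mi.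
  by apply: no; exists m, i.
right; have [l lK] := natf0_pchar mi (introT eqP (m0 _ i mp)); have l_pr := pcharf_prime lK.
have /choice[y Hy] : forall c : K, exists b, b ^+ l = c by move=> c; apply: perfK.
exists l, (\sum_(m <- msupp p) y p@_m *: 'X_[[multinom (m i %/ l)%N | i < n]]).
split; first exact: prime_gt1.
have lP : l \in [pchar {mpoly K[n]}] by apply: (rmorph_pchar (@mpolyC n K)).
rewrite -(pFrobenius_autE lP) rmorph_sum {1}[p]mpolyE [LHS]big_seq [RHS]big_seq.
apply: eq_bigr => m' m'p /=; rewrite pFrobenius_autE exprZn Hy mpolyXn; congr (_ *: 'X_[_]).
apply/mnmP => j; rewrite mulmnE mnmE divnK // (dvdn_pcharf lK).
by rewrite m0.
Qed.

Section Separating.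
Variables (K E : fieldType) (h : {rmorphism K -> E}).

(** Take a relation of minimal total degree. Its derivatives are smaller, so those that vanish at t
    are zero. If all were zero, the relation would be a constant or a proper power of a smaller
    relation. *)
Lemma mderiv_nonzero n (t : 'I_n -> E) : perfect_field K -> ~ alg_independent h t ->
  exists (p : {mpoly K[n]}) i, ev h t p = 0 /\ ev h t p^`M(i) != 0.
Proof.
move=> perfK dep.
pose P k := `[< exists p : {mpoly K[n]}, [/\ p != 0, ev h t p = 0 & msize p = k] >].
have [|k /asboolP[p [nz_p p0 sp]] Hmin] := @ex_minnP P.
  apply: contrapT => no; apply: dep => p p0; apply/eqP; apply: contraT => nz_p.
  by case: no; exists (msize p); apply/asboolP; exists p.
have {}Hmin q : ev h t q = 0 -> (msize q < msize p)%N -> q = 0.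
  move=> qx ltq; apply/eqP; apply: contraTT ltq => nz_q; rewrite -leqNgt sp.
  by apply: Hmin; apply/asboolP; exists q.
exists p; apply: contrapT => no.
have dp i : p^`M(i) = 0.
  apply: Hmin; first by apply/eqP; apply: contraT => ni; case: no; exists i.
  case sp': (msize p) => [|s]; first by move/eqP: sp'; rewrite msize_poly_eq0 (negPf nz_p).
  rewrite ltnS msizeE; apply/bigmax_leqP_seq => m.
  rewrite mcoeff_msupp mcoeff_deriv -mulr_natr mulf_eq0 negb_or => /andP[nm _] _.
  have := @msize_mdeg_lt n K p (m + U_(i))%MM; rewrite mcoeff_msupp nm => /(_ isT).
  by rewrite mdegD mdeg1 addn1 sp'.
case: (mderiv_all0 perfK dp) => [[c Dp]|[l [r [l1 Dp]]]].
  by move: nz_p p0; rewrite Dp mpolyC_eq0 evC => /negPf nc /eqP; rewrite fmorph_eq0 nc.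
have nz_r : r != 0 by apply: contraNneq nz_p => r0; rewrite Dp r0 expr0n; case: l l1 {Dp}.
have r0 : ev h t r = 0.
  move: p0; rewrite Dp -[ev _ _ _]/(evr h t _) rmorphXn => /eqP.
  by rewrite expf_eq0 => /andP[_ /eqP].
have r1 : (1 < msize r)%N.
  rewrite ltnNge; apply/negP => /msize1_polyC rC; move: r0 nz_r; rewrite rC evC => /eqP.
  by rewrite fmorph_eq0 mpolyC_eq0 => ->.
suff : r = 0 by apply/eqP.
apply: Hmin => //; case: l l1 Dp => [|[|l]] // _ Dp.
have sr k' : (msize r <= msize (r ^+ k'.+1))%N.
  elim: k' => [|k' IH]; first by rewrite expr1.
  rewrite exprS msizeM ?expf_neq0 //; move: IH r1.
  by move: (msize r) (msize (r ^+ k'.+1)) => u v; lia.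
rewrite Dp exprS msizeM ?expf_neq0 //; move: (sr l) r1.
by move: (msize r) (msize (r ^+ l.+1)) => u v; lia.
Qed.

(** A relation whose j-th derivative does not vanish at t, read as a polynomial in the j-th variable
    over the field generated by the other coordinates, has [t j] as a simple root. *)
Lemma perfect_relation n (t : 'I_n.+1 -> E) : perfect_field K -> ~ alg_independent h t ->
  exists j (q : {poly sftype (gen h (t \o lift j))}),
    separable_poly q /\ root (map_poly (sfval _) q) (t j).
Proof.
move=> perfK /(mderiv_nonzero perfK)[p [j [p0 pj]]]; exists j.
(* [G] evaluates all variables but the j-th, which becomes the indeterminate of a univariate
   polynomial over E. *)
pose x i : {poly E} := if i == j then 'X else (t i)%:P.
pose G : {rmorphism {mpoly K[n.+1]} -> {poly E}} := evr (polyC \o h) x.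
have GE q : (G q).[t j] = ev h t q.
  apply: (mpoly_rmorph_ext (f := horner_eval (t j) \o G) (g := evr h t)) => [c|i].
    by rewrite /= /horner_eval -!/(ev _ _ _) !evC hornerC.
  rewrite /= /horner_eval -!/(ev _ _ _) !evX /x; case: eqP => [->|_].
    by rewrite hornerX.
  by rewrite hornerC.
have GX m : exists c, forall k, G 'X_[(m - U_(j) *+ m j + U_(j) *+ k)%MM] = c *: 'X^k.
  exists (\prod_(i | i != j) t i ^+ m i) => k.
  rewrite /G -[evr _ _ _]/(ev _ _ _) map_mpolyX mevalX (bigD1 j) //= /x eqxx mulrC -mul_polyC.
  rewrite rmorph_prod; congr (_ * _); last by congr ('X ^+ _); rewrite mnmDE mnmBE !mulmnE mnm1E eqxx; lia.
  apply: eq_bigr => i /negPf nij; rewrite nij rmorphXn /=; congr (_ ^+ _).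
  by rewrite mnmDE mnmBE !mulmnE mnm1E eq_sym nij; lia.
have GP i : gen h (t \o lift j) (G p)`_i.
  suff : G p \is a polyOver (sfpred (gen h (t \o lift j))) by move/polyOverP/(_ i)/asboolP.
  rewrite /G -[evr _ _ _]/(ev _ _ _) evE rpred_sum // => m _; apply: rpredM.
    by rewrite polyOverC; apply/asboolP/gen_base.
  apply: rpred_prod => k _; apply: rpredX; rewrite /x; case: (unliftP j k) => [k' ->|->].
    by rewrite eq_sym (negPf (neq_lift _ _)) polyOverC; apply/asboolP/gen_var.
  by rewrite eqxx polyOverX.
have GC c : G c%:MP = (h c)%:P by rewrite /G -[evr _ _ _]/(ev _ _ _) evC.
clearbody G.
(* Compatibility with derivation is checked on monomials, with the j-th exponent isolated as in
   [GX]. *)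
have Gd q : (G q)^`() = G q^`M(j).
  rewrite [q]mpolyE (rmorph_sum G) (raddf_sum (@deriv E)) (raddf_sum (mderiv j)) (rmorph_sum G).
  apply: eq_bigr => m _ /=; rewrite mderivZ -!mul_mpolyC !rmorphM /= GC.
  rewrite derivM derivC mul0r add0r; congr (_ * _); have [c Hc] := GX m.
  have Dm : (m - U_(j) *+ m j + U_(j) *+ m j)%MM = m.
    by apply/mnmP => i; rewrite mnmDE mnmBE !mulmnE mnm1E; case: eqP => [->|]; lia.
  have Dm1 : (m j)%:R *: 'X_[m - U_(j)] =
      (m j)%:R *: 'X_[(m - U_(j) *+ m j + U_(j) *+ (m j).-1)] :> {mpoly K[n.+1]}.
    case: (posnP (m j)) => [->|mj]; first by rewrite !scale0r.
    congr (_ *: 'X_[_]); apply/mnmP => i; rewrite mnmDE !mnmBE !mulmnE mnm1E.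
    by case: eqP => [<-|]; lia.
  rewrite mderivX Dm1 -{1}Dm Hc -mul_mpolyC rmorphM Hc derivZ derivXn /= GC rmorph_nat.
  by rewrite -mulr_natl scalerAr mulr_natl mul_polyC scaler_nat scalerMnr.
have [q Hq] := poly_sfval GP.
apply: (@separable_root _ _ (sfval _) q).
  by rewrite Hq; apply/rootP; rewrite GE.
by rewrite -deriv_map Hq Gd; apply/rootP; rewrite GE; apply/eqP.
Qed.

End Separating.

Section SubfieldClosure.
Variables (E : fieldType) (P : subfield E).

Lemma sf_prop x : P x <-> x \in sfpred P. Proof. by split=> [?|/asboolP]; [apply/asboolP|]. Qed.

Lemma sf_horner (p : {poly E}) z : (forall k, P p`_k) -> P z -> P p.[z].
Proof.
move=> Hp /sf_prop Pz; apply/sf_prop; apply: rpred_horner => //.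
by apply/polyOverP => k; apply/sf_prop.
Qed.

Lemma gen_min (K : fieldType) (h : {rmorphism K -> E}) n (a : 'I_n -> E) x :
  (forall c, P (h c)) -> (forall i, P (a i)) -> gen h a x -> P x.
Proof.
move=> Ph Pa; have Pev p : ev h a p \in sfpred P.
  rewrite evE rpred_sum // => m _; apply: rpredM; first exact/sf_prop.
  by apply: rpred_prod => i _; apply/rpredX/sf_prop.
by case=> p [q [_ ->]]; apply/sf_prop/rpred_div.
Qed.

End SubfieldClosure.

(** * Simple algebraic extensions and the normal form of finitely generated fields *)

Section SimpleExtension.
Variables (F E : fieldType) (g : {rmorphism F -> E}) (z : E).
Hypothesis algz : algebraicOver g z.

Let mem (x : E) := exists p, x = (map_poly g p).[z].

Fact simple1 : mem 1.
Proof. by exists 1; rewrite rmorph1 hornerC. Qed.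
Fact simpleB x y : mem x -> mem y -> mem (x - y).
Proof. by case=> p -> [q ->]; exists (p - q); rewrite rmorphB hornerD hornerN. Qed.
Fact simple_div x y : mem x -> mem y -> mem (x / y).
Proof.
case=> p -> [q ->]; have [m [mm mi mz Hm]] := minimal_polynomial algz.
have [q0|nq] := eqVneq (map_poly g q).[z] 0.
  by exists 0; rewrite q0 invr0 mulr0 rmorph0 horner0.
have /Bezout_eq1_coprimepP[[u v] /= uv] : coprimep q m.
  rewrite coprimep_sym /coprimep; apply: contraNT nq => ng.
  have /andP[_ mg] := mi.2 _ ng (dvdp_gcdl _ _).
  have /dvdpP[r ->] := dvdp_trans mg (dvdp_gcdr m q).
  by rewrite rmorphM hornerM (rootP mz) mulr0.
exists (p * u); rewrite rmorphM hornerM; congr (_ * _).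
apply: (mulIf nq); rewrite mulVf //.
have := congr1 (fun r => (map_poly g r).[z]) uv.
by rewrite rmorphD !rmorphM rmorph1 /= hornerD !hornerM (rootP mz) mulr0 addr0 hornerC => ->.
Qed.

Definition simple_ext : subfield E := Subfield simple1 simpleB simple_div.

End SimpleExtension.

(* Evaluation of a polynomial in [t] and [s].                                *)
Notation ev2 h t s u := ((map_poly (evr h t) u).[s]).

Section NormalForm.
Variables (K E : fieldType) (h : {rmorphism K -> E}).

Lemma gen_snocl n (t : 'I_n -> E) s x : gen h t x -> gen h (snoc t s) x.
Proof.
apply: gen_min => [c|i]; first exact: gen_base.
have -> : t i = snoc t s (widen1 i) by rewrite /snoc unlift_widen1.
exact: gen_var.
Qed.

Lemma gen_snocr n (t : 'I_n -> E) s : gen h (snoc t s) s.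
Proof. by rewrite -{2}(snoc_max t s); apply: gen_var. Qed.

Lemma gen_poly n (t : 'I_n -> E) z (q : {poly sftype (gen h t)}) :
  gen h (snoc t z) (map_poly (sfval _) q).[z].
Proof.
apply: sf_horner (gen_snocr t z) => k; rewrite coef_map; apply: gen_snocl.
by apply/sfvalP; exists q`_k.
Qed.

Lemma gen_snoc_repr n (t : 'I_n -> E) s x : algOn h t s -> gen h (snoc t s) x ->
  exists q p, ev h t q != 0 /\ ev h t q * x = ev2 h t s p.
Proof.
move=> algs xs; have [p ->] : simple_ext algs x.
  apply: gen_min xs => [c|i].
    have /sfvalP[y <-] := gen_base h t c.
    by exists y%:P; rewrite map_polyC hornerC.
  rewrite /snoc; case: unlift => [j|]; last by exists 'X; rewrite map_polyX hornerX.
  have /sfvalP[y <-] := gen_var h t j.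
  by exists y%:P; rewrite map_polyC hornerC.
have [q [P [nq HP]]] := gen_denominators p.
by exists q, P; rewrite HP hornerZ.
Qed.

(** Take d minimal such that the [a k] lie in some K(t,s) with s algebraic over K(t). If t were
    dependent, some [t j] would be separable over the others, and the primitive element theorem
    would merge it with s, lowering d. *)
Lemma separating_basis n (a : 'I_n -> E) : perfect_field K -> infinite K ->
  exists d (t : 'I_d -> E) s, [/\ alg_independent h t, algOn h t s &
    forall k, gen h (snoc t s) (a k)].
Proof.
move=> perfK infK.
pose P d := `[< exists (t : 'I_d -> E) s, algOn h t s /\ forall k, gen h (snoc t s) (a k) >].
have [|d /asboolP[t [s [algs Ha]]] Hmin] := @ex_minnP P.
  exists n; apply/asboolP; exists a, 0; split; first exact: algebraic0.
  by move=> k; apply/gen_snocl/gen_var.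
exists d, t, s; split=> //; case: d t s algs Ha Hmin => [|d] t s algs Ha Hmin.
  move=> p; have pC : p = (p@_0)%:MP by rewrite mpolyKC.
  by rewrite pC evC => /eqP; rewrite fmorph_eq0 => /eqP ->; rewrite mpolyC0.
apply: contrapT => /(perfect_relation perfK)[j [q [sep_q qt]]].
pose t' := t \o lift j.
have algt i : algOn h t' (t i).
  case: (unliftP j i) => [k ->|->]; first exact/algOn_gen/(gen_var h t' k).
  by exists q => //; apply: separable_poly_neq0.
have [p nz_p ps] : algOn h t' s := algOn_trans algt algs.
have [r nz_r Hr] := large_field_PET nz_p ps qt sep_q.
have [c rc] : exists c : K, ~~ root r (h c).
  apply: contrapT => no; move/eqP: nz_r; apply; apply: (poly_infinite (@fmorph_inj _ _ h) infK) => c.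
  by apply/rootP; apply: contraT => nc; case: no; exists c.
have /sfvalP[u Hu] := gen_base h t' c.
(* The primitive element is [z = c (t j) - s], with [c] taken in K outside the finitely many
   excluded values. *)
have := Hr u; rewrite Hu => /(_ rc) /=; set z := _ - s => -[[q1 Hq1] [q2 Hq2]].
suff /Hmin : P d by rewrite ltnn.
apply/asboolP; exists t', z; split.
  apply: algebraic_sub; last by exists p.
  by apply: algebraic_mul; [exact: (algOn_gen (gen_base h t' c)) | exact: algt].
move=> k; apply: gen_min (Ha k) => [b|i]; first exact: gen_base.
have zs : gen h (snoc t' z) s by rewrite -Hq1; apply: gen_poly.
have zt : gen h (snoc t' z) (t j) by rewrite -Hq2; apply: gen_poly.
rewrite [snoc t s i]/snoc; case: unlift => [i'|] //.
by case: (unliftP j i') => [k' ->|->] //; apply/gen_snocl/(gen_var h t' k').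
Qed.

(* The degree of [s] over [K(t)] is [m], witnessed by the monic polynomial   *)
(* [f].                                                                      *)
Definition generic_root d (t : 'I_d -> E) s m (f : {poly {mpoly K[d]}}) :=
  [/\ f \is monic, size f = m.+1, ev2 h t s f = 0 &
    forall u : {poly {mpoly K[d]}}, (size u <= m)%N -> ev2 h t s u = 0 -> u = 0].

(** Multiplying [s0] by the common denominator [D(t)] of its minimal polynomial makes it a root of a
    monic polynomial with coefficients in K[t], namely [P_k D^(N-1-k)] in degree k < N. *)
Lemma generic_root_exists d (t : 'I_d -> E) s0 : alg_independent h t -> algOn h t s0 ->
  exists s m f, [/\ generic_root t s m f, algOn h t s &
    forall x, gen h (snoc t s0) x -> gen h (snoc t s) x].
Proof.
move=> it alg0; have [m [mm mi mz Hm]] := minimal_polynomial alg0.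
have [D [P [nD HP]]] := gen_denominators m.
pose N := (size m).-1; have sm : size m = N.+1 by rewrite (ltn_predK mi.1).
have mN : m`_N = 1 by rewrite -[N]/(size m).-1 -lead_coefE (monicP mm).
have evI : injective (evr h t).
  by move=> p q /eqP; rewrite -subr_eq0 -rmorphB => /eqP /it /eqP; rewrite subr_eq0 => /eqP.
have sP : size P = N.+1.
  by rewrite -(size_map_inj_poly evI) ?rmorph0 // HP size_scale // size_map_poly.
have PN : P`_N = D.
  apply: evI; have := congr1 (fun q : {poly E} => q`_N) HP.
  by rewrite coefZ !coef_map /= mN rmorph1 mulr1.
pose dl := ev h t D; pose s := dl * s0.
have N0 : (0 < N)%N by rewrite -ltnS -sm; exact: mi.1.
pose f : {poly {mpoly K[d]}} := 'X^N + \poly_(k < N) (P`_k * D ^+ (N.-1 - k)).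
have sf : size f = N.+1.
  by rewrite size_polyDl size_polyXn // ltnS size_poly.
exists s, N, f; split; last 1 first.
- move=> x; apply: gen_min => [c|i]; first exact: gen_base.
  rewrite [snoc t s0 i]/snoc; case: unlift => [j|]; first exact/gen_snocl/gen_var.
  have -> : s0 = s / dl by rewrite /s mulrC mulKf.
  by apply: sfmem_div; [apply: gen_snocr | apply/gen_snocl/gen_ev].
- split=> //.
  + rewrite monicE lead_coefE sf /= coefD coefXn eqxx coef_poly ltnn addr0 //.
  + have := rootP mz => /(congr1 (fun x => dl ^+ N * x)); rewrite mulr0 => <-.
    rewrite /f rmorphD /= map_polyXn hornerD hornerXn.
    have -> : map_poly (evr h t) (\poly_(k < N) (P`_k * D ^+ (N.-1 - k))) =
        \poly_(k < N) (evr h t P`_k * dl ^+ (N.-1 - k)).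
      apply/polyP => k; rewrite coef_map !coef_poly; case: ifP => _; last exact: raddf0.
      by rewrite -[LHS]/(evr h t (_ * _)) rmorphM rmorphXn.
    rewrite horner_poly.
    have HmP k : dl * sfval _ m`_k = ev h t P`_k.
      have := congr1 (fun q : {poly E} => q`_k) HP.
      by rewrite coefZ !coef_map => /= ->.
    rewrite horner_coef size_map_poly sm big_ord_recr /= addrC mulrDr mulr_sumr.
    rewrite coef_map /= mN rmorph1 mul1r exprMn; congr (_ + _).
    apply: eq_bigr => k _; rewrite coef_map -HmP exprMn /=.
    have -> : dl ^+ N = dl * dl ^+ (N.-1 - k) * dl ^+ k.
      by rewrite -exprS -exprD; congr (_ ^+ _); have := ltn_ord k; lia.
    move: (dl ^+ k) (dl ^+ (N.-1 - k)) (s0 ^+ k) (sfval _ m`_k) => u v w z.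
    by rewrite !mulrA; congr (_ * w); rewrite -!mulrA; congr (dl * _); rewrite mulrCA mulrA mulrC mulrCA mulrA.
  + move=> u su u0; apply/polyP => k; rewrite coef0.
    (* A relation of degree less than N for [s = D(t) s0] becomes, after rescaling, one of degree
       less than N for [s0]; minimality of [m] kills it. *)
    pose Q := \poly_(i < N) (evr h t u`_i * dl ^+ i).
    have [q Hq] : exists q, map_poly (sfval (gen h t)) q = Q.
      apply: poly_sfval => i; rewrite coef_poly; case: ifP => _; last first.
        by rewrite -(rmorph0 h); apply: gen_base.
      rewrite (_ : _ * _ = evr h t (u`_i * D ^+ i)); first exact: gen_ev.
      by rewrite rmorphM rmorphXn.
    have q0 : root (map_poly (sfval _) q) s0.
      rewrite Hq rootE horner_poly; apply/eqP; rewrite -[RHS]u0 (horner_coef_wide _ (n := N)); last first.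
        by apply: leq_trans (size_poly _ _) su.
      by apply: eq_bigr => i _; rewrite coef_map /s exprMn mulrA.
    have qz : q = 0.
      apply/eqP; apply: contraT => nz_q; have := dvdp_leq nz_q (Hm _ q0).
      by rewrite sm -(size_map_poly (sfval (gen h t)) q) Hq => /leq_trans/(_ (size_poly _ _)); rewrite ltnn.
    case: (ltnP k N) => kN; last by rewrite nth_default // (leq_trans su).
    have := congr1 (fun q : {poly E} => q`_k) Hq; rewrite qz rmorph0 coef0 coef_poly kN => /esym/eqP.
    rewrite mulf_eq0 expf_eq0 (negPf nD) andbF orbF => /eqP /it; exact.
- by apply: algebraic_mul => //; exact: (algOn_gen (gen_ev h t D)).
Qed.

(* Finitely many elements are rational functions of algebraically            *)
(* independent ones and a root of an irreducible monic polynomial.           *)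
Theorem normal_form n (a : 'I_n -> E) : perfect_field K -> infinite K ->
  exists d (t : 'I_d -> E) s m f, [/\ alg_independent h t, generic_root t s m f &
    forall x, gen h (snoc t s) x ->
      exists q p, ev h t q != 0 /\ ev h t q * x = ev2 h t s p] /\
    forall k, gen h (snoc t s) (a k).
Proof.
move=> perfK infK; have [d [t [s0 [it alg0 Ha]]]] := separating_basis a perfK infK.
have [s [m [f [Hf algs Hs]]]] := generic_root_exists it alg0.
exists d, t, s, m, f; split; last by move=> k; apply: Hs.
by split=> // x; apply: gen_snoc_repr.
Qed.

End NormalForm.

(** * Gauss's lemma *)

Lemma fraction_repr (R : idomainType) (x : {fraction R}) :
  exists a b : R, b != 0 /\ x = tofrac a / tofrac b.
Proof.
elim/quotW: x => r; exists (\n_r), (\d_r); have nd := denom_ratioP r; split=> //.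
have nD : tofrac \d_r != 0 by rewrite tofrac_eq0.
apply: (mulIf nD); rewrite divfK // -[LHS]/(FracField.mul _ _) !piE.
apply/eqmodP; rewrite /= FracField.equivfE /FracField.mulf.
by rewrite !numden_Ratio ?mulf_neq0 ?oner_neq0 // !mulr1 mulrC.
Qed.

Fact frac_subproof (A : idomainType) : {F : fieldType & {i : {rmorphism A -> F} |
  (forall a, (i a == 0) = (a == 0)) /\ forall x, exists a b, b != 0 /\ x = i a / i b}}.
Proof.
exists {fraction A}, (@FracField.tofrac A); split=> [a|x]; first exact: tofrac_eq0.
exact: fraction_repr.
Qed.

Definition Frac (A : idomainType) : fieldType := projT1 (frac_subproof A).
Definition frac (A : idomainType) : {rmorphism A -> Frac A} := sval (projT2 (frac_subproof A)).

Lemma frac_eq0 (A : idomainType) a : (frac A a == 0) = (a == 0).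
Proof. exact: (proj1 (svalP (projT2 (frac_subproof A)))). Qed.

Lemma frac_repr (A : idomainType) x : exists a b, b != 0 /\ x = frac A a / frac A b.
Proof. exact: (proj2 (svalP (projT2 (frac_subproof A)))). Qed.

Lemma frac_inj (A : idomainType) : injective (frac A).
Proof. by move=> a b /eqP; rewrite -subr_eq0 -rmorphB frac_eq0 subr_eq0 => /eqP. Qed.

(* The homogenization of [w], evaluated at [p] and [q].                      *)
Definition homg (A : comNzRingType) (w : {poly A}) (p q : A) :=
  \sum_(i < size w) w`_i * p ^+ i * q ^+ ((size w).-1 - i).

Lemma size_map_monic (A B : comNzRingType) (f : {rmorphism A -> B}) (w : {poly A}) :
  w \is monic -> size (map_poly f w) = size w.
Proof. by move=> /monicP mw; rewrite size_map_poly_id0 // mw rmorph1 oner_neq0. Qed.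

Lemma homg_map (A B : comNzRingType) (f : {rmorphism A -> B}) w p q :
  w \is monic -> homg (map_poly f w) (f p) (f q) = f (homg w p q).
Proof.
move=> mw; rewrite /homg size_map_monic // rmorph_sum; apply: eq_bigr => i _.
by rewrite !rmorphM !rmorphXn coef_map.
Qed.

(** Integral closedness: a fraction [p / q] that is a root of the monic [w] lies in A. The
    homogenized form keeps the condition inside A. *)
Definition int_closed (A : idomainType) := forall (p q : A) (w : {poly A}),
  q != 0 -> w \is monic -> homg w p q = 0 -> exists r, p = r * q.

Lemma int_closed_iso (A B : idomainType) (f : {rmorphism A -> B}) (g : B -> A) :
  cancel f g -> cancel g f -> int_closed B -> int_closed A.
Proof.
move=> fK gK icB p q w nq mw w0.
have [|||r Hr] := icB (f p) (f q) (map_poly f w).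
- by rewrite -(rmorph0 f) (inj_eq (can_inj fK)).
- by rewrite monicE lead_coefE size_map_monic // coef_map -lead_coefE (monicP mw) /= rmorph1.
- by rewrite homg_map // w0 rmorph0.
by exists (g r); apply: (can_inj fK); rewrite rmorphM gK.
Qed.

Lemma homg_dvdp (F : fieldType) (p q : {poly F}) (w : {poly {poly F}}) :
  w \is monic -> homg w p q = 0 -> q %| p ^+ (size w).-1.
Proof.
move=> mw; rewrite /homg; have := monic_neq0 mw; rewrite -size_poly_gt0.
case sw: (size w) => [//|N] _; rewrite big_ord_recr /= subnn mulr1.
have -> : w`_N = 1 by rewrite -(monicP mw) lead_coefE sw.
rewrite mul1r => /eqP; rewrite addrC addr_eq0 => /eqP ->; rewrite dvdpNr.
elim/big_ind: _ => [||i _]; [exact: dvdp0|exact: dvdp_add|].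
by rewrite -(subnSK (ltn_ord i)) exprS mulrCA dvdp_mulr.
Qed.

Lemma homgM (A : comNzRingType) (w : {poly A}) (p q g : A) :
  homg w (p * g) (q * g) = g ^+ (size w).-1 * homg w p q.
Proof.
rewrite /homg mulr_sumr; apply: eq_bigr => i _.
have -> : g ^+ (size w).-1 = g ^+ i * g ^+ ((size w).-1 - i).
  by rewrite -exprD; congr (_ ^+ _); have := ltn_ord i; lia.
by rewrite !exprMn; move: (p ^+ i) (g ^+ i) (q ^+ _) (g ^+ _) => a b c d; ring.
Qed.

Lemma int_closed_dvdp (F : fieldType) (p q : {poly F}) (w : {poly {poly F}}) :
  q != 0 -> w \is monic -> homg w p q = 0 -> q %| p.
Proof.
move=> nq mw w0; set g := gcdp p q.
have ng : g != 0 by rewrite gcdp_eq0 negb_and nq orbT.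
have /dvdpP[p1 Dp] : g %| p by apply: dvdp_gcdl.
have /dvdpP[q1 Dq] : g %| q by apply: dvdp_gcdr.
have cop : coprimep q1 p1.
  have : coprimep (p %/ g) (q %/ g) by apply: coprimep_div_gcd; rewrite nq orbT.
  have -> : p %/ g = p1 by rewrite {1}Dp mulpK.
  have -> : q %/ g = q1 by rewrite {1}Dq mulpK.
  by rewrite coprimep_sym.
have : q1 %| p1 ^+ (size w).-1.
  apply: homg_dvdp => //; move: w0; rewrite {1}Dp {1}Dq homgM => /eqP.
  by rewrite mulf_eq0 expf_eq0 (negPf ng) andbF /= => /eqP.
move=> /(coprimep_dvdl) => /(_ _ (coprimep_expr _ cop)).
rewrite coprimepp => /eqP s1; have /size_poly1P[c nc Dc] : size q1 == 1 by apply/eqP.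
by rewrite Dq Dc mul_polyC dvdpZl // dvdp_gcdl.
Qed.

Section Interpolation.
Variables (k : fieldType) (A : idomainType) (f : {rmorphism k -> A}).
Hypothesis infk : infinite k.
Notation ι := (frac A).

(** Subtract the value at a good point [c0] and divide by [X - c0]: the quotient has smaller degree
    and again takes values in A at almost all points of k, since the nonzero differences [c - c0] of
    elements of the field k are invertible in A. *)
Lemma interpolation n (R : {poly Frac A}) (bad : seq k) : (size R <= n)%N ->
  (forall c, c \notin bad -> exists a, R.[ι (f c)] = ι a) -> forall j, exists a, R`_j = ι a.
Proof.
elim: n R bad => [|n IH] R bad.
  by rewrite leqn0 size_poly_eq0 => /eqP -> _ j; exists 0; rewrite coef0 rmorph0.
move=> sR HR; have [c0 c0b] := infk bad; have [a0 Ha0] := HR c0 c0b.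
have /factor_theorem[R1 DR1] : root (R - (ι a0)%:P) (ι (f c0)).
  by rewrite rootE hornerD hornerN hornerC Ha0 subrr.
have DR : R = (ι a0)%:P + R1 * 'X - ι (f c0) *: R1.
  by rewrite -mul_polyC -addrA [_ * R1]mulrC -mulrBr -DR1 addrC subrK.
have sR1 : (size R1 <= n)%N.
  have [->|nz] := eqVneq R1 0; first by rewrite size_poly0.
  have : (size (R1 * ('X - (ι (f c0))%:P))%R <= n.+1)%N.
    rewrite -DR1; apply: leq_trans (size_polyD _ _) _.
    by rewrite size_polyN size_polyC geq_max sR; case: (_ == _).
  by rewrite size_Mmonic ?monicXsubC // size_XsubC addn2.
have {}IH : forall j, exists a, R1`_j = ι a.
  apply: (IH R1 (c0 :: bad) sR1) => c; rewrite inE negb_or => /andP[nc cb].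
  have [a Ha] := HR c cb; exists ((a - a0) * f (c - c0)^-1).
  have nz : ι (f (c - c0)) != 0 by rewrite frac_eq0 fmorph_eq0 subr_eq0.
  apply: (mulIf nz); rewrite -[RHS]rmorphM -mulrA -rmorphM mulVf ?subr_eq0 // rmorph1 mulr1.
  rewrite (rmorphB f) !(rmorphB ι) -Ha -Ha0.
  have := congr1 (horner^~ (ι (f c))) DR1.
  by rewrite hornerM hornerXsubC hornerD hornerN hornerC Ha0 => ->.
move=> j; rewrite DR !coefD coefN coefZ coefC coefMX.
have [a1 Ha1] := IH j; have [a2 Ha2] := IH j.-1.
exists ((if j == 0%N then a0 else 0) + (if j == 0%N then 0 else a2) - f c0 * a1).
rewrite Ha1 Ha2 rmorphB rmorphD rmorphM; congr (_ + _ - _); by case: ifP; rewrite ?rmorph0.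
Qed.

(** Over the fraction field of A, polynomials form a principal ideal domain, so q divides p there.
    At a point c of k with q(c) nonzero, the quotient takes its value in A because A is integrally
    closed; interpolation then puts its coefficients in A. *)
Lemma int_closed_poly : int_closed A -> int_closed {poly A}.
Proof.
move=> icA p q w nq mw w0.
pose φ : {rmorphism {poly A} -> {poly Frac A}} := map_poly ι.
have φI : injective φ by apply: map_inj_poly; [apply: frac_inj | apply: rmorph0].
have nφq : φ q != 0 by rewrite -(rmorph0 φ) (inj_eq φI).
have mφw : map_poly φ w \is monic.
  by rewrite monicE lead_coefE size_map_monic // coef_map -lead_coefE (monicP mw) /= rmorph1.
have /(int_closed_dvdp nφq mφw)/dvdpP[R DR] : homg (map_poly φ w) (φ p) (φ q) = 0.
  by rewrite homg_map // w0 rmorph0.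
have [bad Hbad] : exists bad : seq k, forall c, c \notin bad -> q.[f c] != 0.
  apply: contrapT => no.
  have many m : exists s : seq k, [/\ uniq s, size s = m & all (root q) (map f s)].
    elim: m => [|m [s [us ss rs]]]; first by exists [::].
    have [c [cs qc]] : exists c, c \notin s /\ q.[f c] = 0.
      apply: contrapT => no'; apply: no; exists s => c cs.
      by apply/eqP => qc; apply: no'; exists c.
    by exists (c :: s); rewrite /= us cs ss rs rootE qc eqxx.
  have [s [us ss rs]] := many (size q).
  have := max_poly_roots nq rs; rewrite size_map ss ltnn map_inj_uniq; last exact: fmorph_inj.
  by move/(_ us).
have /choice[r Hr] : forall j, exists a, R`_j = ι a.
  apply: (@interpolation (size R) R bad (leqnn _)) => c /Hbad nqc.
  have [|||r Hr] := icA p.[f c] q.[f c] (map_poly (horner_eval (f c)) w); first exact: nqc.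
  - by rewrite monicE lead_coefE size_map_monic // coef_map -lead_coefE (monicP mw) /= rmorph1.
  - by rewrite -[p.[_]]/(horner_eval _ p) -[q.[_]]/(horner_eval _ q) homg_map // w0 rmorph0.
  exists r; have nz : ι q.[f c] != 0 by rewrite frac_eq0.
  apply: (mulIf nz); rewrite -rmorphM -Hr.
  by have := congr1 (horner^~ (ι (f c))) DR; rewrite hornerM !horner_map.
exists (\poly_(j < size R) r j); apply: φI; rewrite rmorphM DR; congr (_ * _).
apply/polyP => j; rewrite coef_map coef_poly; case: ltnP => [_|sj] /=; first by rewrite Hr.
by rewrite rmorph0 nth_default.
Qed.

End Interpolation.

Lemma int_closed_mpoly (k : fieldType) n : infinite k -> int_closed {mpoly k[n]}.
Proof.
move=> infk; elim: n => [|n IH].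
  move=> p q w nq _ _; have qC : q = (q@_0)%:MP by rewrite mpolyKC.
  have nq0 : q@_0 != 0 by apply: contraNneq nq => q0; rewrite qC q0 mpolyC0.
  exists (p * (q@_0)^-1%:MP); rewrite {2}qC -mulrA -mpolyCM mulVf // mpolyC1 mulr1 //.
apply: (int_closed_iso (f := @muni n k) (@muniK k n) (@mbackK k n)).
exact: (@int_closed_poly k _ (@mpolyC n k) infk IH).
Qed.

Lemma integral_prod_XsubC (A F : comNzRingType) (i : {rmorphism A -> F}) (rs : seq F) :
  (forall r, r \in rs -> integralOver i r) ->
  forall j, integralOver i (\prod_(r <- rs) ('X - r%:P))`_j.
Proof.
elim: rs => [|r rs IH] H j.
  by rewrite big_nil coef1; case: (_ == _); [apply: integral1|apply: integral0].
have {}IH : forall j, integralOver i (\prod_(r <- rs) ('X - r%:P))`_j.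
  by apply: IH => x xs; apply: H; rewrite inE xs orbT.
rewrite big_cons mulrBl coefB coefXM coefCM; apply: integral_sub.
  by case: ifP => _; [apply: integral0 | apply: IH].
by apply: integral_mul (IH _); apply: H; rewrite inE eqxx.
Qed.

(** The roots of g are roots of the monic f, hence integral over A; so are the coefficients of g,
    which lie in the fraction field of the integrally closed A. *)
Lemma monic_factor (A : idomainType) (f : {poly A}) (g h : {poly Frac A}) :
  int_closed A -> f \is monic -> g \is monic ->
  map_poly (frac A) f = g * h ->
  exists g0 : {poly A}, g = map_poly (frac A) g0.
Proof.
move=> icA mf mg Df; set ι := frac A in Df *.
have [E [e [rs Drs]]] := splitting_extension (monic_neq0 mg).
rewrite (monicP mg) rmorph1 scale1r in Drs.
have Hrs r : r \in rs -> integralOver (e \o ι) r.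
  move=> rrs; exists f => //.
  rewrite map_poly_comp /= -/ι Df rmorphM /= rootM Drs root_prod_XsubC rrs //.
have /choice[c Hc] : forall j, exists a, g`_j = ι a.
  move=> j; have [w mw wr] : integralOver (e \o ι) (e g`_j).
    by rewrite -coef_map Drs; apply: integral_prod_XsubC.
  have [a [b [nb Dg]]] := frac_repr g`_j.
  have nb' : ι b != 0 by rewrite frac_eq0.
  have [|r Hr] := icA a b w nb mw.
    apply/eqP; rewrite -frac_eq0 -/ι.
    have : root (map_poly ι w) g`_j by rewrite -(fmorph_root e) -map_poly_comp.
    rewrite rootE Dg horner_coef size_map_monic // => /eqP/(congr1 (fun x => ι b ^+ (size w).-1 * x)).
    rewrite mulr0 => <-; rewrite /homg rmorph_sum mulr_sumr; apply/eqP/eq_bigr => i _.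
    rewrite coef_map !rmorphM !rmorphXn exprMn exprVn.
    have -> : ι b ^+ (size w).-1 = ι b ^+ i * ι b ^+ ((size w).-1 - i).
      by rewrite -exprD subnKC // -ltnS (ltn_predK (ltn_ord i)).
    have nbi : ι b ^+ i != 0 by rewrite expf_neq0.
    move: nbi; rewrite /= /ι; move: (frac A b ^+ i) (frac A b ^+ (_ - i)).
    by move: (frac A w`_i) (frac A a ^+ i) => u v y z ny; field.
  by exists r; rewrite Dg Hr rmorphM mulfK.
exists (\poly_(j < size g) c j); apply/polyP => j; rewrite coef_map coef_poly.
by case: ltnP => [_|sj]; [apply: Hc | rewrite raddf0 nth_default].
Qed.

Lemma map_polyZXC (A B : nzRingType) (f : {rmorphism A -> B}) c d (p : {poly A}) :
  map_poly f (c *: p * 'X + d%:P) = f c *: map_poly f p * 'X + (f d)%:P.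
Proof. by rewrite rmorphD rmorphM /= map_polyZ map_polyX map_polyC. Qed.

Lemma frac_denominators (A : idomainType) (p : {poly Frac A}) :
  exists (d : A) (P : {poly A}), d != 0 /\ map_poly (frac A) P = frac A d *: p.
Proof.
elim/poly_ind: p => [|p c [d [P [nd HP]]]].
  by exists 1, 0; rewrite oner_neq0 rmorph0 scaler0.
have [u [w [nw ->]]] := frac_repr c.
exists (d * w), (w *: P * 'X + (d * u)%:P); split; first by rewrite mulf_neq0.
rewrite map_polyZXC HP !rmorphM /=.
have nw' : frac A w != 0 by rewrite frac_eq0.
rewrite scalerDr -!mul_polyC; congr (_ + _); first by rewrite polyCM; ring.
by rewrite -!polyCM; congr (_%:P); field.
Qed.

(* If the monic [f] has a root in common with a polynomial of smaller degree *)
(* over a field in which [k(t)] embeds, then it factors already over [k[t]].  *)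
Theorem gauss_factor (k E : fieldType) (h : {rmorphism k -> E}) d (t : 'I_d -> E) s
    (f u : {poly {mpoly k[d]}}) :
  infinite k -> alg_independent h t -> f \is monic -> u != 0 -> (size u < size f)%N ->
  ev2 h t s f = 0 -> ev2 h t s u = 0 ->
  exists g1 g2 : {poly {mpoly k[d]}}, [/\ g1 \is monic, g2 \is monic, f = g1 * g2,
    (1 < size g1)%N & (1 < size g2)%N].
Proof.
move=> infk it mf nu suf f0 u0; pose A : idomainType := {mpoly k[d]}.
have icA : int_closed A := @int_closed_mpoly k d infk.
pose φ : {rmorphism {poly A} -> {poly Frac A}} := map_poly (frac A).
have sφ p : size (φ p) = size p.
  by apply: size_map_inj_poly; [apply: frac_inj | apply: rmorph0].
have φI : injective φ by apply: map_inj_poly; [apply: frac_inj | apply: rmorph0].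
have nφu : φ u != 0 by rewrite -size_poly_eq0 sφ size_poly_eq0.
have nφf : φ f != 0 by rewrite -size_poly_eq0 sφ size_poly_eq0 monic_neq0.
pose g := gcdp (φ f) (φ u).
have ng : g != 0 by rewrite gcdp_eq0 negb_and nφf.
(* If f and u were coprime, a Bezout identity cleared of denominators and evaluated at (t,s) would
   give a nonzero polynomial vanishing at t. *)
have sg1 : (1 < size g)%N.
  rewrite ltn_neqAle eq_sym size_poly_gt0 ng andbT; apply/negP => cop.
  have /Bezout_eq1_coprimepP[[x y] /= xy] : coprimep (φ f) (φ u) by [].
  have [dx [X [ndx HX]]] := frac_denominators x.
  have [dy [Y [ndy HY]]] := frac_denominators y.
  have : (dx * dy) = 0.
    apply: it; have : (dy *: X) * f + (dx *: Y) * u = (dx * dy)%:P.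
      apply: φI; rewrite rmorphD !rmorphM /= !map_polyZ /= HX HY map_polyC /=.
      rewrite !scalerA -!scalerAl [frac _ dy * _]mulrC -scalerDr xy.
      by rewrite map_polyC /= -polyCM alg_polyC.
    move=> EQ; have : ev2 h t s ((dy *: X) * f + (dx *: Y) * u) = 0.
      by rewrite rmorphD !rmorphM /= hornerD !hornerM f0 u0 !mulr0 addr0.
    by rewrite EQ map_polyC hornerC.
  by apply/eqP; rewrite mulf_neq0.
pose g' := (lead_coef g)^-1 *: g.
have nl : (lead_coef g)^-1 != 0 by rewrite invr_eq0 lead_coef_eq0.
have mg' : g' \is monic by rewrite monicE lead_coefZ mulVf // lead_coef_eq0.
have /dvdpP[g2' Dg] : g' %| φ f by rewrite dvdpZl // dvdp_gcdl.
have mφf : φ f \is monic by apply: monic_map.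
have mg2' : g2' \is monic by move: mφf; rewrite Dg monicMr.
have [g1 Dg1] := monic_factor icA mf mg' (etrans Dg (mulrC _ _)).
have [g2 Dg2] := monic_factor icA mf mg2' Dg.
have sg' : size g' = size g by rewrite size_scale.
have ssg : (size g' < size f)%N.
  by rewrite sg'; apply: leq_ltn_trans suf; rewrite -(sφ u); apply: dvdp_leq (dvdp_gcdr _ _).
have monI p : φ p \is monic -> p \is monic.
  rewrite !monicE !lead_coefE sφ coef_map /= => /eqP EQ; apply/eqP/frac_inj.
  by rewrite EQ rmorph1.
have Eg1 : φ g1 = g' := esym Dg1.
have Eg2 : φ g2 = g2' := esym Dg2.
exists g1, g2; split.
- by apply: monI; rewrite Eg1.
- by apply: monI; rewrite Eg2.
- by apply: φI; rewrite rmorphM Eg1 Eg2 mulrC.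
- by rewrite -sφ Eg1 sg'.
rewrite -sφ Eg2; move: ssg; rewrite -(sφ f) Dg size_Mmonic ?monic_neq0 //.
by have := sg1; rewrite -sg'; move: (size g') (size g2') => x y; lia.
Qed.

(** * Regular extensions *)

Lemma rmorph_lift (K F E : fieldType) (i : {rmorphism F -> E}) (h : {rmorphism K -> E}) :
  (forall c, exists y, i y = h c) -> exists k : {rmorphism K -> F}, forall c, i (k c) = h c.
Proof.
move=> /choice[k Hk].
have kB : zmod_morphism k by move=> x y; apply: (fmorph_inj i); rewrite rmorphB !Hk rmorphB.
have kM : monoid_morphism k.
  by split=> [|x y]; apply: (fmorph_inj i); rewrite ?rmorph1 ?rmorphM !Hk ?rmorph1 ?rmorphM.
pose ka := GRing.isZmodMorphism.Build K F k kB.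
pose km := GRing.isMonoidMorphism.Build K F k kM.
by exists (HB.pack_for {rmorphism K -> F} k ka km).
Qed.

Lemma perfect_separable_root (K E : fieldType) (h : {rmorphism K -> E}) x :
  perfect_field K -> algebraicOver h x ->
  exists q : {poly K}, separable_poly q /\ root (map_poly h q) x.
Proof.
move=> perfK algx; pose t : 'I_1 -> E := fun=> x.
have dep : ~ alg_independent h t.
  move=> it; apply: (indep_last it); exact: algOn_base.
have [j [q [sep_q qx]]] := perfect_relation perfK dep.
have /choice[c Hc] : forall k, exists a, h a = sfval _ q`_k.
  move=> k; have [p [r [_ ->]]] : gen h (t \o lift j) (sfval _ q`_k) by apply/sfvalP; exists q`_k.
  exists (p@_0 / r@_0); rewrite fmorph_div.
  have E0 (p' : {mpoly K[0]}) : ev h (t \o lift j) p' = h p'@_0.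
    by rewrite {1}(_ : p' = (p'@_0)%:MP) ?evC // mpolyKC.
  by rewrite -!E0.
pose q' := \poly_(k < size q) c k.
have Eq : map_poly h q' = map_poly (sfval _) q.
  apply/polyP => k; rewrite !coef_map coef_poly; case: ltnP => sk; first exact: Hc.
  by rewrite nth_default // !raddf0.
by exists q'; rewrite -(separable_map h) Eq separable_map.
Qed.

Lemma infinite_neq_root (K E : fieldType) (h : {rmorphism K -> E}) (r : {poly E}) :
  infinite K -> r != 0 -> exists c, ~~ root r (h c).
Proof.
move=> infK nz_r; apply: contrapT => no; move/eqP: nz_r; apply.
apply: (poly_infinite (@fmorph_inj _ _ h) infK) => c; apply/rootP.
by apply: contraT => nc; case: no; exists c.
Qed.

Lemma primitive_element (K E : fieldType) (h : {rmorphism K -> E}) n (c : 'I_n -> E) :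
  perfect_field K -> infinite K -> (forall j, algebraicOver h (c j)) ->
  exists z, algebraicOver h z /\ forall j, exists p, c j = (map_poly h p).[z].
Proof.
move=> perfK infK; elim: n c => [|n IH] c Hc.
  by exists 0; split=> [|[]//]; apply: algebraic0.
have [z0 [[p nz_p pz] Hz]] := IH (c \o lift ord0) (fun j => Hc _).
have [q [sep_q qy]] := perfect_separable_root perfK (Hc ord0).
have [r nz_r Hr] := large_field_PET nz_p pz qy sep_q.
have [a ra] := infinite_neq_root h infK nz_r.
have := Hr a ra => /=; set z := _ - z0 => -[[q1 Hq1] [q2 Hq2]].
exists z; split.
  apply: algebraic_sub; last by exists p.
  by apply: algebraic_mul; [apply: algebraic_id | apply: Hc].
move=> j; case: (unliftP ord0 j) => [i ->|->]; last by exists q2.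
have [u Hu] := Hz i; exists (u \Po q1); rewrite -Hq1 in Hu.
by rewrite -[LHS]/((c \o lift ord0) i) Hu map_comp_poly horner_comp.
Qed.

Definition rel_closed (K F : fieldType) (h : K -> F) :=
  forall x, algebraicOver h x -> exists c, x = h c.

(* A minimal polynomial over a relatively algebraically closed subfield      *)
(* remains irreducible: its factors have algebraic coefficients.             *)
Lemma rel_closed_minpoly (K F E : fieldType) (h : {rmorphism K -> F}) (g : {rmorphism F -> E}) z
    (m : {poly K}) (u : {poly F}) : rel_closed h -> irreducible_poly m ->
  root (map_poly (g \o h) m) z -> root (map_poly g u) z -> (size u < size m)%N -> u = 0.
Proof.
move=> clK irr_m mz uz; have nz_m := irredp_neq0 irr_m.
have [|μ [mμ _ μz Hμ]] := @minimal_polynomial F E g z.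
  by exists (map_poly h m); rewrite ?map_poly_eq0 // -map_poly_comp.
have [D [e [rs Drs]]] := splitting_extension (monic_neq0 mμ).
rewrite (monicP mμ) rmorph1 scale1r in Drs.
have /choice[c Hc] : forall k, exists a, μ`_k = h a.
  move=> k; apply: clK; apply/integral_algebraic.
  have [w mw wr] : integralOver (e \o h) (e μ`_k).
    rewrite -coef_map Drs; apply: integral_prod_XsubC => r rrs; apply/integral_algebraic.
    exists m => //; have /dvdpP[v Dv] : μ %| map_poly h m by apply: Hμ; rewrite -map_poly_comp.
    by rewrite map_poly_comp /= Dv rmorphM /= rootM Drs root_prod_XsubC rrs orbT.
  by exists w => //; rewrite -(fmorph_root e) -map_poly_comp.
pose ν := \poly_(k < size μ) c k.
have Eν : map_poly h ν = μ.
  apply/polyP => k; rewrite coef_map coef_poly; case: ltnP => sk; first exact/esym/Hc.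
  by rewrite raddf0 nth_default.
have [|m1 [_ _ m1z Hm1]] := @minimal_polynomial K E (g \o h) z; first by exists m.
have mν : m %| ν.
  have : m1 %= m.
    apply: irr_m.2; last exact: Hm1.
    apply/eqP => s1; have := m1z; have /size_poly1P[a na ->] : size m1 == 1 by apply/eqP.
    by rewrite map_polyC rootC fmorph_eq0 (negPf na).
  by move=> /eqp_dvdl <-; apply: Hm1; rewrite map_poly_comp /= Eν.
have nz_ν : ν != 0 by rewrite -(map_poly_eq0 h) Eν monic_neq0.
move=> lt_um; apply/eqP; apply: contraLR lt_um => nz_u; rewrite -leqNgt.
apply: leq_trans (dvdp_leq nz_ν mν) _.
by rewrite -(size_map_poly h) Eν; apply: dvdp_leq nz_u (Hμ _ uz).
Qed.

(** The coefficients of a relation are polynomials in one algebraic element z, of degree less than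
    that of z over K. The relation becomes a polynomial over F vanishing at z, of degree less than
    the minimal polynomial of z, which is still irreducible over F. It is zero, and its coefficients
    are relations over K. *)
Theorem regular_of_closed (K F : fieldType) (h : {rmorphism K -> F}) :
  perfect_field K -> infinite K -> rel_closed h -> regular_extension h.
Proof.
move=> perfK infK clK E g n a ia c Hc c0.
have [z [algz Hz]] := primitive_element (h := g \o h) perfK infK Hc.
have [m [mm irr_m mz Hm]] := minimal_polynomial algz.
have /choice[p Hp] : forall j, exists p, c j = (map_poly (g \o h) p).[z] /\ (size p < size m)%N.
  move=> j; have [p Hp] := Hz j; exists (p %% m); rewrite ltn_modp irredp_neq0 //; split=> //.
  rewrite Hp {1}(divp_eq p m) rmorphD rmorphM /= hornerD hornerM.
  by rewrite (rootP mz) mulr0 add0r.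
pose u := \sum_j a j *: map_poly h (p j).
have uz : root (map_poly g u) z.
  rewrite rootE rmorph_sum horner_sum; apply/eqP; rewrite -[RHS]c0; apply: eq_bigr => j _.
  by rewrite /= map_polyZ hornerZ -map_poly_comp mulrC; case: (Hp j) => <-.
have su : (size u < size m)%N.
  have m0 : (0 < size m)%N by rewrite size_poly_gt0 irredp_neq0.
  rewrite -(prednK m0) ltnS; apply: leq_trans (size_sum _ _ _) _.
  apply/bigmax_leqP => j _; apply: leq_trans (size_scale_leq _ _) _.
  by rewrite size_map_poly -ltnS prednK //; case: (Hp j).
have u0 : u = 0.
  by apply: (rel_closed_minpoly clK irr_m mz uz su).
move=> j; have [-> _] := Hp j.
suff -> : p j = 0 by rewrite rmorph0 horner0.
apply/polyP => k; rewrite coef0; apply: (ia (fun j => (p j)`_k)).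
have := congr1 (fun q : {poly F} => q`_k) u0; rewrite coef0 coef_sum => u0k.
rewrite -[RHS]u0k; by apply: eq_bigr => i _; rewrite coefZ coef_map mulrC.
Qed.

Lemma irreducible_of_min (F E : fieldType) (g : {rmorphism F -> E}) (P : {poly F}) x :
  (1 < size P)%N -> root (map_poly g P) x ->
  (forall u, root (map_poly g u) x -> (size u < size P)%N -> u = 0) -> irreducible_poly P.
Proof.
move=> s1 Px Hmin; have nz_P : P != 0 by rewrite -size_poly_gt0 ltnW.
split=> // q q1 /dvdpP[r DP].
have nz_q : q != 0 by apply: contraNneq nz_P => q0; rewrite DP q0 mulr0.
have nz_r : r != 0 by apply: contraNneq nz_P => r0; rewrite DP r0 mul0r.
have := Px; rewrite DP rmorphM rootM => /orP[rx|qx].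
  suff r0 : r = 0 by rewrite r0 eqxx in nz_r.
  apply: Hmin rx _; rewrite DP size_mul //.
  by move: q1 nz_q nz_r; rewrite -!size_poly_gt0; move: (size q) (size r) => a b; lia.
have qP : q %| P by rewrite DP dvdp_mull.
have sq : size q = size P.
  apply/eqP; rewrite eqn_leq (dvdp_leq nz_P qP) leqNgt.
  by apply: contra nz_q => /(Hmin _ qx) ->.
by rewrite -DP -(dvdp_size_eqp qP) sq.
Qed.

Lemma min_of_irreducible (F E : fieldType) (g : {rmorphism F -> E}) (P : {poly F}) x u :
  irreducible_poly P -> root (map_poly g P) x -> root (map_poly g u) x ->
  (size u < size P)%N -> u = 0.
Proof.
move=> irr Px ux su; apply/eqP; apply: contraLR su => nz_u; rewrite -leqNgt.
apply: dvdp_leq => //.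
have [|m [mm mi mx Hm]] := @minimal_polynomial F E g x; first by exists P; rewrite ?irredp_neq0.
have /andP[_ Pm] : m %= P by apply: irr.2; [rewrite gtn_eqF // mi.1 | apply: Hm].
by apply: dvdp_trans Pm _; apply: Hm.
Qed.

(* If [P] remains irreducible over [F], then [K[X]/P] and [F] are linearly   *)
(* disjoint over [K]; but a root of [q] in the former and one in the latter  *)
(* generate isomorphic extensions of [K].                                    *)
Lemma closed_of_root (K F : fieldType) (h : {rmorphism K -> F}) (P q r Q : {poly K}) x :
  irreducible_poly (map_poly h P) -> irreducible_poly q -> q \Po r = P * Q ->
  root (map_poly h q) x -> exists c, x = h c.
Proof.
move=> irrP irrq Dq qx.
have nz_P : P != 0 by rewrite -(map_poly_eq0 h) irredp_neq0.
have nz_q := irredp_neq0 irrq.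
have [E [g [θ Pθ]]] : exists (E : fieldType) (g : {rmorphism F -> E}) y, root (map_poly g (map_poly h P)) y.
  by apply: root_extension; rewrite gtn_eqF // irrP.1.
have gh p : map_poly (g \o h) p = map_poly g (map_poly h p) by rewrite map_poly_comp.
pose ρ := (map_poly (g \o h) r).[θ].
have qρ : root (map_poly (g \o h) q) ρ.
  by rewrite rootE -horner_comp -map_comp_poly Dq rmorphM /= hornerM gh (rootP Pθ) mul0r.
have P1 : (1 < size P)%N by rewrite -(size_map_poly h) irrP.1.
have m0 p : (map_poly (g \o h) (p %% P)).[θ] = (map_poly (g \o h) p).[θ].
  by rewrite {2}(divp_eq p P) rmorphD rmorphM /= hornerD hornerM [map_poly _ P]gh (rootP Pθ) mulr0 add0r.
have [w Dw] := factor_theorem _ _ qx.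
(* Over F one has q = w (X - x). Either ρ equals x, and then r reduced modulo P is the constant x;
   or ρ is a root of w, which is excluded by linear disjointness. *)
have := qρ; rewrite gh Dw rmorphM rootM => /orP[wρ|]; last first.
  rewrite rmorphB /= map_polyX map_polyC root_XsubC => /eqP ρx.
  pose v := map_poly h (r %% P) - x%:P.
  have v0 : v = 0.
    apply: (min_of_irreducible irrP Pθ).
      by rewrite rootE rmorphB /= map_polyC hornerD hornerN hornerC -gh m0 -/ρ ρx subrr.
    rewrite /v (leq_ltn_trans (size_polyD _ _)) // size_polyN gtn_max !size_map_poly ltn_modp nz_P.
    by rewrite size_polyC (leq_ltn_trans _ P1) //; case: (_ == _).
  exists ((r %% P)`_0); have := congr1 (fun p : {poly F} => p`_0) v0.
  by rewrite coefB coef_map coefC coef0 /= => /eqP; rewrite subr_eq0 => /eqP.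
pose n := (size q).-1; have sq : size q = n.+1 by rewrite (ltn_predK irrq.1).
have nz_w : w != 0.
  by apply: contraTneq nz_q => w0; rewrite negbK -(map_poly_eq0 h) Dw w0 mul0r.
have sw : size w = n.
  have := congr1 (fun p : {poly F} => size p) Dw.
  by rewrite size_Mmonic ?monicXsubC // size_XsubC addn2 size_map_poly sq => -[].
pose D := (size P).-1; have sP : size P = D.+1 by rewrite (ltn_predK P1).
(* The coordinates of the powers of ρ in the basis of the powers of θ. The rows are independent over
   K because ρ has degree n over K. *)
pose W := \matrix_(l < n, j < D) (r ^+ l %% P)`_j.
have evW (l : 'I_n) : ρ ^+ l = \sum_(j < D) g (h (W l j)) * θ ^+ j.
  have -> : ρ ^+ l = (map_poly (g \o h) (r ^+ l %% P)).[θ].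
    by rewrite m0 rmorphXn horner_exp.
  rewrite (horner_coef_wide _ (n := D)); last by rewrite size_map_poly -ltnS -sP ltn_modp.
  by apply: eq_bigr => j _; rewrite coef_map mxE.
have key (A : fieldType) (i : {rmorphism K -> A}) (k : {rmorphism A -> E}) (v : 'rV[A]_n) :
    (forall c, k (i c) = g (h c)) ->
    \sum_(l < n) k (v 0 l) * ρ ^+ l = \sum_(j < D) k ((v *m map_mx i W) 0 j) * θ ^+ j.
  move=> ki; under eq_bigr => l _ do rewrite evW mulr_sumr.
  rewrite exchange_big; apply: eq_bigr => j _ /=; rewrite mxE rmorph_sum mulr_suml.
  by apply: eq_bigr => l _; rewrite rmorphM [map_mx _ _ _ _]mxE ki mulrA.
have freeW : row_free W.
  apply: inj_row_free => v v0; apply/rowP => l; rewrite mxE.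
  pose y := \poly_(l < n) (if insub l is Some l' then v 0 l' else 0).
  have yl (l' : 'I_n) : y`_l' = v 0 l' by rewrite coef_poly ltn_ord valK.
  rewrite -yl; suff -> : y = 0 by rewrite coef0.
  apply: (min_of_irreducible irrq qρ); last by rewrite sq ltnS size_poly.
  rewrite rootE (horner_coef_wide _ (n := n)) ?size_map_poly ?size_poly //.
  under eq_bigr => l' _ do rewrite coef_map yl.
  have := key K idfun (g \o h) v (fun c => erefl) => /= ->.
  rewrite big1 // => j _; rewrite (_ : map_mx idfun W = W) ?v0 ?mxE ?rmorph0 ?mul0r //.
  by apply/matrixP => a b; rewrite mxE.
pose v : 'rV[F]_n := \row_l w`_l.
have v0 : v *m map_mx h W = 0.
  pose y := \poly_(j < D) (if insub j is Some j' then (v *m map_mx h W) 0 j' else 0).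
  have yj (j' : 'I_D) : y`_j' = (v *m map_mx h W) 0 j' by rewrite coef_poly ltn_ord valK.
  have yθ : root (map_poly g y) θ.
    rewrite rootE (horner_coef_wide _ (n := D)) ?size_map_poly ?size_poly //.
    under eq_bigr => j' _ do rewrite coef_map yj.
    rewrite -(key F h g v (fun c => erefl)).
    move: wρ; rewrite (rootE _ ρ) (horner_coef_wide _ (n := n)) ?size_map_poly ?sw // => /eqP wρ.
    by apply/eqP; rewrite -[RHS]wρ; apply: eq_bigr => l _; rewrite coef_map mxE.
  apply/rowP => j; rewrite [RHS]mxE -yj (min_of_irreducible irrP Pθ yθ) ?coef0 //.
  by rewrite size_map_poly sP ltnS size_poly.
(* Independence of rows survives the passage from K to F, whereas [w(ρ) = 0] is a relation over F
   between them. *)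
have frW : row_free (map_mx h W) by rewrite row_free_map.
have vz : v = 0 by apply: (row_free_inj frW); rewrite /= v0 mul0mx.
suff w0 : w = 0 by rewrite w0 eqxx in nz_w.
apply/polyP => l; rewrite coef0; case: (ltnP l n) => ln; last first.
  by rewrite nth_default // sw.
by have /rowP/(_ (Ordinal ln)) := vz; rewrite !mxE.
Qed.

(** * Degree bounds *)

Section Bounds.
Variables (R : fieldType) (n : nat).

Lemma msize_leP m (p : {mpoly R[m]}) B :
  (msize p <= B)%N <-> forall u, u \in msupp p -> (mdeg u < B)%N.
Proof.
rewrite msizeE; split=> [/bigmax_leqP_seq H u us|H]; first exact: H.
by apply/bigmax_leqP_seq => u us _; apply: H.
Qed.

Definition mcat (m : 'X_{1..n}) (j : nat) : 'X_{1..n.+1} := [multinom snoc m j i | i < n.+1].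

Lemma mdeg_mcat m j : mdeg (mcat m j) = (mdeg m + j)%N.
Proof.
rewrite !mdegE big_ord_recr /= mnmE snoc_max; congr (_ + _)%N.
apply: eq_bigr => i _; rewrite mnmE -[widen_ord _ i]/(widen1 i).
by rewrite /snoc unlift_widen1.
Qed.

Lemma mcat_eta (m : 'X_{1..n.+1}) : mcat [multinom m (widen1 i) | i < n] (m ord_max) = m.
Proof.
apply/mnmP => i; rewrite mnmE /snoc; case: unliftP => [j ->|->] //.
by rewrite mnmE lift_widen1.
Qed.

Lemma muni_coef (p : {mpoly R[n.+1]}) j m : (muni p)`_j@_m = p@_(mcat m j).
Proof.
rewrite muniE coef_sum raddf_sum [in RHS](mpolyE p) (raddf_sum (mcoeff _)) /=.
apply: eq_bigr => u _.
rewrite coefZ coefXn mcoeffZ mcoeffX.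
case: (j =P u ord_max) => [->|nj].
  rewrite mulr1 mcoeffZ mcoeffX; congr (_ * (_ : bool)%:R); apply/eqP/eqP => [<-|->].
    by rewrite -[LHS]mcat_eta; congr mcat; apply/mnmP => i; rewrite !mnmE.
  apply/mnmP => i; rewrite !mnmE -[widen_ord _ i]/(widen1 i).
  by rewrite /snoc unlift_widen1.
rewrite mulr0 mcoeff0; case: eqP => [Du|]; last by rewrite mulr0.
by case: nj; rewrite Du mnmE snoc_max.
Qed.

Lemma mbackM : {morph @mback R n : p q / p * q}.
Proof. by move=> p q; apply: (can_inj (@muniK R n)); rewrite muniM !mbackK. Qed.

Lemma mback_eq0 (p : {poly {mpoly R[n]}}) : (mback p == 0) = (p == 0).
Proof. by rewrite -muni_eq0 mbackK. Qed.

Lemma coef_bound (p : {poly {mpoly R[n]}}) j : (msize p`_j <= msize (mback p))%N.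
Proof.
apply/msize_leP => m; rewrite mcoeff_msupp -{1}[p]mbackK muni_coef -mcoeff_msupp.
by move=> /msize_mdeg_lt; rewrite mdeg_mcat; apply: leq_ltn_trans; apply: leq_addr.
Qed.

Lemma mback_bound (p : {poly {mpoly R[n]}}) B N :
  (forall j, (msize p`_j <= B)%N) -> (size p <= N)%N -> (msize (mback p) <= B + N)%N.
Proof.
move=> pB pN; apply/msize_leP => m; rewrite mcoeff_msupp -[m]mcat_eta -muni_coef mbackK.
set j := m ord_max; set m' := [multinom _ | i < n] => nz; rewrite mdeg_mcat.
have jN : (j < N)%N.
  rewrite ltnNge; apply: contra nz => Nj.
  by rewrite nth_default ?mcoeff0 // (leq_trans pN).
have := pB j => /msize_leP/(_ m'); rewrite mcoeff_msupp => /(_ nz) mB.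
by apply: leq_trans (leq_add mB (ltnW jN)) => //; rewrite addSn.
Qed.

(** Total degree, including that in the main variable, is additive on products; hence it bounds the
    degrees of the coefficients of any factor. *)
Lemma factor_bound (f g1 g2 : {poly {mpoly R[n]}}) B N :
  f = g1 * g2 -> f != 0 -> (forall j, (msize f`_j <= B)%N) -> (size f <= N)%N ->
  forall j, (msize g1`_j <= B + N)%N.
Proof.
move=> Df nz fB fN j; apply: leq_trans (coef_bound g1 j) _.
apply: leq_trans (mback_bound fB fN); rewrite Df mbackM.
have nz1 : g1 != 0 by apply: contraNneq nz => g0; rewrite Df g0 mul0r.
have nz2 : g2 != 0 by apply: contraNneq nz => g0; rewrite Df g0 mulr0.
have nm2 : mback g2 != 0 by rewrite mback_eq0.
rewrite msizeM ?mback_eq0 //; have : (0 < msize (mback g2))%N.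
  by rewrite lt0n msize_poly_eq0.
by move: (msize (mback g1)) (msize (mback g2)) => x y; lia.
Qed.

End Bounds.

Lemma msizeM_bound (R : fieldType) n (p q : {mpoly R[n]}) B C :
  (msize p <= B)%N -> (msize q <= C)%N -> (msize (p * q) <= B + C)%N.
Proof.
have [->|nzp] := eqVneq p 0; first by rewrite mul0r msize0.
have [->|nzq] := eqVneq q 0; first by rewrite mulr0 msize0.
by rewrite msizeM //; move: (msize p) (msize q) => x y; lia.
Qed.

Lemma msizeB_bound (R : fieldType) n (p q : {mpoly R[n]}) B :
  (msize p <= B)%N -> (msize q <= B)%N -> (msize (p - q) <= B)%N.
Proof.
move=> pB qB; apply: leq_trans (msizeD_le _ _) _; rewrite geq_max pB /=.
by rewrite msizeN.
Qed.

Lemma msize_sum_bound (R : fieldType) n (J : Type) (s : seq J) (F : J -> {mpoly R[n]}) B :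
  (forall j, (msize (F j) <= B)%N) -> (msize (\sum_(j <- s) F j) <= B)%N.
Proof.
move=> FB; elim: s => [|j s IH]; first by rewrite big_nil msize0.
by rewrite big_cons; apply: leq_trans (msizeD_le _ _) _; rewrite geq_max FB.
Qed.

(** * Factorization modulo a polynomial, with bounded degrees *)

Section ModP.
Variables (K k : fieldType) (κ : {rmorphism K -> k}) (θ : k) (P : {poly K}) (d : nat).
Hypothesis mP : P \is monic.
Hypothesis Pθ : root (map_poly κ P) θ.
Hypothesis irrP : irreducible_poly P.

Definition at_last (q : {poly K}) : {mpoly K[d.+1]} := mback (map_poly (@mpolyC d K) q).

(** The last of the [d + 1] variables stands for a root of P; [spec_last] specializes it to θ. *)
Definition spec_last : {rmorphism {mpoly K[d.+1]} -> {mpoly k[d]}} :=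
  horner_eval (θ%:MP) \o map_poly (map_mpoly κ) \o @muni d K.

Lemma spec_lastE p : spec_last (mback p) = (map_poly (map_mpoly κ) p).[θ%:MP].
Proof. by rewrite /= mbackK. Qed.

Lemma spec_widen p : spec_last (mwiden p) = map_mpoly κ p.
Proof. by rewrite /= muni_mwiden /horner_eval map_polyC hornerC. Qed.

Lemma size_slice (p : {poly {mpoly K[d]}}) u : (size (map_poly (mcoeff u) p) <= size p)%N.
Proof. exact: size_poly. Qed.

Lemma coef_slice (p : {poly {mpoly K[d]}}) u j : (map_poly (mcoeff u) p)`_j = p`_j@_u.
Proof. by rewrite coef_map_id0 // mcoeff0. Qed.

Lemma spec_coef p u :
  (spec_last (mback p))@_u = (map_poly κ (map_poly (mcoeff u) p)).[θ].
Proof.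
rewrite spec_lastE (horner_coef_wide _ (size_poly _ _)).
rewrite (horner_coef_wide _ (leq_trans (size_poly _ _) (size_slice p u))).
rewrite (raddf_sum (mcoeff u)) /=; apply: eq_bigr => j _.
rewrite -[LHS]/(((map_poly (map_mpoly κ) p)`_j * θ%:MP ^+ j)@_u) !coef_map /=.
by rewrite -(rmorphXn (@mpolyC d k)) mulrC mcoeffCM mcoeff_map_mpoly mulrC.
Qed.

(** Divide by the monic P with respect to the last variable. For each monomial in the other
    variables, the remainder gives a polynomial over K vanishing at θ and of degree less than that
    of P, hence zero. *)
Lemma spec_eq0 p : spec_last p = 0 -> exists q, p = at_last P * q.
Proof.
move=> p0; have mPm : map_poly (@mpolyC d K) P \is monic.
  by rewrite monic_map.
have := Pdiv.RingMonic.rdivp_eq mPm (muni p); set Q := Pdiv.Ring.rdivp _ _; set r := Pdiv.Ring.rmodp _ _ => Dp.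
have sr : (size r < size P)%N.
  have := Pdiv.Ring.ltn_rmodpN0 (muni p) (monic_neq0 mPm).
  by rewrite size_map_poly_id0 // (monicP mP) rmorph1 oner_neq0.
have r0 : r = 0.
  apply/polyP => j; apply/mpolyP => u; rewrite coef0 mcoeff0 -coef_slice.
  suff -> : map_poly (mcoeff u) r = 0 by rewrite coef0.
  apply: (min_of_irreducible irrP Pθ); last exact: leq_ltn_trans (size_slice _ _) sr.
  apply/rootP; rewrite -spec_coef.
  have : (map_poly (map_mpoly κ) (muni p)).[θ%:MP] = 0 by rewrite -spec_lastE muniK.
  rewrite Dp rmorphD rmorphM /= hornerD hornerM -!spec_lastE.
  have -> : spec_last (mback (map_poly (@mpolyC d K) P)) = 0.
    apply/mpolyP => v; rewrite spec_coef mcoeff0.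
    have -> : map_poly (mcoeff v) (map_poly (@mpolyC d K) P) = (v == 0%MM)%:R *: P.
      apply/polyP => i; rewrite coef_slice coefZ coef_map mcoeffC mulrC eq_sym.
      by rewrite eq_sym.
    by rewrite map_polyZ hornerZ (rootP Pθ) mulr0.
  by rewrite mulr0 add0r => r0; apply: (etrans (congr1 (mcoeff u) r0)); rewrite mcoeff0.
by exists (mback Q); rewrite -[LHS]muniK Dp r0 addr0 mbackM mulrC.
Qed.

Lemma spec_lift (g : {mpoly k[d]}) : (forall c, exists q, c = (map_poly κ q).[θ]) ->
  exists p, spec_last p = g /\ (msize p <= msize g + size P)%N.
Proof.
move=> Hk; have /choice[c Hc] : forall u, exists q : {poly K},
    g@_u = (map_poly κ q).[θ] /\ (size q <= size P)%N.
  move=> u; have [q Hq] := Hk g@_u; exists (q %% P); split; last first.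
    by rewrite ltnW // ltn_modp monic_neq0.
  by rewrite Hq {1}(divp_eq q P) rmorphD rmorphM /= hornerD hornerM (rootP Pθ) mulr0 add0r.
pose p := \poly_(j < size P) \sum_(u <- msupp g) (c u)`_j *: 'X_[u].
have Hp j u : (j < size P)%N -> p`_j@_u = if u \in msupp g then (c u)`_j else 0.
  move=> jP; rewrite coef_poly jP (raddf_sum (mcoeff u)) /=; case: ifP => ug.
    rewrite (bigD1_seq u) //= mcoeffZ mcoeffX eqxx mulr1 big1 ?addr0 // => v vu.
    by rewrite mcoeffZ mcoeffX (negPf vu) mulr0.
  rewrite big_seq big1 // => v vg; rewrite mcoeffZ mcoeffX; case: eqP => [vu|]; last by rewrite mulr0.
  by rewrite -vu vg in ug.
exists (mback p); split.
  apply/mpolyP => u; rewrite spec_coef.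
  have [ug|ng] := boolP (u \in msupp g).
    rewrite (Hc u).1; congr (map_poly _ _).[_]; apply/polyP => j; rewrite coef_slice.
    case: (ltnP j (size P)) => jP; first by rewrite Hp // ug.
    by rewrite coef_poly ltnNge jP /= mcoeff0 nth_default // (leq_trans (Hc u).2).
  have -> : map_poly (mcoeff u) p = 0.
    apply/polyP => j; rewrite coef_slice coef0.
    case: (ltnP j (size P)) => jP; first by rewrite Hp // (negPf ng).
    by rewrite coef_poly ltnNge jP /= mcoeff0.
  by rewrite rmorph0 horner0 memN_msupp_eq0.
apply: mback_bound; last exact: size_poly.
move=> j; apply/msize_leP => u; rewrite mcoeff_msupp.
case: (ltnP j (size P)) => jP; last by rewrite coef_poly ltnNge jP /= mcoeff0 eqxx.
by rewrite Hp //; case: ifP => [ug _|_]; [apply: msize_mdeg_lt | rewrite eqxx].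
Qed.

End ModP.

(* The monic [f], of degree [m], is reducible over [(K[X]/P)[X_1, ..., X_d]], *)
(* by polynomials of degrees less than [B].                                  *)
Definition red_mod (K : fieldType) (P : {poly K}) d (f : {poly {mpoly K[d]}}) m B :=
  exists n1 n2 (G1 G2 Q : {poly {mpoly K[d.+1]}}),
  [/\ [/\ (0 < n1)%N, (0 < n2)%N & (n1 + n2 = m)%N],
      [/\ (size G1 <= n1)%N, (size G2 <= n2)%N & (size Q <= m.+1)%N],
      forall j, [/\ (msize G1`_j <= B)%N, (msize G2`_j <= B)%N & (msize Q`_j <= B)%N] &
      map_poly (@mwiden d K) f = ('X^n1 + G1) * ('X^n2 + G2) + at_last d P *: Q].

(** The inner [B] bounds the coefficients of the lifts of two factors, and [B + B] those of their
    product; the quotient by P is bounded through them. *)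
Definition red_bound b m D := let B := (b + m.+1 + D)%N in (B + B + B)%N.

Lemma msizeM_le (R : fieldType) n (p q : {mpoly R[n]}) : p * q != 0 ->
  (msize q <= msize (p * q))%N.
Proof.
move=> nz; have nzp : p != 0 by apply: contraNneq nz => ->; rewrite mul0r.
have nzq : q != 0 by apply: contraNneq nz => ->; rewrite mulr0.
have : (0 < msize p)%N by rewrite lt0n msize_poly_eq0.
by rewrite msizeM //; move: (msize p) (msize q) => x y; lia.
Qed.

Lemma monic_top (R : nzRingType) (g : {poly R}) : g \is monic ->
  g = 'X^((size g).-1) + \poly_(k < (size g).-1) g`_k.
Proof.
move=> mg; have ng : (0 < size g)%N by rewrite size_poly_gt0 monic_neq0.
apply/polyP => j; rewrite coefD coefXn coef_poly.
case: (ltngtP j (size g).-1) => [_|jg|->]; rewrite ?add0r ?addr0 //.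
  by rewrite nth_default // -(prednK ng).
by rewrite -lead_coefE (monicP mg).
Qed.

(** Coefficients in K(θ) are lifted to polynomials in the last variable, keeping the leading
    coefficients equal to 1. The difference between f and the product of the lifts vanishes at θ,
    hence is a multiple of P. The degree bounds make the condition first order. *)
Lemma red_mod_factor (K k : fieldType) (κ : {rmorphism K -> k}) θ (P : {poly K}) d
    (f : {poly {mpoly K[d]}}) m b (g1 g2 : {poly {mpoly k[d]}}) :
  P \is monic -> irreducible_poly P -> root (map_poly κ P) θ ->
  (forall c, exists q, c = (map_poly κ q).[θ]) ->
  f \is monic -> size f = m.+1 -> (forall j, (msize f`_j <= b)%N) ->
  map_poly (map_mpoly κ) f = g1 * g2 -> g1 \is monic -> g2 \is monic ->
  (1 < size g1)%N -> (1 < size g2)%N -> red_mod P f m (red_bound b m (size P)).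
Proof.
move=> mP irrP Pθ Hk mf sf fb Df mg1 mg2 s1 s2.
set B := (b + m.+1 + size P)%N.
pose F := map_poly (map_mpoly κ) f : {poly {mpoly k[d]}}.
have nF : F != 0 by rewrite [F]Df mulf_neq0 // monic_neq0.
have bF j : (msize F`_j <= b)%N.
  rewrite coef_map; apply: leq_trans (fb j); apply/msize_leP => u.
  rewrite mcoeff_msupp mcoeff_map_mpoly fmorph_eq0 -mcoeff_msupp; exact: msize_mdeg_lt.
have sF : (size F <= m.+1)%N by rewrite -sf size_poly.
have b1 := factor_bound Df nF bF sF.
have b2 := factor_bound (etrans Df (mulrC g1 g2)) nF bF sF.
have lift (g : {poly {mpoly k[d]}}) : (forall j, (msize g`_j <= b + m.+1)%N) -> g \is monic ->
    exists G : {poly {mpoly K[d.+1]}}, [/\ (size G <= (size g).-1)%N,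
      forall j, (msize G`_j <= B)%N &
      map_poly (spec_last κ θ d) ('X^((size g).-1) + G) = g].
  move=> gb mg; have /choice[c Hc] : forall j, exists p : {mpoly K[d.+1]},
      spec_last κ θ d p = g`_j /\ (msize p <= B)%N.
    move=> j; have [p [Hp bp]] := spec_lift mP Pθ g`_j Hk; exists p; split=> //.
    by apply: leq_trans bp _; rewrite leq_add2r.
  exists (\poly_(j < (size g).-1) c j); split; first exact: size_poly.
    by move=> j; rewrite coef_poly; case: ifP => _; [exact: (Hc j).2 | rewrite msize0].
  rewrite [RHS](monic_top mg) rmorphD /= map_polyXn; congr (_ + _).
  apply/polyP => j; rewrite coef_map !coef_poly; case: ifP => _; first exact: (Hc j).1.
  exact: raddf0.
have [G1 [sG1 bG1 HG1]] := lift _ b1 mg1; have [G2 [sG2 bG2 HG2]] := lift _ b2 mg2.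
set n1 := (size g1).-1 in sG1 HG1; set n2 := (size g2).-1 in sG2 HG2.
have Dm : (n1 + n2 = m)%N.
  have := congr1 (fun p : {poly _} => size p) Df; rewrite size_map_monic // sf.
  rewrite size_mul ?monic_neq0 //.
  by rewrite /n1 /n2; move: s1 s2; move: (size g1) (size g2) => x y; lia.
pose R := map_poly (@mwiden d K) f - ('X^n1 + G1) * ('X^n2 + G2).
have R0 : map_poly (spec_last κ θ d) R = 0.
  have DG : map_poly (spec_last κ θ d) (('X^n1 + G1) * ('X^n2 + G2)) = g1 * g2.
    by rewrite -[in RHS]HG1 -[in RHS]HG2; apply: rmorphM.
  rewrite rmorphB /= DG -map_poly_comp -Df.
  apply/eqP; rewrite subr_eq0; apply/eqP; apply: eq_map_poly => p; exact: spec_widen.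
have Rj j : spec_last κ θ d R`_j = 0.
  by have := congr1 (fun p : {poly {mpoly k[d]}} => p`_j) R0; rewrite coef_map coef0.
have /choice[q Hq] : forall j, exists q, R`_j = at_last d P * q /\ (msize q <= msize R`_j)%N.
  move=> j; have [q Hq] := spec_eq0 mP Pθ irrP (Rj j).
  have [R0j|nz] := eqVneq R`_j 0; first by exists 0; rewrite R0j mulr0 msize0.
  by exists q; split=> //; rewrite Hq msizeM_le // -Hq.
have sG i (G : {poly {mpoly K[d.+1]}}) : (size G <= i)%N -> (size ('X^i + G)%R <= i.+1)%N.
  by move=> sGi; apply: leq_trans (size_polyD _ _) _; rewrite size_polyXn geq_max leqnn ltnW.
have sR : (size R <= m.+1)%N.
  apply: leq_trans (size_polyD _ _) _; rewrite size_polyN geq_max (leq_trans (size_poly _ _)) ?sf //=.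
  apply: leq_trans (size_polyMleq _ _) _; have := sG _ _ sG1; have := sG _ _ sG2.
  by rewrite -Dm; move: (size _) (size _) => x y; lia.
exists n1, n2, G1, G2, (\poly_(j < m.+1) q j); split.
- by split=> //; rewrite /n1 /n2; [move: s1; case: size => [|[]] | move: s2; case: size => [|[]]].
- by split=> //; apply: size_poly.
- have le3 : (B <= red_bound b m (size P))%N by rewrite /red_bound; lia.
  have bX i (G : {poly {mpoly K[d.+1]}}) j : (0 < B)%N -> (forall j, (msize G`_j <= B)%N) ->
      (msize ('X^i + G)`_j <= B)%N.
    move=> B0 bG; rewrite coefD coefXn; apply: leq_trans (msizeD_le _ _) _; rewrite geq_max bG andbT.
    by case: (_ == _); rewrite ?msize1 ?msize0.
  have B0 : (0 < B)%N by rewrite /B; lia.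
  move=> j; split; [exact: leq_trans (bG1 j) le3|exact: leq_trans (bG2 j) le3|].
  rewrite coef_poly; case: ifP => _; last by rewrite msize0.
  apply: leq_trans (Hq j).2 _; rewrite /R coefB; apply: msizeB_bound.
    rewrite coef_map; have bB : (b <= red_bound b m (size P))%N by rewrite /red_bound; lia.
    apply: leq_trans bB; apply/msize_leP => u; rewrite mcoeff_msupp -[u]mcat_eta -muni_coef.
    rewrite [muni _]muni_mwiden coefC; case: ifP => [/eqP -> |]; last by rewrite mcoeff0 eqxx.
    by rewrite -mcoeff_msupp mdeg_mcat addn0 => us; move: (fb j) => /msize_leP; apply.
  rewrite coefM; apply: leq_trans (_ : (B + B <= _)%N); last by rewrite /red_bound -/B; lia.
  by apply: msize_sum_bound => i; apply: msizeM_bound; apply: bX.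
rewrite -[LHS](subrK (('X^n1 + G1) * ('X^n2 + G2))) addrC; congr (_ + _).
apply/polyP => j; rewrite -/R coefZ coef_poly; case: ltnP => jm; first exact: (Hq j).1.
by rewrite nth_default ?mulr0 // (leq_trans sR).
Qed.

Lemma algebraic_exp (K E : fieldType) (h : {rmorphism K -> E}) x n :
  algebraicOver h x -> algebraicOver h (x ^+ n).
Proof.
move=> ax; elim: n => [|n IH]; first by rewrite expr0; apply: algebraic1.
by rewrite exprS; apply: algebraic_mul.
Qed.

Lemma algebraic_horner (K E : fieldType) (h : {rmorphism K -> E}) (p : {poly E}) x :
  (forall j, algebraicOver h p`_j) -> algebraicOver h x -> algebraicOver h p.[x].
Proof.
move=> ap ax; rewrite horner_coef; apply: algebraic_sum => j.
by apply: algebraic_mul => //; apply: algebraic_exp.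
Qed.

Lemma infinite_extension (K k : fieldType) (κ : {rmorphism K -> k}) : infinite K -> infinite k.
Proof.
move=> infK rs; have nz : \prod_(x <- rs) ('X - x%:P) != 0.
  by rewrite monic_neq0 // monic_prod_XsubC.
have [c Hc] := infinite_neq_root κ infK nz.
by exists (κ c); rewrite root_prod_XsubC in Hc.
Qed.

Lemma ev2_mod (K E : fieldType) (h : {rmorphism K -> E}) d (t : 'I_d -> E) s m
    (f p : {poly {mpoly K[d]}}) : f \is monic -> size f = m.+1 -> ev2 h t s f = 0 ->
  exists r : {poly {mpoly K[d]}}, (size r <= m)%N /\ ev2 h t s r = ev2 h t s p.
Proof.
move=> mf sf f0; exists (Pdiv.Ring.rmodp p f); split.
  by rewrite -ltnS -sf Pdiv.Ring.ltn_rmodpN0 // monic_neq0.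
by rewrite [in RHS](Pdiv.RingMonic.rdivp_eq mf p) rmorphD rmorphM /= hornerD hornerM f0 mulr0 add0r.
Qed.

Lemma spec_last_ev (K E : fieldType) (κ : {rmorphism K -> E}) θ d (t : 'I_d -> E) p :
  (spec_last κ θ d p).@[t] = ev κ (snoc t θ) p.
Proof.
apply: (@mpoly_rmorph_ext K E d.+1 (meval t \o spec_last κ θ d) (evr κ (snoc t θ))) => [c|i].
  rewrite -[RHS]/(ev κ _ _) evC /= muniC /horner_eval map_polyC hornerC /=.
  by rewrite map_mpolyC mevalC.
rewrite -[RHS]/(ev κ _ _) evX /= muniX /snoc /horner_eval; case: unliftP => [j _|_].
  by rewrite map_polyC hornerC /= map_mpolyX mevalXU.
by rewrite map_polyX hornerX mevalC.
Qed.

Lemma ev_mpolyw (E : fieldType) d (t : 'I_d -> E) (q : {mpoly E[d]}) B : (msize q <= B)%N ->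
  q.@[t] = \sum_(u : 'X_{1..d < B}) q@_u * \prod_i t i ^+ (u : 'X_{1..d}) i.
Proof.
move=> qB; rewrite {1}(mpolywE qB) rmorph_sum; apply: eq_bigr => u _ /=.
by rewrite mevalZ mevalX.
Qed.

Lemma sum_pair (J1 J2 : finType) (V : nmodType) (F : J1 * J2 -> V) :
  \sum_x F x = \sum_i \sum_j F (i, j).
Proof. by rewrite pair_big; apply: eq_bigr => -[]. Qed.

(* Over a regular extension, a generic point stays generic over [K(θ)].      *)
Lemma regular_generic (K F E : fieldType) (h : {rmorphism K -> F}) (g : {rmorphism F -> E}) d
    (t : 'I_d -> F) s m f θ (w : {poly {mpoly K[d.+1]}}) n :
  regular_extension h -> generic_root h t s m f -> algebraicOver (g \o h) θ ->
  (size w <= m)%N -> w`_n = 1 -> ev2 (g \o h) (snoc (g \o t) θ) (g s) w != 0.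
Proof.
move=> regF [mf sf f0 Hf] algθ sw wn; apply/eqP => w0.
pose κ : {rmorphism K -> E} := g \o h; pose σ := spec_last κ θ d.
have nm : (n < m)%N.
  rewrite ltnNge; apply/negP => mn; move/eqP: wn.
  by rewrite nth_default 1?eq_sym ?oner_eq0 // (leq_trans sw).
pose B := (\max_(k < m) msize (σ w`_k)%R).+1.
have wB (k : 'I_m) : (msize (σ w`_k)%R <= B)%N.
  by rewrite ltnW // ltnS; apply: (leq_bigmax k).
(* The elements [s^k t^u] with k < m are linearly independent over K by genericity, hence over the
   algebraic elements by regularity. The specialized w is a combination of them with one coefficient
   equal to 1. *)
pose J : finType := ('I_m * 'X_{1..d < B})%type.
pose a (x : J) : F := s ^+ x.1 * \prod_i t i ^+ (x.2 : 'X_{1..d}) i.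
pose c (x : J) : E := (σ w`_x.1)@_x.2.
have indep : lin_independent h (fun i : 'I_#|J| => a (enum_val i)).
  move=> b b0 j; pose b' (x : J) := b (enum_rank x).
  have {}b0 : \sum_x h (b' x) * a x = 0.
    rewrite -[RHS]b0 (reindex (@enum_val J predT)) /=; last exact/onW_bij/enum_val_bij.
    by apply: eq_bigr => i _; rewrite /b' enum_valK.
  pose W : {poly {mpoly K[d]}} := \poly_(k < m)
     (if insub k is Some k' then \sum_(u : 'X_{1..d < B}) b' (k', u) *: 'X_[u] else 0).
  have Wk (k : 'I_m) : W`_k = \sum_(u : 'X_{1..d < B}) b' (k, u) *: 'X_[u].
    by rewrite coef_poly ltn_ord valK.
  have W0 : W = 0.
    apply: Hf; first exact: size_poly.
    rewrite (horner_coef_wide _ (leq_trans (size_poly _ _) (size_poly _ _))).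
    rewrite -[RHS]b0 sum_pair.
    apply: eq_bigr => k _; rewrite coef_map Wk /= -[X in X * _]/(evr h t _) rmorph_sum mulr_suml.
    apply: eq_bigr => u _; rewrite -[X in X * _]/(ev h t _) map_mpolyZ mevalZ map_mpolyX mevalX /a /=.
    by rewrite -mulrA; congr (_ * _); apply: mulrC.
  have := congr1 (fun p : {poly {mpoly K[d]}} => p`_(enum_val j).1@_(enum_val j).2) W0.
  rewrite Wk coef0 mcoeff0 (raddf_sum (mcoeff _)) /= (bigD1 (enum_val j).2) //= mcoeffZ mcoeffX eqxx mulr1.
  rewrite big1 => [|u nu]; last by rewrite mcoeffZ mcoeffX (inj_eq val_inj) (negPf nu) mulr0.
  by rewrite addr0 /b' -surjective_pairing enum_valK.
have algc (i : 'I_#|J|) : algebraicOver (g \o h) (c (enum_val i)).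
  rewrite /c -[w`__]muniK spec_coef horner_coef; apply: algebraic_sum => j.
  apply: algebraic_mul; first by rewrite coef_map; apply: algebraic_id.
  exact: algebraic_exp.
have c0 : \sum_(i < #|J|) c (enum_val i) * g (a (enum_val i)) = 0.
  transitivity (\sum_x c x * g (a x)).
    rewrite [RHS](reindex (@enum_val J predT)) //=; exact/onW_bij/enum_val_bij.
  rewrite -[RHS]w0 (horner_coef_wide _ (leq_trans (size_poly _ _) sw)).
  rewrite sum_pair.
  apply: eq_bigr => k _; rewrite coef_map /= -[X in _ = X * _]/(ev κ _ _) -spec_last_ev -/σ.
  rewrite (ev_mpolyw _ (wB k)) mulr_suml; apply: eq_bigr => u _.
  rewrite /a /c /= rmorphM rmorphXn rmorph_prod.
  under eq_bigr do rewrite rmorphXn.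
  by rewrite -mulrA; congr (_ * _); apply: mulrC.
have u0B : (mdeg (0%MM : 'X_{1..d}) < B)%N by rewrite mdeg0.
have := regF E g _ _ indep _ algc c0 (enum_rank (Ordinal nm, BMultinom u0B)).
suff -> : c (enum_val (enum_rank (Ordinal nm, BMultinom u0B))) = 1 by move/eqP; rewrite oner_eq0.
by rewrite enum_rankK; apply: (etrans (congr1 (fun p => (σ p)@_0%MM) wn)); rewrite rmorph1 mcoeff1 eqxx.
Qed.

Lemma ev_ext (K E : fieldType) (h h' : {rmorphism K -> E}) n (a : 'I_n -> E) p :
  h =1 h' -> ev h a p = ev h' a p.
Proof. by move=> Hh; rewrite !evE; apply: eq_bigr => m _; rewrite Hh. Qed.

Lemma ev_spec_last (K k E : fieldType) (κ : {rmorphism K -> k}) (i : {rmorphism k -> E}) θ d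
    (t : 'I_d -> E) p : ev i t (spec_last κ θ d p) = ev (i \o κ) (snoc t (i θ)) p.
Proof.
apply: (@mpoly_rmorph_ext K E d.+1 (evr i t \o spec_last κ θ d) (evr (i \o κ) (snoc t (i θ)))) => [c|j].
  rewrite -[RHS]/(ev _ _ _) evC /= muniC /horner_eval map_polyC hornerC /=.
  by rewrite map_mpolyC; apply: evC.
rewrite -[RHS]/(ev _ _ _) evX /= muniX /snoc /horner_eval; case: unliftP => [l _|_].
  by rewrite map_polyC hornerC /= map_mpolyX; apply: evX.
by rewrite map_polyX hornerX; apply: evC.
Qed.

(** Specialize the last variable to a root θ of P. Each of the two factors is monic of degree less
    than m in s, hence nonzero at the generic point; but their product is f(s) = 0, as the multiple
    of P vanishes. *)
Theorem regular_not_red_mod (K F : fieldType) (h : {rmorphism K -> F}) d (t : 'I_d -> F) s m f P B :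
  regular_extension h -> generic_root h t s m f -> irreducible_poly P -> ~ red_mod P f m B.
Proof.
move=> regF gr irrP [n1 [n2 [G1 [G2 [Q [[n1p n2p Dm] [s1 s2 _] _ Df]]]]]].
have [E [g [θ Pθ]]] : exists (E : fieldType) (g : {rmorphism F -> E}) y, root (map_poly g (map_poly h P)) y.
  by apply: root_extension; rewrite size_map_poly gtn_eqF // irrP.1.
rewrite -map_poly_comp in Pθ.
have algθ : algebraicOver (g \o h) θ by exists P; rewrite ?irredp_neq0.
have nz n (G : {poly {mpoly K[d.+1]}}) : (size G <= n)%N -> (n < m)%N ->
    ev2 (g \o h) (snoc (g \o t) θ) (g s) ('X^n + G) != 0.
  move=> sG nm; apply: (regular_generic (n := n) regF gr algθ).
    by apply: leq_trans (size_polyD _ _) _; rewrite size_polyXn geq_max nm (leq_trans sG) // ltnW.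
  by rewrite coefD coefXn eqxx (nth_default _ sG) addr0.
have nm1 : (n1 < m)%N by rewrite -Dm -{1}[n1]addn0 ltn_add2l.
have nm2 : (n2 < m)%N by rewrite -Dm -{1}[n2]add0n ltn_add2r.
have := mulf_neq0 (nz _ _ s1 nm1) (nz _ _ s2 nm2).
rewrite -hornerM -rmorphM.
have -> : ('X^n1 + G1) * ('X^n2 + G2) = map_poly (@mwiden d K) f - at_last d P *: Q.
  by rewrite Df addrK.
rewrite rmorphB /= hornerD hornerN map_polyZ hornerZ -map_poly_comp.
have -> : evr (g \o h) (snoc (g \o t) θ) (at_last d P) = 0.
  rewrite -[LHS]/(ev _ _ _) ev_muni mbackK snoc_widen snoc_max -map_poly_comp.
  rewrite (eq_map_poly (g := g \o h)) => [|c]; first exact: (rootP Pθ).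
  by rewrite /= -[LHS]/(ev _ _ _) evC.
rewrite mul0r subr0 (eq_map_poly (g := g \o evr h t)) => [|p /=].
  by rewrite map_poly_comp horner_map; have [_ _ -> _] := gr; rewrite rmorph0 eqxx.
rewrite -[LHS]/(ev _ _ _) ev_muni muni_mwiden map_polyC hornerC snoc_widen.
exact: ev_comp.
Qed.

Lemma ev_map_mpoly (K k E : fieldType) (κ : {rmorphism K -> k}) (i : {rmorphism k -> E}) n
    (a : 'I_n -> E) p : ev i a (map_mpoly κ p) = ev (i \o κ) a p.
Proof.
apply: (@mpoly_rmorph_ext K E n (evr i a \o map_mpoly κ) (evr (i \o κ) a)) => [c|j].
  by rewrite -[RHS]/(ev _ _ _) evC /= map_mpolyC; apply: evC.
by rewrite -[RHS]/(ev _ _ _) evX /= map_mpolyX; apply: evX.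
Qed.

(** * Regularity of function fields *)

Section FunctionField.
Variables (K E : fieldType) (h : {rmorphism K -> E}) (d : nat) (t : 'I_d -> E) (s : E).
Variables (m : nat) (f : {poly {mpoly K[d]}}).
Hypothesis it : alg_independent h t.
Hypothesis gr : generic_root h t s m f.

Lemma generic_root_alg : algOn h t s.
Proof.
have [mf sf f0 _] := gr; apply/algOnP; exists f; split; last exact/rootP.
by rewrite monic_neq0 // monic_map.
Qed.

Lemma gen_reduced p : exists v : {poly {mpoly K[d]}}, (size v <= m)%N /\
  ev2 h t s v = ev h (snoc t s) p.
Proof.
have [mf sf f0 _] := gr; have [r [sr Hr]] := ev2_mod (muni p) mf sf f0.
by exists r; rewrite Hr ev_muni snoc_widen snoc_max.
Qed.

(* [x] is an eigenvalue of its multiplication matrix.                        *)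
Lemma degree_bound x q : gen h (snoc t s) x -> irreducible_poly q -> root (map_poly h q) x ->
  (size q <= m.+1)%N.
Proof.
move=> xs irr qx; have [mf sf f0 _] := gr.
have [D [p [nD Hp]]] := gen_snoc_repr generic_root_alg xs.
have /choice[r Hr] : forall i : 'I_m, exists r : {poly {mpoly K[d]}},
    (size r <= m)%N /\ ev2 h t s r = ev2 h t s p * s ^+ i.
  move=> i; have [r [sr Hr]] := ev2_mod (p * 'X^i) mf sf f0.
  by exists r; rewrite Hr rmorphM /= map_polyXn hornerM hornerXn.
pose M : 'M[{mpoly K[d]}]_m := \matrix_(j, i) (r i)`_j.
set y := ev2 h t s p in Hp Hr.
have nm : (0 < m)%N.
  rewrite lt0n; apply/eqP => m0; have f1 : f = 1.
    have /size1_polyC -> : (size f <= 1)%N by rewrite sf m0.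
    by have := monicP mf; rewrite lead_coefE sf m0 /= => ->.
  by move: f0; rewrite f1 rmorph1 hornerC => /eqP; rewrite oner_eq0.
have Vy : root (char_poly (map_mx (evr h t) M)) y.
  rewrite -eigenvalue_root_char; apply/eigenvalueP; exists (\row_j s ^+ j).
    apply/rowP => i; rewrite !mxE -(Hr i).2 (horner_coef_wide _ (leq_trans (size_poly _ _) (Hr i).1)).
    by apply: eq_bigr => j _; rewrite !mxE coef_map mulrC.
  apply/eqP => /rowP/(_ (Ordinal nm)); rewrite !mxE expr0 => /eqP; by rewrite oner_eq0.
rewrite -map_char_poly in Vy; set V := char_poly M in Vy.
have sV : size V = m.+1 by rewrite size_char_poly.
have mV : V \is monic by rewrite char_poly_monic.
pose W i := V`_i * D ^+ i.
(* With [y = D(t) x] a root of the characteristic polynomial [V], the sum of the [V_i(t) D(t)^i x^i]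
   vanishes. As x is algebraic over K and t stays independent over such elements, this holds
   coefficientwise in t. A monomial [u] of the leading coefficient [D^m] then gives an equation of x
   over K of degree m. *)
pose p' : {mpoly E[d]} := \sum_(i < m.+1) x ^+ i *: map_mpoly h (W i).
have p'u u : p'@_u = \sum_(i < m.+1) x ^+ i * h (W i)@_u.
  rewrite (raddf_sum (mcoeff u)) /=; apply: eq_bigr => i _.
  by rewrite mcoeffZ mcoeff_map_mpoly.
have p'0 : p' = 0.
  apply: (indep_algebraic it) => [u|].
    rewrite p'u; apply: algebraic_sum => i; apply: algebraic_mul; last exact: algebraic_id.
    by apply: algebraic_exp; exists q; rewrite ?irredp_neq0.
  rewrite -[RHS](rootP Vy) (horner_coef_wide _ (leq_trans (size_poly _ _) (eq_leq sV))).
  rewrite (rmorph_sum (meval t)) /=; apply: eq_bigr => i _.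
  rewrite mevalZ coef_poly sV ltn_ord -Hp exprMn /W -[X in x ^+ i * X]/(evr h t _).
  by rewrite rmorphM rmorphXn /= mulrC mulrA.
have nW : W m != 0.
  rewrite /W; have -> : V`_m = 1 by rewrite -(monicP mV) lead_coefE sV.
  by rewrite mul1r expf_neq0 //; apply: contraNneq nD => ->; rewrite ev0.
have [u nWu] : exists u, (W m)@_u != 0.
  apply: contrapT => no; move/eqP: nW; apply; apply/mpolyP => u; rewrite mcoeff0.
  by apply/eqP; apply: contraT => nu; case: no; exists u.
rewrite leqNgt; apply/negP => qm; pose w := \poly_(i < m.+1) (W i)@_u.
have : w = 0.
  apply: (min_of_irreducible irr qx); last exact: leq_ltn_trans (size_poly _ _) qm.
  have := congr1 (mcoeff u) p'0; rewrite mcoeff0 p'u => H0; apply/rootP; rewrite -[RHS]H0.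
  rewrite (horner_coef_wide _ (leq_trans (size_poly _ _) (size_poly _ _))).
  by apply: eq_bigr => i _; rewrite coef_map coef_poly ltn_ord mulrC.
move/(congr1 (fun p : {poly K} => p`_m)); rewrite coef_poly ltnSn coef0 => /eqP.
by rewrite (negPf nWu).
Qed.

Let L := sftype (gen h (snoc t s)).
Variable κL : {rmorphism K -> L}.
Hypothesis HκL : forall c, sfval _ (κL c) = h c.

(** A polynomial over K(t,s) of degree less than that of P and vanishing at θ can be reordered into
    a polynomial in s over K(θ)[t] of degree less than m. By Gauss's lemma f would factor over
    K(θ)[t], hence modulo P. *)
Lemma irreducible_gen P b : infinite K -> P \is monic -> irreducible_poly P ->
  (forall j, (msize f`_j <= b)%N) -> ~ red_mod P f m (red_bound b m (size P)) ->
  irreducible_poly (map_poly κL P).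
Proof.
move=> infK mP irrP fb nred; have [mf sf f0 _] := gr.
have [E2 [g [θ Pθ]]] : exists (E2 : fieldType) (g : {rmorphism E -> E2}) y,
    root (map_poly g (map_poly h P)) y.
  by apply: root_extension; rewrite size_map_poly gtn_eqF // irrP.1.
rewrite -map_poly_comp in Pθ.
apply: (@irreducible_of_min L E2 (g \o sfval _) _ θ) => [||u uθ su].
- by rewrite size_map_poly irrP.1.
- by rewrite -map_poly_comp (eq_map_poly (g := g \o h)) // => c /=; rewrite HκL.
apply: contrapT => /eqP nz_u; apply: nred.
have algθ : algebraicOver (g \o h) θ by exists P; rewrite ?irredp_neq0.
pose k := sftype (simple_ext algθ); pose i : {rmorphism k -> E2} := sfval _.
have [κ Hκ] : exists κ : {rmorphism K -> k}, forall c, i (κ c) = (g \o h) c.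
  by apply: rmorph_lift => c; apply/sfvalP; exists c%:P; rewrite map_polyC hornerC.
have [θk Hθk] : exists y, i y = θ by apply/sfvalP; exists 'X; rewrite map_polyX hornerX.
have Pθk : root (map_poly κ P) θk.
  apply/rootP/(fmorph_inj i); rewrite rmorph0 -horner_map Hθk -map_poly_comp.
  by rewrite (eq_map_poly (g := g \o h)) //; apply/rootP.
have Hk c : exists q, c = (map_poly κ q).[θk].
  have /sfvalP[q Hq] : exists y, sfval (simple_ext algθ) y = i c by exists c.
  exists q; apply: (fmorph_inj i); rewrite Hq -horner_map Hθk -map_poly_comp.
  by congr (_.[_]); apply: eq_map_poly => a; rewrite /= Hκ.
have [D [U [nD HU]]] := gen_denominators u.
have /choice[V HV] := fun j => gen_reduced U`_j.
pose N := (size P).-1; have DN : size P = N.+1 by rewrite (ltn_predK irrP.1).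
(* The roles of θ and s are exchanged: [(V j)_n] multiplies both [θ^j] and [s^n]. *)
pose W n := \poly_(j < N) (V j)`_n : {poly {mpoly K[d]}}.
pose w := \poly_(n < m) spec_last κ θk d (mback (W n)).
have uN : (size u <= N)%N by rewrite -ltnS -DN -(size_map_poly κL).
have Uj j : ev h (snoc t s) U`_j = ev h (snoc t s) D * sfval _ u`_j.
  have := congr1 (fun p : {poly E} => p`_j) HU; rewrite coefZ !coef_map //.
have w0 : ev2 i (g \o t) (g s) w = 0.
  rewrite (horner_coef_wide _ (leq_trans (size_poly _ _) (size_poly _ _))).
  transitivity (\sum_(n < m) \sum_(j < N) g (ev h t (V j)`_n) * θ ^+ j * g s ^+ n).
    apply: eq_bigr => n _; rewrite coef_map coef_poly ltn_ord /= -[X in X * _]/(ev _ _ _).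
    rewrite ev_spec_last Hθk (ev_ext _ _ (h' := g \o h)) // ev_muni mbackK snoc_widen snoc_max.
    rewrite (horner_coef_wide _ (leq_trans (size_poly _ _) (size_poly _ _))) mulr_suml.
    apply: eq_bigr => j _; rewrite coef_map coef_poly ltn_ord /= -[X in X * _ * _]/(ev _ _ _).
    by rewrite ev_comp.
  rewrite exchange_big /=; transitivity (g (ev h (snoc t s) D) * (map_poly (g \o sfval _) u).[θ]).
    rewrite (horner_coef_wide _ (leq_trans (size_poly _ _) uN)) mulr_sumr; apply: eq_bigr => j _.
    rewrite coef_map mulrA -rmorphM -Uj -(HV j).2.
    rewrite (horner_coef_wide _ (leq_trans (size_poly _ _) (HV j).1)) rmorph_sum mulr_suml.
    apply: eq_bigr => n _; rewrite coef_map rmorphM rmorphXn /= -!mulrA; congr (_ * _).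
    exact: mulrC.
  by rewrite (rootP uθ) mulr0.
(* The powers of θ below the degree of P are independent over K, so a nonzero coefficient of some
   [V j] survives in w. *)
have nz_w : w != 0.
  have nlu : lead_coef u != 0 by rewrite lead_coef_eq0.
  rewrite lead_coefE in nlu; set j := (size u).-1 in nlu.
  have jN : (j < N)%N by apply: leq_trans uN; rewrite prednK // size_poly_gt0.
  have nVj : V j != 0.
    apply: contraNneq nlu => V0; have := (HV j).2; rewrite V0 rmorph0 horner0 Uj => /esym/eqP.
    by rewrite mulf_eq0 (negPf nD) fmorph_eq0.
  rewrite -lead_coef_eq0 lead_coefE in nVj; set n := (size (V j)).-1 in nVj.
  have nm : (n < m)%N.
    apply: leq_trans (HV j).1; rewrite prednK // size_poly_gt0.
    by apply: contraNneq nVj => ->; rewrite coef0.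
  apply: contraNneq nVj => w_0; apply/eqP/mpolyP => v; rewrite mcoeff0.
  have := congr1 (fun p : {poly {mpoly k[d]}} => p`_n@_v) w_0.
  rewrite coef_poly nm coef0 mcoeff0 spec_coef => /rootP r0.
  have : map_poly (mcoeff v) (W n) = 0.
    apply: (min_of_irreducible irrP Pθk r0); rewrite DN ltnS.
    exact: leq_trans (size_poly _ _) (size_poly _ _).
  by move/(congr1 (fun p : {poly K} => p`_j)); rewrite coef_slice coef_poly jN coef0.
have infk : infinite k := infinite_extension κ infK.
have itk : alg_independent i (g \o t).
  move=> p p0; have : map_mpoly i p = 0.
    apply: (indep_algebraic (h := g \o h) (t := g \o t)) => // [q|v].
      rewrite ev_comp => /eqP; rewrite fmorph_eq0 => /eqP; exact: it.
    rewrite mcoeff_map_mpoly; suff : algebraicOver (g \o h) (i p@_v) by [].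
    have [q Hq] := Hk p@_v; have -> : i p@_v = (map_poly i (map_poly κ q)).[θ] by rewrite Hq -Hθk horner_map.
    rewrite -map_poly_comp.
    by apply: algebraic_horner => // l; rewrite coef_map /= Hκ; apply: algebraic_id.
  move=> p'0; apply/mpolyP => v; apply: (fmorph_inj i); rewrite mcoeff0 rmorph0.
  by rewrite -mcoeff_map_mpoly p'0 mcoeff0.
have [|||g1 [g2 [mg1 mg2 Dg s1 s2]]] := gauss_factor (f := map_poly (map_mpoly κ) f) infk itk _ nz_w _ _ w0.
- by rewrite monic_map.
- by rewrite size_map_monic // sf ltnS size_poly.
- rewrite -map_poly_comp (eq_map_poly (g := g \o evr h t)) => [|p].
    by rewrite map_poly_comp horner_map f0; apply: rmorph0.
  rewrite -[RHS]/(g (ev h t p)) -ev_comp -[LHS]/(ev i _ (map_mpoly κ p)) ev_map_mpoly.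
  exact: ev_ext.
exact: (red_mod_factor mP irrP Pθk Hk mf sf fb Dg mg1 mg2 s1 s2).
Qed.

(* An element of [K(t, s)] of degree [j] over [K] has [2 <= j <= m] unless it *)
(* is in [K].                                                                *)
Theorem function_field_regular (P : nat -> {poly K}) b : perfect_field K -> infinite K ->
  (forall j, (1 < j <= m)%N -> [/\ P j \is monic, irreducible_poly (P j),
     ~ red_mod (P j) f m (red_bound b m (size (P j))) &
     forall q, irreducible_poly q -> separable_poly q -> size q = j.+1 ->
       exists r Q, q \Po r = P j * Q]) ->
  (forall j, (msize f`_j <= b)%N) -> regular_extension κL.
Proof.
move=> perfK infK HP fb; apply: regular_of_closed => // x algx.
have [q [mq irrq qx Hq]] := minimal_polynomial algx.
have sepq : separable_poly q.
  have [r [sepr rx]] := perfect_separable_root perfK algx.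
  by apply: dvdp_separable (Hq _ rx) sepr.
have qx' : root (map_poly h q) (sfval _ x).
  apply/rootP; rewrite -(eq_map_poly HκL) map_poly_comp horner_map (rootP qx).
  exact: rmorph0.
have sq : (size q <= m.+1)%N.
  by apply: degree_bound irrq qx'; apply/sfvalP; exists x.
have s1 := irrq.1; have [q2|q2] := leqP (size q) 2.
  have sq2 : size q = 2 by apply/eqP; rewrite eqn_leq q2.
  have q1 : q`_1 = 1 by have := monicP mq; rewrite lead_coefE sq2.
  exists (- q`_0); move: (rootP qx); rewrite horner_coef size_map_poly sq2 !big_ord_recl big_ord0.
  rewrite !coef_map /= q1 rmorph1 mul1r mulr1 addr0 => /eqP.
  by rewrite addrC addr_eq0 rmorphN => /eqP.
pose j := (size q).-1; have sj : size q = j.+1 by rewrite (ltn_predK s1).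
have [|mP irrP nred W] := HP j.
  by rewrite -ltnS -sj q2 -ltnS -sj.
have [r [Q Dr]] := W _ irrq sepq sj.
exact: closed_of_root (irreducible_gen infK mP irrP fb nred) irrq Dr qx.
Qed.

End FunctionField.

(** * Parametrized polynomials *)

(** A single sequence of parameters encodes countably many sequences through a pairing of indices;
    [glue] assembles them. *)
Definition slot (K : Type) (k : nat) (e : nat -> K) : nat -> K := fun j => e (pickle (k, j)).

Definition glue (K : Type) (E : nat -> nat -> K) : nat -> K :=
  fun x => if @unpickle (nat * nat)%type x is Some (k, j) then E k j else E 0%N 0%N.

Lemma slot_glue (K : Type) (E : nat -> nat -> K) k : slot k (glue E) = E k.
Proof. by apply/funext => j; rewrite /slot /glue pickleK. Qed.

(** The general polynomial of size at most [B], whose coefficients are parameters; quantifying over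
    [e] is quantifying over such polynomials. *)
Definition gmp (K : fieldType) d B (e : nat -> K) : {mpoly K[d]} :=
  \sum_(u : 'X_{1..d < B}) e (pickle u) *: 'X_[u].

Definition gp (K : fieldType) d B N (e : nat -> K) : {poly {mpoly K[d]}} :=
  \poly_(k < N) gmp d B (slot k e).

Section Parametrized.
Variables (K : fieldType) (d B : nat).

Lemma gmp_coef e (u : 'X_{1..d < B}) : (gmp d B e : {mpoly K[d]})@_u = e (pickle u).
Proof.
rewrite (raddf_sum (mcoeff u)) /= (bigD1 u) //= mcoeffZ mcoeffX eqxx mulr1 big1 ?addr0 // => v vu.
by rewrite mcoeffZ mcoeffX (inj_eq val_inj) (negPf vu) mulr0.
Qed.

Lemma gmp_bound e : (msize (gmp d B e : {mpoly K[d]}) <= B)%N.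
Proof.
apply: msize_sum_bound => u; apply: leq_trans (msizeZ_le _ _) _.
by rewrite msizeX; apply: bmdeg.
Qed.

Lemma gmp_onto (p : {mpoly K[d]}) : (msize p <= B)%N -> exists e, gmp d B e = p.
Proof.
move=> pB; exists (fun k => if @unpickle 'X_{1..d < B} k is Some u then p@_u else 0).
by rewrite [RHS](mpolywE pB); apply: eq_bigr => u _; rewrite pickleK.
Qed.

Lemma gp_size N e : (size (gp d B N e : {poly {mpoly K[d]}}) <= N)%N.
Proof. exact: size_poly. Qed.

Lemma gp_bound N e j : (msize (gp d B N e : {poly {mpoly K[d]}})`_j <= B)%N.
Proof. by rewrite coef_poly; case: ifP => _; [apply: gmp_bound | rewrite msize0]. Qed.

Lemma gp_onto N (p : {poly {mpoly K[d]}}) : (size p <= N)%N -> (forall j, (msize p`_j <= B)%N) ->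
  exists e, gp d B N e = p.
Proof.
move=> pN pB; have /choice[E HE] : forall j, exists e, gmp d B e = p`_j by move=> j; apply: gmp_onto.
exists (glue E); apply/polyP => j; rewrite coef_poly slot_glue HE; case: ltnP => // jN.
by rewrite nth_default // (leq_trans pN).
Qed.

Lemma gmp_ev e (x : 'I_d -> K) :
  (gmp d B e).@[x] = \sum_(u : 'X_{1..d < B}) e (pickle u) * \prod_i x i ^+ (u : 'X_{1..d}) i.
Proof. by rewrite rmorph_sum; apply: eq_bigr => u _; rewrite /= mevalZ mevalX. Qed.

End Parametrized.

Lemma gmp_map (K F : fieldType) (h : {rmorphism K -> F}) d B e :
  map_mpoly h (gmp d B e) = gmp d B (h \o e).
Proof.
by rewrite rmorph_sum; apply: eq_bigr => u _; rewrite /= map_mpolyZ map_mpolyX.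
Qed.

Lemma gp_map (K F : fieldType) (h : {rmorphism K -> F}) d B N e :
  map_poly (map_mpoly h) (gp d B N e) = gp d B N (h \o e).
Proof.
apply/polyP => j; rewrite coef_map !coef_poly; case: ifP => _; last exact: raddf0.
exact: gmp_map.
Qed.

Lemma tdefinable_ext (g1 g2 : forall K : fieldType, (nat -> K) -> K) :
  (forall K v, g1 K v = g2 K v) -> tdefinable g1 -> tdefinable g2.
Proof. by move=> Hg [t Ht]; exists t => K c v; rewrite Ht Hg. Qed.

Lemma tdefinable_gmp d B (a : nat -> forall K : fieldType, (nat -> K) -> K)
    (b : 'I_d -> forall K : fieldType, (nat -> K) -> K) :
  (forall k, tdefinable (a k)) -> (forall i, tdefinable (b i)) ->
  tdefinable (fun K v => (gmp d B (fun k => a k K v)).@[fun i => b i K v]).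
Proof.
move=> Ha Hb; apply: (tdefinable_ext (g1 := fun K v =>
    \sum_(u : 'X_{1..d < B}) a (pickle u) K v * \prod_i b i K v ^+ (u : 'X_{1..d}) i)).
  by move=> K v; rewrite gmp_ev.
apply: tdefinable_sum => u; apply: tdefinableM => //; apply: tdefinable_prod => i.
exact: tdefinableX.
Qed.

Lemma tdefinable_gp d B N (a : nat -> forall K : fieldType, (nat -> K) -> K)
    (b : 'I_d -> forall K : fieldType, (nat -> K) -> K) s :
  (forall k, tdefinable (a k)) -> (forall i, tdefinable (b i)) -> tdefinable s ->
  tdefinable (fun K v => (map_poly (meval (fun i => b i K v)) (gp d B N (fun k => a k K v))).[s K v]).
Proof.
move=> Ha Hb Hs; apply: (tdefinable_ext (g1 := fun K v => \sum_(k < N)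
    (gmp d B (fun j => a (pickle (k : nat, j)) K v)).@[fun i => b i K v] * s K v ^+ k)).
  move=> K v; rewrite (horner_coef_wide _ (leq_trans (size_poly _ _) (gp_size _ _ _ _))).
  by apply: eq_bigr => k _; rewrite coef_map coef_poly ltn_ord.
apply: tdefinable_sum => k; apply: tdefinableM; last exact: tdefinableX.
exact: tdefinable_gmp.
Qed.

(** * Generic points *)

Definition dense (K : fieldType) n (X : ('I_n -> K) -> Prop) :=
  forall p : {mpoly K[n]}, vanishing X p -> p = 0.

Lemma dense_point (K : fieldType) n (X : ('I_n -> K) -> Prop) p :
  dense X -> p != 0 -> exists2 a, X a & p.@[a] != 0.
Proof.
move=> dX nz; apply: contrapT => no; move/eqP: nz; apply; apply: dX => a Xa.
by apply/eqP; apply: contraT => na; case: no; exists a.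
Qed.

Lemma gen_infinite (K : fieldType) n : infinite K -> dense (fun _ : 'I_n -> K => True).
Proof.
move=> infK p Hp; apply/eqP; apply: contraT => nz.
by have [a] := mpoly_infinite_neq infK nz; rewrite Hp // eqxx.
Qed.

Lemma mpoly_term d (K : fieldType) (p : {mpoly K[d]}) : exists (t : term void) (e : nat -> K),
  forall (N : fieldType) (h : {rmorphism K -> N}) (c : void -> N) (x : 'I_d -> N),
    teval c (fcat x (h \o e)) t = ev h x p.
Proof.
have [e He] := gmp_onto (leqnn (msize p)).
have [t Ht] := tdefinable_gmp (d := d) (msize p) (fun k => tdefinable_var (d + k))
  (fun i : 'I_d => tdefinable_var i).
exists t, e => N h c x; rewrite Ht -[in RHS]He gmp_map.
have -> : (fun k => fcat x (h \o e) (d + k)%N) = h \o e by apply/funext => k; rewrite fcat_ge.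
by have -> : (fun i : 'I_d => fcat x (h \o e) i) = x by apply/funext => i; rewrite fcat_lt.
Qed.

(** By compactness, one has to satisfy [φ] while avoiding the zeros of finitely many nonzero
    polynomials over K, that is, of their product; density in the given model [S0] provides such a
    point. *)
Lemma generic_point (R : signature) (T : theory R) (K : fieldType) (SK : struct R void K)
    (N0 : fieldType) (S0 : struct R void N0) (h0 : {rmorphism K -> N0}) d φ (e : nat -> K) :
  models S0 T -> extension SK S0 h0 ->
  dense (fun x : 'I_d -> N0 => sat S0 (fcat x (h0 \o e)) φ) ->
  exists (N : fieldType) (SN : struct R void N) (h : {rmorphism K -> N}) (t : 'I_d -> N),
    [/\ models SN T, extension SK SN h, alg_independent h t & sat SN (fcat t (h \o e)) φ].
Proof.
move=> m0 ext0 dX; pose A := (K + 'I_d)%type; pose i : K -> A := inl.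
have /choice[τ Hτ] : forall p : {mpoly K[d]}, exists te : term void * (nat -> K),
    forall (N : fieldType) (h : {rmorphism K -> N}) (c : void -> N) (x : 'I_d -> N),
    teval c (fcat x (h \o te.2)) te.1 = ev h x p.
  by move=> p; have [t [e' H]] := mpoly_term p; exists (t, e').
pose G (f : formula R void) (v : nat -> A) :=
  [\/ exists s : sentence R, T s /\ f = sval s, diagram SK i f v,
      f = φ /\ v = fcat inr (i \o e) |
      exists p, [/\ p != 0, f = fnot (feq R (τ p).1 (tzero _)) & v = fcat inr (i \o (τ p).2)]].
pose hx (N : fieldType) (h : K -> N) (x : 'I_d -> N) (a : A) := match a with inl c => h c | inr j => x j end.
have hxE (N : fieldType) (h : K -> N) x v : hx N h x \o fcat inr (i \o v) = fcat x (h \o v).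
  by rewrite fcat_comp.
have [s Hs|N [SN [H HG]]] := @compactness R void A G.
  suff [p [nz Hp]] : exists p : {mpoly K[d]}, p != 0 /\ forall y, sat S0 (fcat y (h0 \o e)) φ ->
      ev h0 y p != 0 -> forall x, List.In x s -> sat S0 (hx _ h0 y \o x.2) x.1.
    have nzp : map_mpoly h0 p != 0.
      apply: contraNneq nz => p0; apply/eqP/mpolyP => u; apply: (fmorph_inj h0).
      by rewrite -mcoeff_map_mpoly p0 !mcoeff0 rmorph0.
    have [y Xy py] := dense_point dX nzp.
    by exists N0, S0, (hx _ h0 y); apply: Hp.
  elim: s Hs => [|[f v] s IH] Hs; first by exists 1; rewrite oner_neq0.
  have [p [nz Hp]] := IH (fun x xs => Hs x (or_intror xs)).
  have ok y : sat S0 (hx _ h0 y \o v) f -> (forall x, List.In x s -> sat S0 (hx _ h0 y \o x.2) x.1) ->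
     forall x, List.In x ((f, v) :: s) -> sat S0 (hx _ h0 y \o x.2) x.1.
    by move=> H1 H2 x [<- //|]; apply: H2.
  case: (Hs _ (or_introl erefl)) => /= [[σ [Tσ ->]]|[v' [-> qff Hf]]|[-> ->]|[p' [nz' -> ->]]].
  - exists p; split=> // y Xy py x [<- /=|]; [exact: m0|exact: Hp].
  - exists p; split=> // y Xy py x [<- /=|]; [|exact: Hp].
    by have /(extension_sat v' ext0) := qff; move=> /iffLR/(_ Hf).
  - exists p; split=> // y Xy py x [<- /=|]; [by rewrite hxE|exact: Hp].
  - exists (p' * p); split; first by rewrite mulf_neq0.
    move=> y Xy; rewrite evM mulf_eq0 negb_or => /andP[p'y py] x [<- /=|]; [|exact: Hp].
    by rewrite hxE Hτ; apply/eqP.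
have [h [hE ext]] := diagram_embed (fun f v D => HG f v (Or42 _ _ _ D)).
pose t j := H (inr j).
have HE v : H \o fcat inr (i \o v) = fcat t (h \o v).
  by rewrite fcat_comp; congr fcat; apply/funext => x /=; rewrite hE.
exists N, SN, h, t; split=> //.
- move=> σ Tσ v; have := HG (sval σ) (fun=> inl 0) (Or41 _ _ _ (ex_intro _ σ (conj Tσ erefl))).
  by apply: (proj1 (sat_free _ _)) => x fx; case: (proj2_sig σ x fx).
- move=> p p0; apply/eqP; apply: contraT => nz.
  have := HG _ _ (Or44 _ _ _ (ex_intro _ p (And3 nz erefl erefl))).
  by rewrite HE /= Hτ.
- by have := HG _ _ (Or43 _ _ _ (conj erefl erefl)); rewrite HE.
Qed.

(** The image of x is determined by any equation [q x = p] with q nonzero; since the kernels agree,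
    it does not depend on the equation. *)
Lemma fraction_morphism (A : comNzRingType) (L E E' : fieldType) (i : {rmorphism L -> E})
    (σ : {rmorphism A -> E}) (σ' : {rmorphism A -> E'}) :
  (forall p, σ p = 0 <-> σ' p = 0) ->
  (forall x, exists p q, σ q != 0 /\ i x = σ p / σ q) ->
  exists ψ : {rmorphism L -> E'}, forall x p q, σ q != 0 ->
    σ q * i x = σ p -> σ' q * ψ x = σ' p.
Proof.
move=> Hi repr0.
have nz q : (σ q != 0) = (σ' q != 0).
  by apply/idP/idP; apply: contra => /eqP q0; apply/eqP/Hi.
have /choice[ψ Hψ] : forall x : L, exists y, forall p q, σ q != 0 ->
    σ q * i x = σ p -> σ' q * y = σ' p.
  move=> x; have [p0 [q0 [nq0 Dx]]] := repr0 x.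
  have nq0' : σ' q0 != 0 by rewrite -nz.
  exists (σ' p0 / σ' q0) => p q nq; rewrite Dx => Hpq.
  have : σ' (q * p0 - p * q0) = 0.
    apply/Hi; rewrite rmorphB !rmorphM -Hpq; apply/eqP; rewrite subr_eq0; apply/eqP.
    by rewrite -mulrA divfK.
  rewrite rmorphB !rmorphM => /eqP; rewrite subr_eq0 => /eqP H.
  by apply: (mulIf nq0'); rewrite -mulrA divfK.
have repr (x : L) : exists p q, σ q != 0 /\ σ q * i x = σ p.
  by have [p [q [nq Dx]]] := repr0 x; exists p, q; rewrite nq Dx mulrC divfK.
have char (x : L) y p q : σ q != 0 -> σ q * i x = σ p -> σ' q * y = σ' p -> ψ x = y.
  move=> nq Hx Hy; have nq' : σ' q != 0 by rewrite -nz.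
  by apply: (mulfI nq'); rewrite (Hψ _ _ _ nq Hx).
have ψB : zmod_morphism ψ.
  move=> x y; have [p [q [nq Hx]]] := repr x; have [p1 [q1 [nq1 Hy]]] := repr y.
  apply: (char _ _ (q1 * p - q * p1) (q * q1)); first by rewrite rmorphM mulf_neq0.
    rewrite !rmorphB !rmorphM -Hx -Hy.
    by move: (σ q) (σ q1) (i x) (i y) => u v w z; ring.
  rewrite rmorphB !rmorphM -(Hψ _ _ _ nq Hx) -(Hψ _ _ _ nq1 Hy).
  by move: (σ' q) (σ' q1) (ψ x) (ψ y) => u v w z; ring.
have ψM : monoid_morphism ψ.
  split=> [|x y].
    by apply: (char _ _ 1 1); rewrite ?rmorph1 ?oner_neq0 ?mulr1.
  have [p [q [nq Hx]]] := repr x; have [p1 [q1 [nq1 Hy]]] := repr y.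
  apply: (char _ _ (p * p1) (q * q1)); first by rewrite rmorphM mulf_neq0.
    rewrite !rmorphM -Hx -Hy.
    by move: (σ q) (σ q1) (i x) (i y) => u v w z; ring.
  rewrite !rmorphM -(Hψ _ _ _ nq Hx) -(Hψ _ _ _ nq1 Hy).
  by move: (σ' q) (σ' q1) (ψ x) (ψ y) => u v w z; ring.
pose ka := GRing.isZmodMorphism.Build L E' ψ ψB.
pose km := GRing.isMonoidMorphism.Build L E' ψ ψM.
by exists (HB.pack_for {rmorphism L -> E'} ψ ka km).
Qed.

Lemma gen_iso (K E E' : fieldType) (h : {rmorphism K -> E}) (h' : {rmorphism K -> E'}) n
    (a : 'I_n -> E) (a' : 'I_n -> E') :
  (forall p, ev h a p = 0 <-> ev h' a' p = 0) ->
  exists ψ : {rmorphism sftype (gen h a) -> E'}, forall x p q, ev h a q != 0 ->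
    ev h a q * sfval _ x = ev h a p -> ev h' a' q * ψ x = ev h' a' p.
Proof.
move=> Hi; apply: (fraction_morphism (σ := evr h a) (σ' := evr h' a') Hi) => x.
have /sfvalP[p [q [nq Dx]]] : exists y, sfval (gen h a) y = sfval _ x by exists x.
by exists p, q.
Qed.

Lemma generic_tuple (K : fieldType) d : exists (E : fieldType) (h : {rmorphism K -> E}) (t : 'I_d -> E),
  alg_independent h t.
Proof.
pose ι := frac {mpoly K[d]}; pose h : {rmorphism K -> Frac {mpoly K[d]}} := ι \o @mpolyC d K.
exists (Frac {mpoly K[d]}), h, (fun i => ι 'X_i) => p p0; apply: (@frac_inj {mpoly K[d]}).
rewrite rmorph0 -[RHS]p0; apply: (@mpoly_rmorph_ext K _ d ι (evr h (fun i => ι 'X_i))) => [c|i].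
  by rewrite -[RHS]/(ev _ _ _) evC.
by rewrite -[RHS]/(ev _ _ _) evX.
Qed.

Lemma indep_ext (K E F : fieldType) (h : {rmorphism K -> E}) (g : {rmorphism E -> F}) n (t : 'I_n -> E) :
  alg_independent h t -> alg_independent (g \o h) (g \o t).
Proof. by move=> it p; rewrite ev_comp => /eqP; rewrite fmorph_eq0 => /eqP; apply: it. Qed.

(* Purely transcendental extensions are regular.                             *)
Lemma gen_indep_regular (K E : fieldType) (h : {rmorphism K -> E}) d (t : 'I_d -> E)
    (κ : {rmorphism K -> sftype (gen h t)}) :
  alg_independent h t -> (forall c, sfval _ (κ c) = h c) -> regular_extension κ.
Proof.
move=> it Hκ E2 g n a ia c algc c0; set L := sftype (gen h t) in a κ Hκ g ia algc c0 *.
have /choice[t' Ht'] : forall i, exists y, sfval (gen h t) y = t i by move=> i; apply/sfvalP/gen_var.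
have sfE p : sfval _ (ev κ t' p) = ev h t p.
  rewrite -ev_comp (ev_ext _ _ (h' := h)) //.
  by congr (meval _ _); apply/funext.
have it' : alg_independent κ t' by move=> p p0; apply: it; rewrite -sfE p0 rmorph0.
have /choice[pq Hpq] : forall j, exists pq, ev κ t' pq.2 != 0 /\ ev κ t' pq.2 * a j = ev κ t' pq.1.
  move=> j; have /sfvalP[p [q [nq Dx]]] : exists y, sfval (gen h t) y = sfval _ (a j) by exists (a j).
  have nq' : ev κ t' q != 0 by rewrite -(fmorph_eq0 (sfval (gen h t))) sfE.
  exists (p, q); split=> //=; apply: (fmorph_inj (sfval (gen h t))).
  by rewrite rmorphM !sfE Dx mulrC divfK.
(* With a common denominator the [a j] become polynomials in t. Independence over K says that the
   matrix of their coefficients has independent rows, a property kept over any larger field. *)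
pose D := \prod_j (pq j).2; pose P j := (pq j).1 * \prod_(i | i != j) (pq i).2.
have nD : ev κ t' D != 0.
  rewrite -[ev _ _ _]/(evr κ t' D) rmorph_prod; apply/prodf_neq0 => j _; exact: (Hpq j).1.
have HP j : ev κ t' D * a j = ev κ t' (P j).
  by rewrite /D (bigD1 j) //= !evM -(Hpq j).2; apply: mulrAC.
pose B := \max_j msize (P j); have PB j : (msize (P j) <= B)%N by apply: (leq_bigmax j).
pose J : finType := 'X_{1..d < B}.
pose M := \matrix_(j < n, u < #|J|) (P j)@_(enum_val u : J).
have freeM : row_free M.
  apply: inj_row_free => b bM; apply/rowP => j; rewrite mxE.
  apply: (ia (fun i => b 0 i)); apply: (mulfI nD); rewrite mulr0 mulr_sumr.
  transitivity (ev κ t' (\sum_i b 0 i *: P i)).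
    rewrite -[RHS]/(evr κ t' _) (rmorph_sum (evr κ t')); apply: eq_bigr => i _.
    by rewrite mulrCA HP -[RHS]/(ev κ t' _) map_mpolyZ mevalZ.
  have -> : \sum_i b 0 i *: P i = 0; last exact: ev0.
  apply/mpolyP => u; rewrite mcoeff0 (raddf_sum (mcoeff u)) /=.
  have [uB|uB] := ltnP (mdeg u) B; last first.
    rewrite big1 // => i _; rewrite mcoeffZ memN_msupp_eq0 ?mulr0 //.
    by apply: contraL uB => /msize_mdeg_lt; rewrite -ltnNge => /leq_trans; apply.
  have := congr1 (fun A : 'rV_#|J| => A 0 (enum_rank (BMultinom uB))) bM; rewrite !mxE => H.
  by rewrite -[RHS]H; apply: eq_bigr => i _; rewrite mcoeffZ mxE enum_rankK.
pose Q := \sum_j c j *: map_mpoly (g \o κ) (P j).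
have Qu u : Q@_u = \sum_j c j * g (κ (P j)@_u).
  rewrite (raddf_sum (mcoeff u)) /=; apply: eq_bigr => j _.
  by rewrite mcoeffZ mcoeff_map_mpoly.
have Q0 : Q = 0.
  have it2 : alg_independent (g \o κ) (g \o t') := indep_ext it'.
  apply: (@indep_algebraic _ _ (g \o κ : {rmorphism K -> E2}) _ (g \o t')) it2 _ _ => [u|].
    by rewrite Qu; apply: algebraic_sum => j; apply: algebraic_mul => //; apply: algebraic_id.
  transitivity (g (ev κ t' D) * \sum_j c j * g (a j)); last by rewrite c0 mulr0.
  rewrite mulr_sumr (rmorph_sum (meval (g \o t'))); apply: eq_bigr => j _.
  by rewrite /= mevalZ [X in _ * X]ev_comp -HP rmorphM mulrCA.
have : row_free (map_mx (g \o κ) M) by rewrite row_free_map.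
move=> /row_free_inj; move/(_ 1%N (\row_j c j) 0) => H j.
have /rowP/(_ j) : \row_j c j = 0; last by rewrite !mxE.
apply: H; rewrite mul0mx; apply/rowP => u; rewrite !mxE.
have := Qu (enum_val u : J); rewrite Q0 mcoeff0 => H; rewrite [RHS]H.
by apply: eq_bigr => i _; rewrite !mxE.
Qed.

(** * Zariski density *)

Lemma box_dense (K : fieldType) n (U : 'I_n -> K -> Prop) :
  (forall j (s : seq K), exists2 x, U j x & x \notin s) -> dense (fun a : 'I_n -> K => forall j, U j (a j)).
Proof.
elim: n U => [|n IH] U HU p Hp.
  have pC : p = (p@_0)%:MP by rewrite mpolyKC.
  have p0 : p@_0 = 0 by rewrite -(Hp (fun=> 0)); [rewrite {2}pC mevalC | case].
  by rewrite pC p0 mpolyC0.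
apply/eqP; rewrite -muni_eq0; apply/eqP/polyP => j; rewrite coef0.
apply: (IH (U \o @widen1 n)) => [i s|a Ha]; first exact: HU.
suff : map_poly (meval a) (muni p) = 0.
  by move/(congr1 (fun q : {poly K} => q`_j)); rewrite coef0 coef_map.
set q := map_poly _ _; apply/eqP; apply: contraT => nq.
have q0 x : U ord_max x -> q.[x] = 0.
  move=> Ux; have <- : p.@[snoc a x] = q.[x].
    have evid m (b : 'I_m -> K) r : ev idfun b r = r.@[b].
      by congr (meval _ _); apply/mpolyP => u; rewrite mcoeff_map_mpoly.
    rewrite -evid ev_muni snoc_widen snoc_max; congr (_.[_]); apply: eq_map_poly => r.
    exact: evid.
  apply: Hp => i; rewrite /snoc; case: unliftP => [i' ->|-> //].
  by rewrite lift_widen1; apply: Ha.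
have [rs [Hrs urs Drs]] : exists rs : seq K, [/\ all (root q) rs, uniq rs & size rs = size q].
  elim: (size q) => [|N [rs [Hrs urs Drs]]]; first by exists [::].
  have [x Ux nx] := HU ord_max rs; exists (x :: rs) => /=.
  by rewrite Hrs nx urs Drs andbT; split=> //; apply/rootP/q0.
by have := max_poly_roots nq Hrs urs; rewrite Drs ltnn.
Qed.

Lemma open_ext (N : Type) (op : (N -> Prop) -> Prop) (U V : N -> Prop) :
  (forall x, U x <-> V x) -> op U -> op V.
Proof. by move=> UV; suff -> : V = U by []; apply/funext => x; apply/propext; split=> /UV. Qed.

(** A finite open set would, by the Hausdorff property, make one of its points open; translations
    would then make every point open and the topology discrete. *)
Lemma open_infinite (N : fieldType) (op : (N -> Prop) -> Prop) (U : N -> Prop) x (s : seq N) :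
  field_topology op -> nondiscrete op -> op U -> U x -> exists2 y, U y & y \notin s.
Proof.
move=> [[[opT opI opU] haus] opD _ _ _] ndisc oU Ux; apply: contrapT => no; apply: ndisc.
have Us y : U y -> y \in s by move=> Uy; apply: contraT => ny; case: no; exists y.
have o1 : op (fun y => y = x).
  have [V [oV Vx HV]] : exists V, [/\ op V, V x & forall y, y \in s -> V y -> y = x].
    elim: s {no Us} => [|z s [V [oV Vx HV]]]; first by exists (fun=> True).
    have [->|/eqP nzx] := eqVneq z x.
      by exists V; split=> // y; rewrite inE => /orP[/eqP -> //|]; apply: HV.
    have [W1 [W2 [o1 o2 W1z W2x W12]]] := haus _ _ nzx.
    exists (fun y => V y /\ W2 y); split=> //; first exact: opI.
    move=> y; rewrite inE => /orP[/eqP -> [_ W2z]|ys [Vy _]]; last exact: HV.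
    by case: (W12 z).
  apply: open_ext (opI _ _ oU oV) => y; split=> [[Uy Vy]|->] //.
  by apply: HV => //; apply: Us.
have oy y : op (fun z => z = y).
  have [|U' [V' [[oU' U'y] [_ V'x] UV]]] := opD y (x - y) (fun z => z = x).
    by split=> //; rewrite addrC subrK.
  apply: open_ext oU' => z; split=> [U'z|-> //].
  by apply: (addIr (x - y)); rewrite (UV _ _ U'z V'x) addrC subrK.
move=> V; pose A (W : N -> Prop) := exists2 y, V y & W = (fun z => z = y).
apply: (@open_ext _ _ (fun z => exists W, A W /\ W z)) => [z|]; last by apply: opU => W [y _ ->].
by split=> [[W [[y Vy ->] ->]] //|Vz]; exists (fun y => y = z); split=> //; exists z.
Qed.

Lemma indep_inj (K E : fieldType) (h : {rmorphism K -> E}) n m (a : 'I_n -> E) (s : 'I_m -> 'I_n) :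
  alg_independent h (fun i => a (s i)) -> injective s.
Proof.
move=> ind i j sij; apply/eqP; apply: contraT => nij.
have : ('X_i - 'X_j : {mpoly K[m]}) = 0 by apply: ind; rewrite evB !evX sij subrr.
move/(congr1 (mcoeff U_(i))); rewrite mcoeffB !mcoeffX eqxx mcoeff0 eq_mnm1.
by rewrite eq_sym (negPf nij) subr0 => /eqP; rewrite oner_eq0.
Qed.

(** When d coordinates chosen among d are independent, the choice is injective, hence a permutation,
    and the point is generic. Conversely a generic tuple is a zero of the zero ideal. *)
Lemma dim_full (K : fieldType) d (J : {mpoly K[d]} -> Prop) : dim_is J d <-> forall p, J p -> p = 0.
Proof.
split=> [[[F [h [a [s [az ia]]]]] _] p Xp|dX].
  have sI := indep_inj ia; pose s' := invF sI.
  pose ρ (r : 'I_d -> 'I_d) : {rmorphism {mpoly K[d]} -> {mpoly K[d]}} :=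
    evr (@mpolyC d K) (fun i => 'X_(r i)).
  have ρC r c : ρ r c%:MP = c%:MP by apply: evC.
  have ρX r i : ρ r 'X_i = 'X_(r i) by apply: evX.
  clearbody ρ.
  have ρK q : ρ s (ρ s' q) = q.
    apply: (@mpoly_rmorph_ext K _ d (ρ s \o ρ s') idfun) => [c|i] /=; first by rewrite !ρC.
    by rewrite !ρX /s' f_invF.
  have ρev q : ev h (fun i => a (s i)) (ρ s' q) = ev h a q.
    apply: (@mpoly_rmorph_ext K F d (evr h (fun i => a (s i)) \o ρ s') (evr h a)) => [c|i] /=.
      by rewrite ρC !evC.
    by rewrite ρX !evX /s' f_invF.
  rewrite -[p]ρK (ia (ρ s' p)) ?rmorph0 // ρev; exact: az.
have [F [h [t it]]] := generic_tuple K d.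
split; first by exists F, h, t, id; split=> // p /dX ->; rewrite ev0.
move=> [F' [h' [a [s [_ ia]]]]]; have := leq_card _ (indep_inj ia).
by rewrite !card_ord ltnn.
Qed.

Lemma dim_dense (K : fieldType) d (X : ('I_d -> K) -> Prop) : set_dim_is X d <-> dense X.
Proof. exact: dim_full. Qed.

(** The affine line has the smooth point 0; if the field were the finite list s, the product of the
    [X - c] would vanish at all its points. *)
Lemma large_infinite (N : fieldType) : large N -> infinite N.
Proof.
move=> lN s; apply: contrapT => no; pose J (p : {mpoly N[1]}) := p = 0.
have Js x : x \in s by apply: contraT => nx; case: no; exists x.
have primeJ : prime_ideal J.
  split=> [//|p q -> ->|p q ->||p q /eqP]; rewrite ?addr0 ?mulr0 //.
    by move/eqP; rewrite oner_eq0.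
  by rewrite mulf_eq0 => /orP[] /eqP; [left|right].
have smooth : exists a, smooth_at J a.
  exists (fun=> 0); split=> [p ->|]; first by rewrite meval0.
  exists 0%N, 1%N, (fun=> 0); split.
  - move=> p; split=> [->|[q ->]]; last by rewrite big_ord0.
    by exists (fun=> 0); rewrite big_ord0.
  - exact/dim_full.
  - by apply/eqP; rewrite addn1 eqSS -leqn0 rank_leq_row.
have nz : \prod_(c <- s) ('X_ord0 - c%:MP) != 0 :> {mpoly N[1]}.
  rewrite prodf_seq_neq0; apply/allP => c _; apply/implyP => _.
  apply: contra_neq (oner_neq0 N) => /(congr1 (mcoeff U_(ord0))).
  by rewrite mcoeffB mcoeffX eqxx mcoeffC mcoeff0 mnm1_eq0 mulr0 subr0.
move/eqP: nz; apply; apply: (lN _ _ primeJ smooth) => a _.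
by rewrite rmorph_prod /= (big_rem (a ord0)) //= mevalB mevalXU mevalC subrr mul0r.
Qed.

Section DensityDefinable.
Variables (R : signature) (T : theory R).
Variables (d : nat) (P : forall K : fieldType, struct R void K -> ('I_d -> K) -> (nat -> K) -> Prop).
Hypothesis QE : elim_quantifiers T.
Hypothesis dP : definable T (fun K S v => P S (fun i => v i) (fun k => v (d + k)%N)).

Lemma fibre_formula : exists φ, qf φ /\ forall (K : fieldType) (S : struct R void K), models S T ->
  forall x e, sat S (fcat x e) φ <-> P S x e.
Proof.
have [φ [qφ Hφ]] := definable_qf QE dP; exists φ; split=> // K S mS x e; rewrite Hφ //.
have -> : (fun k => fcat x e (d + k)%N) = e by apply/funext => k; rewrite fcat_ge.
by have -> : (fun i : 'I_d => fcat x e i) = x by apply/funext => i; rewrite fcat_lt.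
Qed.

(** A subset of the affine space of dimension d is dense exactly when its dimension is d, and (Z)
    defines this condition on the fibres of a family. *)
Lemma dense_definable_Z : cond_Z T -> definable T (fun K S e => dense (P S ^~ e)).
Proof.
move=> Z; have [φ [qφ Hφ]] := fibre_formula; have [B [HB _]] := sat_bound φ.
(* In [cond_Z] the base variables come before those of the fibre; here the d coordinates precede the
   parameters, so the two blocks are exchanged. *)
pose r x := if (x < d)%N then (B + x)%N else (x - d)%N.
have [g [qg Hg]] := Z B d (frename r φ) (qf_frename r qφ).
(* The variables beyond the parameters must take the value 0: they all read one quantified variable
   constrained to be 0. *)
pose ρ x := if (x < B)%N then x.*2 else 1%N.
apply: (@definable_ext _ _ (fun K S e => exists w : nat -> K, w 0%N = 0 /\ sat S (vmix e w \o ρ) g)).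
  move=> K S mS e; rewrite -dim_dense.
  have -> : (exists w : nat -> K, w 0%N = 0 /\ sat S (vmix e w \o ρ) g) <->
      sat S (fcat (fun i : 'I_B => e i) (fzero K)) g.
    have E0 w : w 0%N = 0 -> vmix e w \o ρ = fcat (fun i : 'I_B => e i) (fzero K).
      move=> w0; apply/funext => x; rewrite /= /ρ; case: ltnP => xB.
        by rewrite (fcat_lt _ _ (Ordinal xB)) -[LHS]/(vfst (vmix e w) x) vfst_mix.
      by rewrite -(subnKC xB) fcat_ge -[LHS]/(vsnd (vmix e w) 0%N) vsnd_mix.
    by split=> [[w [w0]]|H]; [rewrite E0|exists (fun=> 0); rewrite E0].
  rewrite Hg //; suff -> : (fun y : 'I_d -> K => sat S (fcat (fun i : 'I_B => e i) (fcat y (fzero K)))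
      (frename r φ)) = P S ^~ e by [].
  apply/funext => y; apply/propext; rewrite -Hφ // sat_frename; last by right.
  apply: HB => x xB /=; rewrite /r; case: ltnP => xd.
    by rewrite fcat_ge !(fcat_lt _ _ (Ordinal xd)).
  have xdB : (x - d < B)%N by apply: leq_ltn_trans xB; apply: leq_subr.
  by rewrite (fcat_lt _ _ (Ordinal xdB)) /= -{2}(subnKC xd) fcat_ge.
apply: definable_exv; apply: definable_and.
  by apply: definable_eq; [apply: tdefinable_var | apply: tdefinable0].
apply: (@definable_ext _ _ (fun K S u => sat S (u \o ρ) g)); first by move=> K S _ u; rewrite vmix_eta.
exact: (definable_rename ρ (definable_sat T g)).
Qed.

(** If the set is dense, its Zariski closure is the whole space and (H) gives it an interior, so it
    contains a box of basic open sets. Conversely non-empty open sets are infinite, and a box of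
    infinite sets is dense. In [w], each slot contains a point of the side, then the parameters of
    the basic open set. *)
Lemma dense_definable_H : cond_H T -> definable T (fun K S e => dense (P S ^~ e)).
Proof.
case=> f [qf_f Hf]; have [φ [qφ Hφ]] := fibre_formula.
pose bas (K : fieldType) (S : struct R void K) (e : nat -> K) x := sat S (fcat (fun _ : 'I_1 => x) e) f.
apply: (@definable_ext _ _ (fun K S e => exists w,
    (forall j : 'I_d, bas K S (fun k => slot j w k.+1) (slot j w 0%N)) /\
    forall b : nat -> K, (forall j : 'I_d, bas K S (fun k => slot j w k.+1) (b j)) -> P S (fun i => b i) e)).
  move=> K S mS e; have [op [basis [ftop ndisc _] _ Hint]] := Hf _ _ mS.
  split=> [[w [wa Hw]]|dX].
    pose U (j : 'I_d) := bas K S (fun k => slot j w k.+1).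
    have dU : dense (fun a : 'I_d -> K => forall j, U j (a j)).
      by apply: box_dense => j s; apply: open_infinite (basis.1 _) (wa j).
    move=> p Hp; apply: dU => a Ua; apply: Hp; have := Hw (fcat a (fun=> 0)).
    have -> : (fun i : 'I_d => fcat a (fun=> 0) i) = a by apply/funext => i; rewrite fcat_lt.
    by apply=> j; rewrite fcat_lt; apply: Ua.
  have [a Xa _] := dense_point dX (oner_neq0 _).
  have pX : pdefinable S (P S ^~ e) by exists φ, e; split=> // x; rewrite Hφ.
  have [b [U [_ Ub HU]]] := Hint _ _ pX (ex_intro _ a Xa).
  have /choice[E HE] : forall j, exists E, bas K S E (b j) /\ forall y, bas K S E y -> U j y.
    by move=> j; apply: basis.2; [exact: (Ub j).1|exact: (Ub j).2].
  pose w := glue (fun j k => if insub j is Some j' then if k is k'.+1 then E j' k' else b j' else 0).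
  have Ew (j : 'I_d) : (fun k => slot j w k.+1) = E j /\ slot j w 0%N = b j.
    by split; [apply/funext => k|]; rewrite slot_glue valK.
  exists w; split=> [j|c Hc]; first by rewrite (Ew j).1 (Ew j).2; apply: (HE j).1.
  apply: HU => [p /dX ->|j]; first by rewrite meval0.
  by apply: (HE j).2; have := Hc j; rewrite (Ew j).1.
apply: definable_exv; apply: definable_and.
  apply: definable_all_fin => j.
  pose r (x : nat) := (pickle (j : nat, x)).*2.+1.
  apply: (@definable_ext _ _ (fun K S u => sat S (u \o r) f)); last first.
    exact: (definable_rename r (definable_sat T f)).
  move=> K S _ u; rewrite /bas; suff -> : fcat (fun _ : 'I_1 => slot j (vsnd u) 0) (fun k => slot j (vsnd u) k.+1) = u \o r by [].
  apply/funext => -[|x]; first by rewrite (fcat_lt _ _ (ord0 : 'I_1)).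
  by rewrite -add1n fcat_ge.
apply: definable_allv; apply: definable_imp.
  apply: definable_all_fin => j.
  pose r x := if x is x'.+1 then (pickle (j : nat, x)).*2.+1.*2 else (j : nat).*2.+1.
  apply: (@definable_ext _ _ (fun K S u => sat S (u \o r) f)); last first.
    exact: (definable_rename r (definable_sat T f)).
  move=> K S _ u; rewrite /bas; suff -> : fcat (fun _ : 'I_1 => vsnd u j) (fun k => slot j (vsnd (vfst u)) k.+1) = u \o r by [].
  apply/funext => -[|x]; first by rewrite (fcat_lt _ _ (ord0 : 'I_1)).
  by rewrite -add1n fcat_ge.
pose r x := if (x < d)%N then x.*2.+1 else (x - d)%N.*2.*2.
apply: (@definable_ext _ _ (fun K S u => P S (fun i => (u \o r) i) (fun k => (u \o r) (d + k)%N))).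
  move=> K S _ u; rewrite /r /=.
  have -> : (fun i : 'I_d => u (if (i < d)%N then i.*2.+1 else (i - d).*2.*2)) = (fun i : 'I_d => vsnd u i).
    by apply/funext => i; rewrite ltn_ord.
  have -> : (fun k : nat => u (if (d + k < d)%N then (d + k).*2.+1 else (d + k - d).*2.*2)) = vfst (vfst u) => //.
  by apply/funext => k; rewrite ltnNge leq_addr /= addKn.
exact: (definable_rename r dP).
Qed.

End DensityDefinable.

Section DenseOfGeneric.
Variables (R : signature) (T : theory R).
Variables (d : nat) (P : forall K : fieldType, struct R void K -> ('I_d -> K) -> (nat -> K) -> Prop).
Hypothesis QE : elim_quantifiers T.
Hypothesis dP : definable T (fun K S v => P S (fun i => v i) (fun k => v (d + k)%N)).

(* The normalized polynomial of minimal support vanishing on a definable set *)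
(* is unique, so its coefficients are in the definable closure.              *)
Lemma dense_of_generic (k N : fieldType) (S : struct R void N) (h : {rmorphism k -> N})
    (t : 'I_d -> N) (e : nat -> k) :
  models S T -> (forall x, dcl S h x -> algebraicOver h x) ->
  P S t (h \o e) -> alg_independent h t -> dense (P S ^~ (h \o e)).
Proof.
move=> mS Hdcl Pt it p0 van0; apply/eqP; apply: contraT => nz0.
pose Q n := `[< exists p : {mpoly N[d]}, [/\ p != 0, vanishing (P S ^~ (h \o e)) p &
  size (msupp p) = n] >].
have [|n /asboolP[p [nz van sp]] Hmin] := @ex_minnP Q.
  by exists (size (msupp p0)); apply/asboolP; exists p0.
have [u0 u0p] : exists u0, u0 \in msupp p.
  case E: (msupp p) => [|u s]; last by exists u; rewrite inE eqxx.
  by move/eqP: nz; case; apply/eqP; rewrite -msupp_eq0 E.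
pose p1 := (p@_u0)^-1 *: p.
have pu0 : p@_u0 != 0 by rewrite -mcoeff_msupp.
have p1u0 : p1@_u0 = 1 by rewrite mcoeffZ mulVf.
have nz1 : p1 != 0 by rewrite scaler_eq0 invr_eq0 negb_or pu0.
have van1 : vanishing (P S ^~ (h \o e)) p1 by move=> a Pa; rewrite mevalZ van // mulr0.
have supp1 u : (p1@_u != 0) = (u \in msupp p) by rewrite mcoeffZ mulf_eq0 invr_eq0 (negPf pu0) mcoeff_msupp.
pose B := msize p1.
have mB u : u \in msupp p -> (mdeg u < B)%N by rewrite -supp1 -mcoeff_msupp; apply: msize_mdeg_lt.
(* The difference of two normalized polynomials has strictly smaller support, so it must vanish by
   minimality. *)
have uniq (p2 : {mpoly N[d]}) : p2@_u0 = 1 -> (forall u, u \notin msupp p -> p2@_u = 0) ->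
    vanishing (P S ^~ (h \o e)) p2 -> p2 = p1.
  move=> H1 H2 H3; apply/eqP; rewrite -subr_eq0; apply: contraT => nz2.
  have : Q (size (msupp (p2 - p1))).
    by apply/asboolP; exists (p2 - p1); split=> // a Pa; rewrite mevalB H3 // van1 // subrr.
  move/Hmin; rewrite -sp leqNgt => /negP[].
  have sub u : u \in msupp (p2 - p1) -> u \in rem u0 (msupp p).
    rewrite mem_rem_uniq ?msupp_uniq // inE mcoeff_msupp mcoeffB.
    have [->|] := eqVneq u u0; first by rewrite H1 p1u0 subrr eqxx.
    move=> _ /=; apply: contraR => nu.
    by rewrite H2 // sub0r oppr_eq0; move: nu; rewrite -supp1 negbK.
  have := uniq_leq_size (msupp_uniq _) sub; rewrite size_rem // => /leq_ltn_trans; apply.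
  by rewrite prednK //; case: (msupp p) u0p.
have alg1 u : algebraicOver h p1@_u.
  have [up|nup] := boolP (u \in msupp p); last first.
    have -> : p1@_u = 0 by apply/eqP; move: nup; rewrite -supp1 negbK.
    exact: algebraic0.
  apply: Hdcl; pose bu (v : 'X_{1..d}) : nat := if insub v is Some v' then pickle (v' : 'X_{1..d < B}) else 0%N.
  have buE (v : 'X_{1..d < B}) : bu v = pickle v by rewrite /bu valK.
  (* By this uniqueness, the coefficient at [u] is the only value x for which some polynomial
     supported in [msupp p], normalized at [u0] and vanishing on the set, has x as coefficient at
     [u]. *)
  have dQ : definable T (fun K S v => exists w : nat -> K,
      [/\ w (bu u) = v 0%N, w (bu u0) = 1,
        forall y : 'X_{1..d < B}, val y \notin msupp p -> w (bu y) = 0 &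
        forall a : nat -> K, P S (fun i => a i) (fun k => v k.+1) -> (gmp d B w).@[fun i => a i] = 0]).
    apply: definable_exv.
    apply: (@definable_ext _ _ (fun K S v => (vsnd v (bu u) = vfst v 0%N /\ vsnd v (bu u0) = 1) /\
      ((forall y : 'X_{1..d < B}, val y \notin msupp p -> vsnd v (bu y) = 0) /\
        (forall a : nat -> K, P S (fun i => a i) (fun k => vfst v k.+1) -> (gmp d B (vsnd v)).@[fun i => a i] = 0)))).
      by move=> K S' _ v; split=> [[[? ?] [? ?]]|[? ? ? ?]].
    apply: definable_and; [apply: definable_and|apply: definable_and].
    - by apply: definable_eq; apply: tdefinable_var.
    - by apply: definable_eq; [apply: tdefinable_var | apply: tdefinable1].
    - apply: definable_all_fin => y; apply: definable_imp; first exact: definable_const.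
      by apply: definable_eq; [apply: tdefinable_var | apply: tdefinable0].
    apply: definable_allv; apply: definable_imp.
      pose r x := if (x < d)%N then x.*2.+1 else (x - d)%N.+1.*2.*2.
      apply: (@definable_ext _ _ (fun K S u => P S (fun i => (u \o r) i) (fun k => (u \o r) (d + k)%N))).
        move=> K S' _ v; rewrite /r /=.
        have -> : (fun i : 'I_d => v (if (i < d)%N then i.*2.+1 else (i - d).+1.*2.*2)) = (fun i : 'I_d => vsnd v i).
          by apply/funext => i; rewrite ltn_ord.
        suff -> : (fun k : nat => v (if (d + k < d)%N then (d + k).*2.+1 else (d + k - d).+1.*2.*2)) =
          (fun k => vfst (vfst v) k.+1) by [].
        by apply/funext => k'; rewrite ltnNge leq_addr /= addKn.
      exact: (definable_rename r dP).
    apply: definable_eq; last exact: tdefinable0.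
    exact: (tdefinable_gmp B (a := fun k K v => vsnd (vfst v) k) (b := fun i K v => vsnd v i)
      (fun k => tdefinable_var _) (fun i => tdefinable_var _)).
  have [f [qf_f Hf]] := definable_qf QE dQ; exists f, e; split=> // x; rewrite Hf //.
  have E0 : fcat (fun _ : 'I_1 => x) (fun k => h (e k)) 0%N = x by apply: (fcat_lt _ _ (ord0 : 'I_1)).
  have -> : (fun k => fcat (fun _ : 'I_1 => x) (fun k => h (e k)) k.+1) = h \o e.
    by apply/funext => j; rewrite -add1n fcat_ge.
  rewrite E0; split=> [[w [w1 w2 w3 w4]]|->].
    suff <- : gmp d B w = p1 by rewrite -w1 (gmp_coef w (BMultinom (mB _ up))) -buE.
    apply: uniq => [|v vp|a Pa].
    - by rewrite (gmp_coef w (BMultinom (mB _ u0p))) -buE.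
    - have [vB|vB] := ltnP (mdeg v) B; first by rewrite (gmp_coef w (BMultinom vB)) -buE w3.
      rewrite memN_msupp_eq0 //; apply: contraL vB => /msize_mdeg_lt; rewrite -ltnNge => /leq_trans.
      by apply; apply: gmp_bound.
    - have := w4 (fcat a (fun=> 0)).
      have -> : (fun i : 'I_d => fcat a (fun=> 0) i) = a by apply/funext => i; rewrite fcat_lt.
      exact.
  have [w Hw] := gmp_onto (leqnn (msize p1)).
  have wE (y : 'X_{1..d < B}) : w (bu y) = p1@_y by rewrite buE -gmp_coef Hw.
  exists w; split.
  - exact: (wE (BMultinom (mB _ up))).
  - by rewrite (wE (BMultinom (mB _ u0p))).
  - by move=> y yp; rewrite wE; apply/eqP; move: yp; rewrite -supp1 negbK.
  - by move=> a Pa; rewrite Hw; apply: van1.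
by move/eqP: nz1; case; apply: (indep_algebraic it alg1); apply: van1.
Qed.

End DenseOfGeneric.

(** * Pseudo closed fields *)

Lemma choice_dep (J : Type) (Y : J -> Type) (P : forall j, Y j -> Prop) :
  (forall j, exists y, P j y) -> exists f : forall j, Y j, forall j, P j (f j).
Proof. by move=> H; exists (fun j => projT1 (cid (H j))) => j; case: (cid _). Qed.

Section PIC.
Variables (I : finType) (L : I -> signature) (T : forall i, theory (L i)).
Variables (K : fieldType) (SK : struct (sig_union L) void K).
Hypothesis picK : PIC T SK.

(* A point, with the same ideal as the tuple [a], in a model of [T i].       *)
Record realisation (E : fieldType) (h : {rmorphism K -> E}) n (a : 'I_n -> E) (i : I) := Realisation {
  rN : fieldType;
  rS : struct (L i) void rN;
  rh : {rmorphism K -> rN};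
  ra : 'I_n -> rN;
  rmod : models rS (@T i);
  rext : extension (reduct_i SK i) rS rh;
  rideal : forall p, ev h a p = 0 <-> ev rh ra p = 0 }.

Arguments rmod {E h n a i} r.
Arguments rext {E h n a i} r.
Arguments rideal {E h n a i} r.

(** Having the same ideal as its realisations, the tuple generates a field that embeds into every
    [rN (r i)]. Pulling the relations back, one language at a time, makes it a model of T_I
    extending K, to which the PIC property applies. *)
Lemma function_field_ec (E : fieldType) (h : {rmorphism K -> E}) n (a : 'I_n -> E)
    (κ : {rmorphism K -> sftype (gen h a)}) (r : forall i, realisation h a i) :
  (forall c, sfval _ (κ c) = h c) -> regular_extension κ ->
  exists (SF : struct (sig_union L) void (sftype (gen h a))) (b : 'I_n -> sftype (gen h a))
         (ψ : forall i, {rmorphism sftype (gen h a) -> rN (r i)}),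
    [/\ forall j, sfval _ (b j) = a j, ec SK SF κ,
      forall i, extension (reduct_i SF i) (rS (r i)) (ψ i),
      forall i j, ψ i (b j) = ra (r i) j & forall i c, ψ i (κ c) = rh (r i) c].
Proof.
move=> Hκ regκ; pose F := sftype (gen h a).
have /choice[b Hb] : forall j, exists y, sfval (gen h a) y = a j by move=> j; apply/sfvalP/gen_var.
have /choice_dep[ψ Hψ] : forall i, exists ψ : {rmorphism F -> rN (r i)}, forall x p q, ev h a q != 0 ->
    ev h a q * sfval _ x = ev h a p -> ev (rh (r i)) (ra (r i)) q * ψ x = ev (rh (r i)) (ra (r i)) p.
  by move=> i; apply: gen_iso; apply: rideal.
have ψκ i c : ψ i (κ c) = rh (r i) c.
  by have := Hψ i (κ c) c%:MP 1; rewrite !ev1 !mul1r !evC; apply; rewrite ?oner_neq0 ?Hκ.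
have ψb i j : ψ i (b j) = ra (r i) j.
  by have := Hψ i (b j) 'X_j 1; rewrite !ev1 !mul1r !evX; apply; rewrite ?oner_neq0 ?Hb.
pose SF : struct (sig_union L) void F := @Struct (sig_union L) void F
  (fun s => match s return ('I_(arity (s : rsym (sig_union L))) -> F) -> Prop with
            existT i s' => fun x => rint (rS (r i)) (fun j => ψ i (x j)) end)
  (fun c : void => match c with end).
have extψ i : extension (reduct_i SF i) (rS (r i)) (ψ i) by split=> [s x|[]].
exists SF, b, ψ; split=> //.
have extκ : extension SK SF κ.
  split=> [[i s] x|[]] /=; have [Hr _] := rext (r i); rewrite -[rint SK _]/(rint (reduct_i SK i) _) Hr.
  by under eq_fun do rewrite -ψκ.
apply/exist_closed_ec; apply: picK.2 => // i.
exact: (models_sub (extψ i) (models_univ (rmod (r i)))).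
Qed.

End PIC.

Lemma fcat1S (K : Type) (a : 'I_1 -> K) e k : fcat a e k.+1 = e k.
Proof. exact: (fcat_ge a e k). Qed.

Lemma indep1 (K E : fieldType) (h : {rmorphism K -> E}) x :
  ~ algebraicOver h x -> alg_independent h (fun _ : 'I_1 => x).
Proof.
move=> nalg p p0; apply/eqP; apply: contraT => nz; case: nalg.
have evC0 (c : {mpoly K[0]}) : ev h ((fun _ : 'I_1 => x) \o @widen1 0) c = h c@_0.
  by have -> : c = (c@_0)%:MP; [rewrite mpolyKC | rewrite evC mcoeffC eqxx mulr1].
exists (map_poly (mcoeff 0%MM) (muni p)).
  apply: contraNneq nz => H; rewrite -muni_eq0; apply/eqP/polyP => j.
  have := congr1 (fun q : {poly K} => q`_j) H; rewrite coef_slice !coef0 => cj.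
  by have -> : (muni p)`_j = ((muni p)`_j@_0)%:MP; [rewrite mpolyKC | rewrite cj mpolyC0].
apply/rootP; rewrite -[RHS]p0 ev_muni; congr (_.[_]).
by apply/polyP => j; rewrite !coef_map /= -[RHS]/(ev _ _ _) evC0.
Qed.

Lemma trans_basis (K E : fieldType) (h : {rmorphism K -> E}) n (e : 'I_n -> E) : perfect_field K ->
  exists r (τ : 'I_r -> E), alg_independent h τ /\ forall k, algOn h τ (e k).
Proof.
move=> perfK; pose P r := `[< exists τ : 'I_r -> E, forall k, algOn h τ (e k) >].
have [|r /asboolP[τ Hτ] Hmin] := @ex_minnP P.
  by exists n; apply/asboolP; exists e => k; apply/algOn_gen/gen_var.
exists r, τ; split=> //; case: r τ Hτ Hmin => [|r] τ Hτ Hmin.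
  move=> p; have pC : p = (p@_0)%:MP by rewrite mpolyKC.
  by rewrite pC evC => /eqP; rewrite fmorph_eq0 => /eqP ->; rewrite mpolyC0.
apply: contrapT => /(perfect_relation perfK)[j [q [sep_q qt]]].
suff /Hmin : P r by rewrite ltnn.
apply/asboolP; exists (τ \o lift j) => k; apply: algOn_trans (Hτ k) => i.
case: (unliftP j i) => [i' ->|->]; first exact/algOn_gen/(gen_var h (τ \o lift j) i').
by exists q => //; apply: separable_poly_neq0.
Qed.

Lemma roots_list (K : fieldType) (p : {poly K}) : p != 0 -> exists rs : seq K, forall x, root p x -> x \in rs.
Proof.
move: {2}(size p) (leqnn (size p)) => n; elim: n p => [|n IH] p sp nz.
  by move: sp; rewrite leqn0 size_poly_eq0 (negPf nz).
have [[x px]|no] := pselect (exists x, root p x); last by exists [::] => x px; case: no; exists x.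
have /factor_theorem[q Dp] := px; have nq : q != 0 by apply: contraNneq nz => q0; rewrite Dp q0 mul0r.
have [|rs Hrs] := IH q _ nq.
  by move: sp; rewrite Dp size_Mmonic ?monicXsubC // size_XsubC addnC.
by exists (x :: rs) => y; rewrite Dp rootM root_XsubC inE => /orP[/Hrs ->|->]; rewrite ?orbT.
Qed.

Section PureTranscendental.
Variables (I : finType) (L : I -> signature) (T : forall i, theory (L i)).
Hypothesis hlarge : forall i, large_fields_theory (@T i).
Variables (K : fieldType) (SK : struct (sig_union L) void K).
Hypothesis picK : PIC T SK.

(** Models of T_i are large, hence infinite, so their affine spaces are dense in themselves and have
    generic points in further models. *)
Lemma indep_realisation (E : fieldType) (h : {rmorphism K -> E}) d (t : 'I_d -> E) i :
  alg_independent h t -> inhabited (realisation T SK h t i).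
Proof.
move=> it; have [N0 [S0 [h0 [m0 ext0]]]] := univ_model (picK.1 i).
have inf0 : infinite N0 := large_infinite (@hlarge i N0 S0 m0).
have [|N [SN [h' [t' [mN ext it' _]]]]] := @generic_point _ (@T i) K _ N0 S0 h0 d
    (feq (L i) (tzero _) (tzero _)) (fun=> 0) m0 ext0.
  by move=> p Hp; apply: (gen_infinite inf0) => a _; apply: Hp.
split; apply: (@Realisation I L T K SK E h d t i N SN h' t' mN ext) => p.
by split=> [/it ->|/it' ->]; rewrite ev0.
Qed.

Lemma indep_ec (E : fieldType) (h : {rmorphism K -> E}) d (t : 'I_d -> E)
    (r : forall i, realisation T SK h t i) : alg_independent h t ->
  exists (κ : {rmorphism K -> sftype (gen h t)}) (SF : struct (sig_union L) void (sftype (gen h t))) b,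
    [/\ forall j, sfval _ (b j) = t j, forall c, sfval _ (κ c) = h c, ec SK SF κ &
      forall i (f : formula (L i) void) (e : nat -> K), qf f ->
        sat (reduct_i SF i) (fcat b (κ \o e)) f <-> sat (rS (r i)) (fcat (ra (r i)) (rh (r i) \o e)) f].
Proof.
move=> it; have [κ Hκ] : exists κ : {rmorphism K -> sftype (gen h t)}, forall c, sfval _ (κ c) = h c.
  by apply: rmorph_lift => c; apply/sfvalP/gen_base.
have [SF [b [ψ [Hb Hec extψ ψb ψκ]]]] := function_field_ec picK r Hκ (gen_indep_regular it Hκ).
exists κ, SF, b; split=> // i f e qff; rewrite (extension_sat _ (extψ i) qff) fcat_comp.
have -> : ψ i \o b = ra (r i) by apply/funext => j; apply: ψb.
by have -> : ψ i \o (κ \o e) = rh (r i) \o e by apply/funext => j; apply: ψκ.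
Qed.

(** K(t) carries a structure of model of T_I regular over K, and t differs from every element of a
    given finite list; existential closedness finds such an element in K. *)
Lemma PIC_infinite : infinite K.
Proof.
move=> s; have [E [h [t it]]] := generic_tuple K 1.
pose r i := inhabited_witness (indep_realisation i it).
have [κ [SF [b [Hb Hκ Hec _]]]] := indep_ec r it.
pose f := foldr (fun k g => fand (fnot (feq (sig_union L) (tvar void 0) (tvar _ k.+1))) g)
  (feq _ (tzero _) (tzero _)) (iota 0 (size s)).
have qff : qf f by rewrite /f; elim: (iota _ _).
have satf (F : fieldType) (S : struct (sig_union L) void F) v :
    sat S v f <-> forall k, (k < size s)%N -> v 0%N <> v k.+1.
  have Hr m l : sat S v (foldr (fun k g => fand (fnot (feq (sig_union L) (tvar void 0) (tvar _ k.+1))) g)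
      (feq _ (tzero _) (tzero _)) (iota m l)) <-> forall k, (m <= k < m + l)%N -> v 0%N <> v k.+1.
    elim: l m => [|l IH] m /=; first by split=> // _ k; lia.
    split=> [[v0 /IH H] k mk|H]; last by split; [apply: H; lia|apply/IH => k mk; apply: H; lia].
    by have [-> //|nk] := eqVneq k m; apply: H; lia.
  by rewrite Hr; split=> H k kl; apply: H; lia.
have [|a /satf Ha] := Hec f 1%N (nth 0 s) qff.
  exists b; apply/satf => k kl; rewrite (fcat_lt _ _ (ord0 : 'I_1)) fcat1S /= => bk.
  have : ev h t ('X_ord0 - (s`_k)%:MP) = 0 by rewrite evB evX evC -Hb bk Hκ subrr.
  move/it/(congr1 (mcoeff U_(ord0))); rewrite mcoeffB mcoeffX eqxx mcoeffC mcoeff0 mnm1_eq0 mulr0 subr0.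
  by move/eqP; rewrite oner_eq0.
exists (a ord0); apply/negP => /(nthP 0)[k kl ak]; apply: (Ha k kl).
by rewrite (fcat_lt _ _ (ord0 : 'I_1)) fcat1S ak.
Qed.

(** Suppose x is transcendental. Give K(x) the L_{i0}-structure induced by N, and any realisation in
    the other languages. The formula isolating x is then satisfied in K by existential closedness,
    so that x comes from K. *)
Lemma dcl_PIC i0 (N : fieldType) (SN : struct (L i0) void N) (h : {rmorphism K -> N}) x :
  models SN (@T i0) -> extension (reduct_i SK i0) SN h -> dcl SN h x -> algebraicOver h x.
Proof.
move=> mN ext [f [e [qff Hf]]]; apply: contrapT => nalg.
have it := indep1 nalg; set t := (fun _ : 'I_1 => x) in it.
have /choice_dep[r Hr] : forall i, exists r : realisation T SK h t i, forall D : i0 = i,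
    sat (rS r) (fcat (ra r) (rh r \o e)) (ecast j (formula (L j) void) D f).
  move=> i; have [D|nD] := pselect (i0 = i); last first.
    by have [r] := indep_realisation i it; exists r.
  case: i / D; exists (@Realisation I L T K SK N h 1 t i0 N SN h t mN ext (fun p => iff_refl _)) => D.
  by rewrite (eq_irrelevance D erefl) /=; apply/Hf.
have [κ [SF [b [Hb Hκ Hec Hsat]]]] := indep_ec r it.
have := Hr i0 erefl; rewrite /= -Hsat // => bf.
have [|a] := Hec (lembed void f) 1%N e (qf_lembed void qff).
  by exists b; apply/sat_lembed.
move/sat_lembed/(extension_sat _ ext qff); rewrite fcat_comp.
have -> : h \o a = fun=> h (a ord0) by apply/funext => j; rewrite /= (ord1 j).
move=> /Hf xa; by apply: nalg; rewrite -xa; apply: algebraic_id.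
Qed.

End PureTranscendental.

Lemma box_of_dense (R : signature) (T : theory R) (N : fieldType) (S : struct R void N) n
    (X : ('I_n -> N) -> Prop) :
  cond_H T -> models S T -> pdefinable S X -> dense X ->
  exists U : 'I_n -> N -> Prop, (forall j (s : seq N), exists2 x, U j x & x \notin s) /\
    forall b, (forall j, U j (b j)) -> X b.
Proof.
move=> [f [_ Hf]] mS pX dX; have [op [basis [ftop ndisc _] _ Hint]] := Hf _ _ mS.
have [a Xa _] := dense_point dX (oner_neq0 _).
have [b [U [_ Ub HU]]] := Hint _ _ pX (ex_intro _ a Xa).
exists U; split=> [j s|c Uc]; first exact: (open_infinite _ ftop ndisc (Ub j).1 (Ub j).2).
by apply: HU => // p /dX ->; rewrite meval0.
Qed.

(* [t] is independent over [M], and [τ] over [K].                            *)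
Lemma indep_cat (K M N : fieldType) (κ : {rmorphism K -> M}) (h : {rmorphism M -> N}) r d
    (τ : 'I_r -> M) (t : 'I_d -> N) :
  alg_independent κ τ -> alg_independent h t ->
  alg_independent (h \o κ) (fun i : 'I_(d + r) => fcat (h \o τ) (fcat t (fzero N)) i).
Proof.
move=> iτ; elim: d t => [|d IH] t it.
  have -> : (fun i : 'I_(0 + r) => fcat (h \o τ) (fcat t (fzero N)) i) = h \o τ.
    by apply/funext => i; rewrite fcat_lt.
  exact: indep_ext.
set u := fun i : 'I_(d.+1 + r) => _; have Du : u \o @widen1 (d + r) =
    fun i : 'I_(d + r) => fcat (h \o τ) (fcat (t \o @widen1 d) (fzero N)) i.
  apply/funext => i; rewrite /u /=; have [ir|ri] := ltnP i r; first by rewrite !(fcat_lt _ _ (Ordinal ir)).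
  rewrite -(subnKC ri) !fcat_ge; have id : (i - r < d)%N by have := ltn_ord i; lia.
  have id' : (i - r < d.+1)%N by lia.
  rewrite (fcat_lt _ _ (Ordinal id)) (fcat_lt _ _ (Ordinal id')) /=.
  by congr (t _); apply/val_inj.
apply: indep_snoc; rewrite Du; first exact: IH (indep_widen it).
have -> : u ord_max = t ord_max.
  have E0 : (d + r = r + d)%N by rewrite addnC.
  apply: (etrans (congr1 (fcat (h \o τ) (fcat t (fzero N))) E0)).
  by rewrite fcat_ge; apply: (fcat_lt t (fzero N) ord_max).
move=> alg; apply: (indep_last it); apply: algebraic_trans alg => y.
have /sfvalP[z <-] : gen h (t \o @widen1 d) (sfval _ y); last exact: algebraic_id.
apply: (gen_min (h := h \o κ) (a := fun i : 'I_(d + r) => fcat (h \o τ) (fcat (t \o @widen1 d) (fzero N)) i)).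
- by move=> c; apply: gen_base.
- move=> i; have [ir|ri] := ltnP i r.
    by rewrite (fcat_lt _ _ (Ordinal ir)); apply: gen_base.
  have id : (i - r < d)%N by have := ltn_ord i; lia.
  rewrite -(subnKC ri) fcat_ge (fcat_lt _ _ (Ordinal id)); exact: (gen_var h (t \o @widen1 d)).
by apply/sfvalP; exists y.
Qed.

(** * Density of generic members of a family under (H) *)

Section FamilyDefinable.
Variables (R : signature) (T : theory R).
Variables (d : nat) (P : forall K : fieldType, struct R void K -> ('I_d -> K) -> (nat -> K) -> Prop).
Hypothesis QE : elim_quantifiers T.
Hypothesis H : cond_H T.
Hypothesis dP : definable T (fun K S v => P S (fun i => v i) (fun k => v (d + k)%N)).

Let ly (K : fieldType) r (z : 'I_(d + r) -> K) (i : 'I_r) : K := z (cast_ord (addnC r d) (lshift d i)).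
Let rx (K : fieldType) r (z : 'I_(d + r) -> K) (j : 'I_d) : K := z (cast_ord (addnC r d) (rshift r j)).

(* The union of the sparse members of the family [P] whose parameters        *)
(* [e 0, ..., e (B - 1)] are algebraic over the first [r] coordinates.       *)
Definition sparse_union r B B0 N0 (J : 'I_B -> nat) (K : fieldType) (S : struct R void K)
    (z : 'I_(d + r) -> K) (e0 : nat -> K) :=
  exists e : nat -> K, (forall k : 'I_B, (gmp r B0 (slot (J k) (slot k e0))).@[ly z] <> 0 /\
     (map_poly (meval (ly z)) (gp r B0 N0 (slot k e0))).[e k] = 0) /\
    (P S (rx z) e /\ ~ dense (P S ^~ e)).

Lemma sparse_union_definable r B B0 N0 J :
  definable T (fun K S v => @sparse_union r B B0 N0 J K S (fun i => v i) (fun k => v (d + r + k)%N)).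
Proof.
apply: definable_exv; apply: definable_and; [|apply: definable_and].
- apply: definable_all_fin => k; apply: definable_and.
    apply: definable_not; apply: definable_eq; last exact: tdefinable0.
    exact: (tdefinable_gmp (d := r) B0 (a := fun q K v => vfst v (d + r + pickle (k : nat, pickle (J k, q)))%N)
      (b := fun i K v => vfst v i) (fun k => tdefinable_var _) (fun i => tdefinable_var _)).
  apply: definable_eq; last exact: tdefinable0.
  exact: (tdefinable_gp (d := r) B0 N0 (a := fun q K v => vfst v (d + r + pickle (k : nat, q))%N)
      (b := fun i K v => vfst v i) (s := fun K v => vsnd v k)
      (fun k => tdefinable_var _) (fun i => tdefinable_var _) (tdefinable_var _)).
- pose ρ x := if (x < d)%N then (r + x).*2 else (x - d)%N.*2.+1.
  apply: (@definable_ext _ _ (fun K S u => P S (fun i => (u \o ρ) i) (fun k => (u \o ρ) (d + k)%N))).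
    move=> K S _ u; rewrite /ρ /rx /=.
    have -> : (fun i : 'I_d => u (if (i < d)%N then (r + i).*2 else (i - d).*2.+1)) =
        (fun i : 'I_d => vfst u (r + i)%N).
      by apply/funext => i; rewrite ltn_ord.
    suff -> : (fun k : nat => u (if (d + k < d)%N then (r + (d + k)).*2 else (d + k - d).*2.+1)) = vsnd u by [].
    by apply/funext => k; rewrite ltnNge leq_addr /= addKn.
  exact: (definable_rename ρ dP).
apply: definable_not.
exact: (definable_rename (fun x => x.*2.+1) (dense_definable_H QE dP H)).
Qed.

(* A generic point of a sparse member would put [(τ, t)] in a definable set  *)
(* over [K], hence Zariski dense; but the fibre over some [y] would contain  *)
(* a box covered by finitely many sparse sets.                               *)
Lemma generic_dense_H (K M N : fieldType) (κ : {rmorphism K -> M}) (h : {rmorphism M -> N})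
    (S : struct R void N) (t : 'I_d -> N) (e : nat -> M) :
  perfect_field K -> models S T -> (forall x, dcl S (h \o κ) x -> algebraicOver (h \o κ) x) ->
  alg_independent h t -> P S t (h \o e) -> dense (P S ^~ (h \o e)).
Proof.
move=> perfK mS Hdcl it Pt; apply: contrapT => nd.
have [φ [qφ Hφ]] := fibre_formula QE dP; have [B [HB _]] := sat_bound φ.
have PB (e1 e2 : nat -> N) x : (forall k : 'I_B, e1 k = e2 k) -> P S x e1 -> P S x e2.
  move=> He; rewrite -!Hφ //; apply: (HB _ _ _ _ _).1 => k kB; rewrite /fcat; case: insubP => //= nk.
  have kdB : (k - d < B)%N by apply: leq_ltn_trans kB; apply: leq_subr.
  exact: (He (Ordinal kdB)).
have [r [τ [iτ algτ]]] := trans_basis κ (fun k : 'I_B => e k) perfK.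
(* [W k] is an equation of [e k] with coefficients polynomial in τ over K, and [J k] marks one that
   does not vanish at τ. Both enter the definition of the sparse union, so that its parameters lie
   in K. *)
have /choice[W HW] := fun k : 'I_B => (proj1 (algOnP κ τ (e k)) (algτ k)).
have /choice[J HJ] : forall k : 'I_B, exists j, ev κ τ (W k)`_j != 0.
  move=> k; apply: contrapT => no; have /negP := (HW k).1; apply; apply/eqP/polyP => j.
  rewrite coef_map coef0 /=; apply/eqP; apply: contraT => nz; by case: no; exists j.
pose N0 := \max_k size (W k).
pose B0 := \max_k \max_(j < N0) msize (W k)`_j.
have WN (k : 'I_B) : (size (W k) <= N0)%N by apply: (leq_bigmax k).
have WB (k : 'I_B) j : (msize (W k)`_j <= B0)%N.
  have [jN|jN] := ltnP j N0; last by rewrite nth_default ?msize0 // (leq_trans (WN k)).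
  apply: leq_trans (leq_bigmax k); exact: (leq_bigmax (Ordinal jN)).
have /choice[E HE] : forall k, exists E, gp r B0 N0 E = W k by move=> k; apply: gp_onto.
pose e0 : nat -> K := glue (fun k => if insub k is Some k' then E k' else fun=> 0).
have e0k (k : 'I_B) : gp r B0 N0 (slot k e0) = W k by rewrite slot_glue valK HE.
have JN (k : 'I_B) : (J k < N0)%N.
  rewrite ltnNge; apply/negP => NJ; have /negP := HJ k; apply.
  by rewrite nth_default ?ev0 // (leq_trans (WN k)).
have e0J (k : 'I_B) : gmp r B0 (slot (J k) (slot k e0)) = (W k)`_(J k).
  by rewrite -e0k coef_poly JN.
pose z i : N := fcat (h \o τ) (fcat t (fzero N)) (i : 'I_(d + r)).
have lyz : ly z = h \o τ by apply/funext => i; rewrite /ly /z fcat_lt.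
have rxz : rx z = t by apply/funext => j; rewrite /rx /z /= fcat_ge fcat_lt.
pose X := @sparse_union r B B0 N0 J N S.
have Xz : X z ((h \o κ) \o e0).
  exists (h \o e); split=> [k|]; last by rewrite rxz.
  have E1 p : (map_mpoly (h \o κ) p).@[h \o τ] = h (ev κ τ p) by rewrite -ev_comp.
  rewrite lyz; split.
    rewrite -[slot _ _]/((h \o κ) \o slot (J k) (slot k e0)) -gmp_map e0J E1.
    by move/eqP; rewrite fmorph_eq0 (negPf (HJ k)).
  rewrite -[slot _ _]/((h \o κ) \o slot k e0) -gp_map e0k -map_poly_comp.
  rewrite (eq_map_poly (g := h \o evr κ τ)) => [|p]; last exact: E1.
  by rewrite map_poly_comp horner_map (rootP (HW k).2); apply: rmorph0.
have dX := dense_of_generic QE (sparse_union_definable r B0 N0 J) mS Hdcl Xz (indep_cat iτ it).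
have pX : pdefinable S (X ^~ ((h \o κ) \o e0)).
  have [ψ [qψ Hψ]] := fibre_formula QE (sparse_union_definable r B0 N0 J).
  by exists ψ, ((h \o κ) \o e0); split=> // a; rewrite Hψ.
have [U [Uinf HU]] := box_of_dense H mS pX dX.
have /choice[y0 Hy0] : forall i, exists x, U i x by move=> i; have [x Ux _] := Uinf i [::]; exists x.
pose y (i : 'I_r) := y0 (cast_ord (addnC r d) (lshift d i)).
pose V (j : 'I_d) := U (cast_ord (addnC r d) (rshift r j)).
pose Wy (k : 'I_B) := map_poly (meval y) (gp r B0 N0 (slot k ((h \o κ) \o e0))).
pose mix (x : 'I_d -> N) i : N := fcat y (fcat x (fzero N)) (i : 'I_(d + r)).
have lym x : ly (mix x) = y by apply/funext => i; rewrite /ly /mix fcat_lt.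
have rxm x : rx (mix x) = x by apply/funext => j; rewrite /rx /mix /= fcat_ge fcat_lt.
have mixU x : (forall j, V j (x j)) -> forall i, U i (mix x i).
  move=> Vx i; have := rxm x; have := lym x.
  case: (splitP (cast_ord (addnC d r) i)) => j Dj; move=> /funeqP/= Hl /funeqP/= Hr.
    have -> : i = cast_ord (addnC r d) (lshift d j) by apply/val_inj.
    by have := Hl j; rewrite /ly => ->; apply: Hy0.
  have -> : i = cast_ord (addnC r d) (rshift r j) by apply/val_inj.
  by have := Hr j; rewrite /rx => ->; apply: Vx.
have nWy k : Wy k != 0.
  have [x Vx] : exists x : 'I_d -> N, forall j, V j (x j) by exists (fun j => y0 (cast_ord (addnC r d) (rshift r j))) => j; apply: Hy0.
  have [e1 [He1 _]] := HU _ (mixU _ Vx); have [+ _] := He1 k; rewrite lym => nz.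
  apply/eqP => W0; apply: nz; have := congr1 (fun q : {poly N} => q`_(J k)) W0.
  by rewrite coef0 coef_map coef_poly JN.
have /choice[rs Hrs] := fun k => roots_list (nWy k).
pose Q := \max_k size (rs k).
(* Above the fixed [y], the relevant parameters are roots of the nonzero polynomials [Wy k]:
   finitely many tuples, enumerated by [c]. Each sparse member lies in the zeros of a nonzero
   polynomial, and the product of these vanishes on a box. *)
pose ec (c : {ffun 'I_B -> 'I_Q}) : nat -> N :=
  fun k => if insub k is Some k' then nth 0 (rs k') (c k') else 0.
have /choice[q Hq] : forall c, exists q : {mpoly N[d]}, q != 0 /\
    (~ dense (P S ^~ (ec c)) -> vanishing (P S ^~ (ec c)) q).
  move=> c; have [dc|ndc] := pselect (dense (P S ^~ (ec c))).
    by exists 1; rewrite oner_neq0.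
  apply: contrapT => no; apply: ndc => q Hq; apply/eqP; apply: contraT => nq.
  by case: no; exists q.
have /eqP : \prod_c q c = 0.
  apply: (box_dense (U := V)) => [j s|x Vx]; first exact: Uinf.
  have [e1 [He1 [Pe1 nd1]]] := HU _ (mixU _ Vx); rewrite rxm in Pe1.
  have idx (k : 'I_B) : (index (e1 k) (rs k) < Q)%N.
    apply: leq_trans (leq_bigmax k); rewrite index_mem; apply: Hrs; apply/rootP.
    by have [_] := He1 k; rewrite lym.
  pose c := [ffun k => Ordinal (idx k)].
  have Ec (k : 'I_B) : e1 k = ec c k.
    rewrite /ec valK ffunE /= nth_index //; apply: Hrs; apply/rootP.
    by have [_] := He1 k; rewrite lym.
  rewrite rmorph_prod (bigD1 c) //= (Hq c).2 ?mul0r //.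
    move=> dc; apply: nd1 => p Hp; apply: dc => a Pa; apply: Hp.
    by apply: PB Pa => k; rewrite Ec.
  exact: PB Ec Pe1.
by apply/negP/prodf_neq0 => c _; apply: (Hq c).1.
Qed.

End FamilyDefinable.

(** * Literals *)

Lemma teval_void (K : fieldType) (c : void -> K) v t : teval c v t = teval (of_void K) v t.
Proof. by congr teval; apply/funext; case. Qed.

Section Decompose.
Variables (I : finType) (L : I -> signature).

Definition falways (i : I) : formula (L i) void := feq (L i) (tzero _) (tzero _).

(* [g] is determined by the polynomial equations [t = 0] for [t] in [es], by *)
(* [w <> 0], and by one formula in each language.                            *)
Definition literals (K : fieldType) (S : struct (sig_union L) void K) v
    (es : seq (term void)) (w : term void) (φ : forall i, formula (L i) void) :=
  [/\ forall t, List.In t es -> teval (of_void K) v t = 0, teval (of_void K) v w <> 0 &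
    forall i, sat (reduct_i S i) v (φ i)].

(** Record the truth value of every atom at v: the equations that hold, the product of the terms
    that do not vanish, and for each language the conjunction of its literals. *)
Lemma decompose (g : formula (sig_union L) void) (F : fieldType) (SF : struct (sig_union L) void F) v :
  qf g -> exists es w φ, [/\ forall i, qf (φ i), literals SF v es w φ &
    forall F' (SF' : struct (sig_union L) void F') v', literals SF' v' es w φ ->
      sat SF v g <-> sat SF' v' g].
Proof.
elim: g => // [t1 t2 _|[i r] ts _|g IH /IH[es [w [φ [qφ lit H]]]]|g1 IH1 g2 IH2 [q1 q2]].
- pose t := tadd t1 (topp t2).
  have tE (F' : fieldType) (c : void -> F') v' : (teval c v' t1 = teval c v' t2) <-> (teval (of_void F') v' t = 0).
    rewrite /t /= -!(teval_void c); split=> [->|/eqP]; first by rewrite subrr.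
    by rewrite subr_eq0 => /eqP.
  have [t0|nt0] := eqVneq (teval (of_void F) v t) 0.
    exists [:: t], (tone _), falways; split=> //; first by split=> [t' [<-|]|/eqP|] //=; rewrite oner_eq0.
    by move=> F' SF' v' [et _ _]; rewrite /= !tE t0; split=> // _; apply: et; left.
  exists [::], t, falways; split=> //; first by split=> //; apply/eqP.
  by move=> F' SF' v' [_ nt _]; rewrite /= !tE; split=> // /eqP; rewrite (negPf nt0).
- pose ft := @frel (L i) void r ts.
  pose f0 : formula (L i) void := if pselect (sat (reduct_i SF i) v ft) then ft else fnot ft.
  pose φ j : formula (L j) void := if pselect (i = j) is left D then ecast j (formula (L j) void) D f0 else falways j.
  have φi : φ i = f0.
    by rewrite /φ; case: pselect => // D; rewrite (eq_irrelevance D erefl).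
  have φn j : j <> i -> φ j = falways j by move=> nj; rewrite /φ; case: pselect => // D; case: nj.
  have q0 : qf f0 by rewrite /f0; case: pselect.
  have s0 : sat (reduct_i SF i) v f0 by rewrite /f0; case: pselect.
  exists [::], (tone _), φ; split.
  + by move=> j; have [->|/eqP nj] := eqVneq j i; [rewrite φi | rewrite φn].
  + split=> //=; first by move/eqP; rewrite oner_eq0.
    by move=> j; have [->|/eqP nj] := eqVneq j i; [rewrite φi | rewrite φn].
  + move=> F' SF' v' [_ _ /(_ i)]; rewrite φi /f0.
    have E (K : fieldType) (S : struct (sig_union L) void K) u :
        sat S u (@frel (sig_union L) _ (existT _ i r) ts) <-> sat (reduct_i S i) u ft.
      by rewrite /=; split; congr rint; apply/funext => k; rewrite !(teval_void (_ : void -> _)).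
    case: pselect => H H'; apply: (iff_trans (E _ _ _)); apply: iff_sym;
      by apply: (iff_trans (E _ _ _)); split=> // /H'.
- by exists es, w, φ; split=> // F' SF' v' /H /= ->.
- have [es1 [w1 [φ1 [qφ1 [e1 n1 r1] H1]]]] := IH1 q1; have [es2 [w2 [φ2 [qφ2 [e2 n2 r2] H2]]]] := IH2 q2.
  exists (es1 ++ es2), (tmul w1 w2), (fun i => fand (φ1 i) (φ2 i)); split=> //.
    split=> [t ti|/eqP|i] //=; first by case: (List.in_app_or _ _ _ ti) => [/e1|/e2].
    by rewrite mulf_eq0 => /orP[/eqP/n1|/eqP/n2].
  move=> F' SF' v' [e w r] /=; rewrite (H1 F' SF' v') ?(H2 F' SF' v') //.
    split=> [t ti||i]; [by apply: e; apply: List.in_or_app; right| |exact: (r i).2].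
    by move=> w0; apply: w; rewrite /= w0 mulr0.
  split=> [t ti||i]; [by apply: e; apply: List.in_or_app; left| |exact: (r i).1].
  by move=> w0; apply: w; rewrite /= w0 mul0r.
Qed.

End Decompose.

Section Hat.
Variables (K : fieldType) (d n : nat) (q : {mpoly K[d]}) (p : nat -> {poly {mpoly K[d]}}) (v : nat -> K).

(* The numerator, over the indicated power of [q], of a term evaluated at    *)
(* [p k / q].                                                                *)
Fixpoint hat (t : term void) : nat * {poly {mpoly K[d]}} :=
  match t with
  | tvar x => if (x < n)%N then (1%N, p x) else (0%N, ((v (x - n)%N)%:MP)%:P)
  | tcst c => match c with end
  | tzero => (0%N, 0)
  | tone => (0%N, 1)
  | tadd t1 t2 => (((hat t1).1 + (hat t2).1)%N,
      (q ^+ (hat t2).1)%:P * (hat t1).2 + (q ^+ (hat t1).1)%:P * (hat t2).2)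
  | topp t1 => ((hat t1).1, - (hat t1).2)
  | tmul t1 t2 => (((hat t1).1 + (hat t2).1)%N, (hat t1).2 * (hat t2).2)
  end.

Lemma hatP (E : fieldType) (h : {rmorphism K -> E}) (t : 'I_d -> E) s (a : 'I_n -> E) c τ :
  (forall k : 'I_n, ev h t q * a k = ev2 h t s (p k)) ->
  ev h t q ^+ (hat τ).1 * teval c (fcat a (h \o v)) τ = ev2 h t s (hat τ).2.
Proof.
move=> Ha; pose ρ : {rmorphism {poly {mpoly K[d]}} -> E} := horner_eval s \o map_poly (evr h t).
have Hq k : ρ (q ^+ k)%:P = ev h t q ^+ k.
  by rewrite /ρ /= /horner_eval map_polyC hornerC; apply: (rmorphXn (evr h t)).
have Hb b : ρ (b%:MP)%:P = h b by rewrite /ρ /= /horner_eval map_polyC hornerC; apply: evC.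
have {}Ha k : ev h t q * a k = ρ (p k) := Ha k.
rewrite -[RHS]/(ρ _); move: (ev h t q) Hq Ha => y Hq Ha; clearbody ρ.
elim: τ => [x|[]|||t1 IH1 t2 IH2|t1 IH1|t1 IH1 t2 IH2]; rewrite [teval _ _ _]/= [hat _]/=.
- case: ltnP => xn; rewrite [in RHS]/=; first by rewrite expr1 (fcat_lt _ _ (Ordinal xn)) Ha.
  by rewrite expr0 mul1r Hb -{1}(subnKC xn) fcat_ge.
- by rewrite mulr0 rmorph0.
- by rewrite mulr1 rmorph1.
- rewrite [in RHS]/= (rmorphD ρ) !(rmorphM ρ) !Hq -IH1 -IH2 exprD.
  move: (y ^+ _) (y ^+ _) (teval _ _ t1) (teval _ _ t2) => a1 a2 b1 b2; ring.
- by rewrite [in RHS]/= (rmorphN ρ) mulrN IH1.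
- rewrite [in RHS]/= (rmorphM ρ) -IH1 -IH2 exprD.
  move: (y ^+ _) (y ^+ _) (teval _ _ t1) (teval _ _ t2) => a1 a2 b1 b2; ring.
Qed.

End Hat.

Definition pv (K : fieldType) d (x : 'I_d -> K) (s : K) (u : {poly {mpoly K[d]}}) : K :=
  (map_poly (meval x) u).[s].

Section Pv.
Variables (K : fieldType) (d : nat) (x : 'I_d -> K) (s : K).

Lemma pvD u w : pv x s (u + w) = pv x s u + pv x s w.
Proof. by rewrite /pv rmorphD hornerD. Qed.
Lemma pvB u w : pv x s (u - w) = pv x s u - pv x s w.
Proof. by rewrite /pv rmorphB hornerD hornerN. Qed.
Lemma pvM u w : pv x s (u * w) = pv x s u * pv x s w.
Proof. by rewrite /pv rmorphM hornerM. Qed.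
Lemma pvC c : pv x s c%:P = c.@[x].
Proof. by rewrite /pv map_polyC hornerC. Qed.
Lemma pvXn n : pv x s 'X^n = s ^+ n.
Proof. by rewrite /pv map_polyXn hornerXn. Qed.
Lemma pvZ c u : pv x s (c *: u) = c.@[x] * pv x s u.
Proof. by rewrite -mul_polyC pvM pvC. Qed.

End Pv.

Lemma pv_inj (K : fieldType) d (u w : {poly {mpoly K[d]}}) : infinite K ->
  (forall x s, pv x s u = pv x s w) -> u = w.
Proof.
move=> infK H; apply/eqP; rewrite -subr_eq0; apply/eqP/polyP => j; rewrite coef0.
have evid (a : 'I_d -> K) r : r.@[(idfun : {rmorphism K -> K}) \o a] = r.@[a] by [].
apply: (mpoly_infinite (h := idfun) infK) => a; rewrite evid.
suff E : map_poly (meval a) (u - w) = 0.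
  by have := congr1 (fun q : {poly K} => q`_j) E; rewrite coef0 coef_map.
apply: (poly_infinite (h := id) _ infK) => // s.
by rewrite -[LHS]/(pv a s _) pvB H subrr.
Qed.

(** * First-order description of a hypersurface and of its rational functions *)

Section Pieces.
Variables (n d B m : nat).

(* The layout of the parameter [e].                                          *)
Definition cv (K : fieldType) (e : nat -> K) := slot 0 e.
Definition cF (K : fieldType) (e : nat -> K) : {poly {mpoly K[d]}} := 'X^m + gp d B m (slot 1 e).
Definition cq (K : fieldType) (e : nat -> K) : {mpoly K[d]} := gmp d B (slot 2 e).
Definition cp (K : fieldType) (e : nat -> K) k : {poly {mpoly K[d]}} := gp d B m (slot k.+3 e).
Definition chat (K : fieldType) (e : nat -> K) τ := (hat n (cq e) (cp e) (cv e) τ).2.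

Lemma cF_map (K F : fieldType) (h : {rmorphism K -> F}) e : map_poly (map_mpoly h) (cF e) = cF (h \o e).
Proof. by rewrite rmorphD /= map_polyXn gp_map. Qed.

Lemma cF_size (K : fieldType) (e : nat -> K) : size (cF e) = m.+1.
Proof. by rewrite size_polyDl size_polyXn // ltnS gp_size. Qed.

Lemma cF_monic (K : fieldType) (e : nat -> K) : cF e \is monic.
Proof.
rewrite monicE lead_coefE cF_size /= coefD coefXn eqxx nth_default ?addr0 //.
exact: gp_size.
Qed.

(** The successor makes room for the leading coefficient 1, of size 1, also when [B = 0]. *)
Lemma cF_bound (K : fieldType) (e : nat -> K) j : (msize (cF e)`_j <= B.+1)%N.
Proof.
rewrite coefD coefXn; apply: leq_trans (msizeD_le _ _) _; rewrite geq_max.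
by case: (_ == _); rewrite ?msize1 ?msize0 /= (leq_trans (gp_bound _ _ _ _ _)).
Qed.

Variables (ρ : nat -> nat) (xi : nat -> nat) (σ : nat).
Notation "'xs' v" := (fun i : 'I_d => v (xi i)) (at level 10).

Lemma tdefinable_gpv B' N' (E : forall K : fieldType, (nat -> K) -> nat -> K) :
  (forall k, tdefinable (fun K v => E K v k)) ->
  tdefinable (fun K v => pv (xs v) (v σ) (gp d B' N' (E K v))).
Proof.
move=> Ha; exact: (tdefinable_gp (d := d) B' N' (a := fun k K v => E K v k) (b := fun i K v => v (xi i)) (s := fun K v => v σ) Ha
  (fun i => tdefinable_var _) (tdefinable_var _)).
Qed.

Lemma tdefinable_F : tdefinable (fun K v => pv (xs v) (v σ) (cF (v \o ρ))).
Proof.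
apply: (tdefinable_ext (g1 := fun K v => v σ ^+ m + pv (xs v) (v σ) (gp d B m (slot 1 (v \o ρ))))).
  by move=> K v; rewrite pvD pvXn.
apply: tdefinableD; first by apply: tdefinableX; apply: tdefinable_var.
exact: (tdefinable_gpv B m (E := fun K v => slot 1 (v \o ρ)) (fun k => tdefinable_var _)).
Qed.

Lemma tdefinable_q : tdefinable (fun K v => (cq (v \o ρ)).@[xs v]).
Proof.
exact: (tdefinable_gmp (d := d) B (b := fun i K v => v (xi i)) (fun k => tdefinable_var _)
  (fun i => tdefinable_var _)).
Qed.

Lemma tdefinable_p k : tdefinable (fun K v => pv (xs v) (v σ) (cp (v \o ρ) k)).
Proof. exact: (tdefinable_gpv B m (E := fun K v => slot k.+3 (v \o ρ)) (fun k => tdefinable_var _)). Qed.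

Fixpoint hdeg (t : term void) : nat :=
  match t with
  | tvar x => (x < n)%N
  | tcst _ | tzero | tone => 0%N
  | tadd t1 t2 | tmul t1 t2 => (hdeg t1 + hdeg t2)%N
  | topp t1 => hdeg t1
  end.

Lemma hat_deg (K : fieldType) (q : {mpoly K[d]}) p v t : (hat n q p v t).1 = hdeg t.
Proof. by elim: t => //= [x|t1 -> t2 ->|t1 -> t2 ->] //; case: ltnP. Qed.

Lemma tdefinable_hat τ : tdefinable (fun K v => pv (xs v) (v σ) (chat (v \o ρ) τ)).
Proof.
elim: τ => [x|[]|||t1 IH1 t2 IH2|t1 IH1|t1 IH1 t2 IH2].
- case xn : (x < n)%N.
    apply: (tdefinable_ext _ (tdefinable_p x)) => K v; by rewrite /chat /= xn.
  apply: (tdefinable_ext _ (tdefinable_var (ρ (pickle (0%N, (x - n)%N))))) => K v.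
  by rewrite /chat /= xn pvC mevalC.
- by apply: (tdefinable_ext _ tdefinable0) => K v; rewrite /chat /= pvC meval0.
- by apply: (tdefinable_ext _ tdefinable1) => K v; rewrite /chat /= pvC meval1.
- apply: (tdefinable_ext _ (tdefinableD (tdefinableM (tdefinableX (hdeg t2) tdefinable_q) IH1)
    (tdefinableM (tdefinableX (hdeg t1) tdefinable_q) IH2))) => K v.
  by rewrite /chat [in RHS]/= pvD !pvM !pvC !hat_deg !rmorphXn.
- apply: (tdefinable_ext _ (tdefinableN IH1)) => K v.
  by rewrite /chat [in RHS]/= -[X in _ = pv _ _ X]sub0r pvB pvC meval0 sub0r.
- apply: (tdefinable_ext _ (tdefinableM IH1 IH2)) => K v.
  by rewrite /chat [in RHS]/= pvM.
Qed.

End Pieces.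

Section Certificates.
Variables (R : signature) (T : theory R) (n d B m : nat).

(** The numerator of the term is a multiple of f, so the term vanishes on the hypersurface. Over an
    infinite field identities between polynomials can be stated pointwise; [x d] is the main
    variable. *)
Definition eq_cert τ N' B' (K : fieldType) (e : nat -> K) :=
  exists w : nat -> K, forall x : nat -> K, pv (fun i : 'I_d => x i) (x d) (chat n d B m e τ) =
    pv (fun i : 'I_d => x i) (x d) (cF d B m e) * pv (fun i : 'I_d => x i) (x d) (gp d B' N' w).

(** The numerator divides a nonzero polynomial in t modulo f, so it is invertible at the generic
    point of the hypersurface. *)
Definition neq_cert τ N' B' (K : fieldType) (e : nat -> K) :=
  exists w : nat -> K, (exists x : nat -> K, (gmp d B' (slot 2 w)).@[fun i : 'I_d => x i] <> 0) /\
    forall x : nat -> K,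
    pv (fun i : 'I_d => x i) (x d) (gp d B' N' (slot 0 w)) * pv (fun i : 'I_d => x i) (x d) (chat n d B m e τ) =
    (gmp d B' (slot 2 w)).@[fun i : 'I_d => x i] +
    pv (fun i : 'I_d => x i) (x d) (cF d B m e) * pv (fun i : 'I_d => x i) (x d) (gp d B' N' (slot 1 w)).

Lemma eq_cert_definable τ N' B' ρ : definable T (fun K S v => eq_cert τ N' B' (v \o ρ)).
Proof.
apply: definable_exv; apply: definable_allv; apply: definable_eq.
  exact: (tdefinable_hat n d B m (fun k => (ρ k).*2.*2) (fun i => i.*2.+1) d.*2.+1 τ).
apply: tdefinableM.
  exact: (tdefinable_F d B m (fun k => (ρ k).*2.*2) (fun i => i.*2.+1) d.*2.+1).
exact: (tdefinable_gpv d (fun i => i.*2.+1) d.*2.+1 B' N' (E := fun K u => vsnd (vfst u)) (fun k => tdefinable_var k.*2.+1.*2)).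
Qed.

Lemma neq_cert_definable τ N' B' ρ : definable T (fun K S v => neq_cert τ N' B' (v \o ρ)).
Proof.
apply: definable_exv; apply: definable_and.
  apply: definable_exv; apply: definable_not; apply: definable_eq; last exact: tdefinable0.
  exact: (tdefinable_gmp (d := d) B' (a := fun k K v => slot 2 (vsnd (vfst v)) k) (b := fun i K v => v i.*2.+1)
    (fun k => tdefinable_var (pickle (2%N, k)).*2.+1.*2) (fun i => tdefinable_var _)).
apply: definable_allv; apply: definable_eq.
  apply: tdefinableM.
    exact: (tdefinable_gpv d (fun i => i.*2.+1) d.*2.+1 B' N' (E := fun K u => slot 0 (vsnd (vfst u))) (fun k => tdefinable_var (pickle (0%N, k)).*2.+1.*2)).
  exact: (tdefinable_hat n d B m (fun k => (ρ k).*2.*2) (fun i => i.*2.+1) d.*2.+1 τ).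
apply: tdefinableD.
  exact: (tdefinable_gmp (d := d) B' (a := fun k K v => slot 2 (vsnd (vfst v)) k) (b := fun i K v => v i.*2.+1)
    (fun k => tdefinable_var (pickle (2%N, k)).*2.+1.*2) (fun i => tdefinable_var _)).
apply: tdefinableM.
  exact: (tdefinable_F d B m (fun k => (ρ k).*2.*2) (fun i => i.*2.+1) d.*2.+1).
exact: (tdefinable_gpv d (fun i => i.*2.+1) d.*2.+1 B' N' (E := fun K u => slot 1 (vsnd (vfst u))) (fun k => tdefinable_var (pickle (1%N, k)).*2.+1.*2)).
Qed.

(** A pointwise form of [red_mod] for given degrees: [x d] stands for the root of P, whose
    coefficients are in [c], and [x d.+1] is the main variable. *)
Definition red_cert D n1 n2 B' (K : fieldType) (c e : nat -> K) :=
  exists w : nat -> K, forall x : nat -> K,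
    pv (fun i : 'I_d => x i) (x d.+1) (cF d B m e) =
    (x d.+1 ^+ n1 + pv (fun i : 'I_d.+1 => x i) (x d.+1) (gp d.+1 B' n1 (slot 0 w))) *
    (x d.+1 ^+ n2 + pv (fun i : 'I_d.+1 => x i) (x d.+1) (gp d.+1 B' n2 (slot 1 w))) +
    (\sum_(k < D) c k * x d ^+ k) * pv (fun i : 'I_d.+1 => x i) (x d.+1) (gp d.+1 B' m.+1 (slot 2 w)).

Lemma red_cert_definable D n1 n2 B' γ ρ :
  definable T (fun K S v => red_cert D n1 n2 B' (v \o γ) (v \o ρ)).
Proof.
apply: definable_exv; apply: definable_allv; apply: definable_eq.
  exact: (tdefinable_F d B m (fun k => (ρ k).*2.*2) (fun i => i.*2.+1) d.+1.*2.+1).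
have G N' j : tdefinable (fun K u => pv (fun i : 'I_d.+1 => vsnd u i) (vsnd u d.+1)
    (gp d.+1 B' N' (slot j (vsnd (vfst u))))).
  exact: (tdefinable_gpv d.+1 (fun i => i.*2.+1) d.+1.*2.+1 B' N' (E := fun K u => slot j (vsnd (vfst u))) (fun k => tdefinable_var (pickle (j, k)).*2.+1.*2)).
apply: tdefinableD; apply: tdefinableM; try exact: G.
- by apply: tdefinableD; [apply: tdefinableX; apply: tdefinable_var | apply: G].
- by apply: tdefinableD; [apply: tdefinableX; apply: tdefinable_var | apply: G].
apply: tdefinable_sum => k; apply: tdefinableM; first exact: tdefinable_var.
by apply: tdefinableX; apply: tdefinable_var.
Qed.

Lemma red_certP (K : fieldType) (P : {poly K}) D B' (c e : nat -> K) : infinite K ->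
  (size P <= D)%N -> (forall k, (k < D)%N -> c k = P`_k) ->
  red_mod P (cF d B m e) m B' <-> exists n1 n2, [/\ (0 < n1)%N, (0 < n2)%N, (n1 + n2 = m)%N &
    red_cert D n1 n2 B' c e].
Proof.
move=> infK sP Hc.
have PE y : P.[y] = \sum_(k < D) c k * y ^+ k.
  by rewrite (horner_coef_wide _ sP); apply: eq_bigr => k _; rewrite Hc.
have evid k (b : 'I_k -> K) r : ev idfun b r = r.@[b].
  by congr (meval _ _); apply/mpolyP => u; rewrite mcoeff_map_mpoly.
have pvw (x : 'I_d.+1 -> K) s (f : {poly {mpoly K[d]}}) :
    pv x s (map_poly (@mwiden d K) f) = pv (x \o @widen1 d) s f.
  rewrite /pv -map_poly_comp; congr (_.[_]); apply: eq_map_poly => p /=.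
  rewrite -evid ev_muni muni_mwiden map_polyC hornerC; exact: evid.
have atl (x : 'I_d.+1 -> K) : (at_last d P).@[x] = P.[x ord_max].
  rewrite -evid ev_muni mbackK -map_poly_comp; congr (_.[_]).
  by apply: map_poly_id => a _; apply: evC.
have pvG (x : 'I_d.+1 -> K) y n1 n2 (G1 G2 Q : {poly {mpoly K[d.+1]}}) :
    pv x y (('X^n1 + G1) * ('X^n2 + G2) + at_last d P *: Q) =
    (y ^+ n1 + pv x y G1) * (y ^+ n2 + pv x y G2) + P.[x ord_max] * pv x y Q.
  by rewrite pvD pvM !pvD !pvXn pvZ atl.
split=> [[n1 [n2 [G1 [G2 [Q [[p1 p2 Dm] [s1 s2 sQ] HB Df]]]]]]|[n1 [n2 [p1 p2 Dm [w Hw]]]]].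
  have [w1 Hw1] := gp_onto s1 (fun j => let: And3 b _ _ := HB j in b).
  have [w2 Hw2] := gp_onto s2 (fun j => let: And3 _ b _ := HB j in b).
  have [w3 Hw3] := gp_onto sQ (fun j => let: And3 _ _ b := HB j in b).
  exists n1, n2; split=> //; exists (glue (fun k => nth w3 [:: w1; w2] k)) => x.
  rewrite !slot_glue /= Hw1 Hw2 Hw3 -PE.
  have := congr1 (pv (fun i : 'I_d.+1 => x i) (x d.+1)) Df.
  by rewrite pvw pvG.
exists n1, n2, (gp d.+1 B' n1 (slot 0 w)), (gp d.+1 B' n2 (slot 1 w)), (gp d.+1 B' m.+1 (slot 2 w)).
split=> //; [by split=> //; apply: gp_size | by move=> j; split; apply: gp_bound|].
apply: pv_inj => // x s; rewrite pvw pvG.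
pose z := fcat x (fun=> s); have := Hw z.
have -> : (fun i : 'I_d.+1 => z i) = x by apply/funext => i; rewrite /z fcat_lt.
have -> : (fun i : 'I_d => z i) = x \o @widen1 d by apply/funext => i; apply: (fcat_lt x _ (widen1 i)).
have -> : z d.+1 = s by have := fcat_ge x (fun=> s) 0; rewrite addn0.
by rewrite /z (fcat_lt x _ ord_max) -PE.
Qed.

End Certificates.

(** * Generic points of hypersurfaces *)

Lemma generic_dvd (K E : fieldType) (h : {rmorphism K -> E}) d (t : 'I_d -> E) s m f
    (u : {poly {mpoly K[d]}}) : generic_root h t s m f ->
  ev2 h t s u = 0 <-> exists w, u = f * w.
Proof.
move=> [mf sf f0 Hf]; split=> [u0|[w ->]]; last by rewrite rmorphM hornerM f0 mul0r.
exists (Pdiv.Ring.rdivp u f); rewrite mulrC [LHS](Pdiv.RingMonic.rdivp_eq mf u).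
suff -> : Pdiv.Ring.rmodp u f = 0 by rewrite addr0.
apply: Hf; first by rewrite -ltnS -sf Pdiv.Ring.ltn_rmodpN0 // monic_neq0.
move: u0; rewrite {1}(Pdiv.RingMonic.rdivp_eq mf u) rmorphD rmorphM /= hornerD hornerM f0 mulr0 add0r //.
Qed.

(** Modulo X, factoring is factoring over K itself; by Gauss's lemma, a nonzero polynomial of
    smaller degree vanishing at s would yield such a factorization. *)
Lemma generic_of_irreducible (K E : fieldType) (h : {rmorphism K -> E}) d (t : 'I_d -> E) s m b
    (f : {poly {mpoly K[d]}}) : infinite K -> alg_independent h t -> f \is monic ->
  size f = m.+1 -> (forall j, (msize f`_j <= b)%N) -> ev2 h t s f = 0 ->
  ~ red_mod 'X f m (red_bound b m (size ('X : {poly K}))) -> generic_root h t s m f.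
Proof.
move=> infK it mf sf fb f0 nred; split=> // u su u0; apply/eqP; apply: contraT => nu; case: nred.
have [|g1 [g2 [m1 m2 Df s1 s2]]] := gauss_factor infK it mf nu _ f0 u0; first by rewrite sf ltnS.
have idm : map_poly (map_mpoly (idfun : {rmorphism K -> K})) f = f.
  by apply: map_poly_id => p _; apply/mpolyP => v; rewrite mcoeff_map_mpoly.
apply: (red_mod_factor (κ := idfun) (θ := 0) (g1 := g1) (g2 := g2)) => //.
- exact: monicX.
- apply: (irreducible_of_min (g := idfun) (x := 0)) => [||v v0].
  + by rewrite size_polyX.
  + by rewrite map_polyX rootX.
  + rewrite size_polyX ltnS => /size1_polyC Dv; move: v0; rewrite {1}Dv map_polyC rootC => /eqP c0.
    by rewrite Dv (c0 : v`_0 = 0) polyC0.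
- by rewrite map_polyX rootX.
- by move=> c; exists c%:P; rewrite map_polyC hornerC.
- by rewrite idm.
Qed.

Lemma generic_solution (K : fieldType) d (f : {poly {mpoly K[d]}}) : f \is monic -> (1 < size f)%N ->
  exists (E : fieldType) (h : {rmorphism K -> E}) (t : 'I_d -> E) s,
    alg_independent h t /\ ev2 h t s f = 0.
Proof.
move=> mf s1; have [E [h [t it]]] := generic_tuple K d.
have [F [g [s fs]]] : exists (F : fieldType) (g : {rmorphism E -> F}) s,
    root (map_poly g (map_poly (evr h t) f)) s.
  by apply: root_extension; rewrite size_map_monic // gtn_eqF.
exists F, (g \o h), (g \o t), s; split; first exact: indep_ext.
rewrite -[RHS](rootP fs) -map_poly_comp; congr (_.[_]); apply: eq_map_poly => p.
exact: ev_comp.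
Qed.

Section Fibre.
Variables (n d B m : nat).

(** The points x above which the hypersurface has a point s where q does not vanish and the
    quotients p_k/q satisfy [φ]; [w 0] is s and [w k.+1] the k-th quotient. *)
Definition fibre (R : signature) (φ : formula R void) (K : fieldType) (S : struct R void K)
    (x : 'I_d -> K) (e : nat -> K) :=
  exists w : nat -> K, (pv x (w 0%N) (cF d B m e) = 0 /\ (cq d B e).@[x] <> 0) /\
    ((forall k : 'I_n, (cq d B e).@[x] * w k.+1 = pv x (w 0%N) (cp d B m e k)) /\
     sat S (fcat (fun k : 'I_n => w k.+1) (cv e)) φ).

Lemma fibre_definable (R : signature) (T : theory R) (φ : formula R void) :
  definable T (fun K S v => fibre φ S (fun i => v i) (fun k => v (d + k)%N)).
Proof.
pose ρ k := (d + k).*2; apply: definable_exv; apply: definable_and; [|apply: definable_and].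
- apply: definable_and.
    apply: definable_eq; last exact: tdefinable0.
    exact: (tdefinable_F d B m ρ (fun i => i.*2) 1).
  apply: definable_not; apply: definable_eq; last exact: tdefinable0.
  exact: (tdefinable_q d B ρ (fun i => i.*2)).
- apply: definable_all_fin => k; apply: definable_eq.
    apply: tdefinableM; last exact: tdefinable_var.
    exact: (tdefinable_q d B ρ (fun i => i.*2)).
  exact: (tdefinable_p d B m ρ (fun i => i.*2) 1).
pose r x := if (x < n)%N then x.+1.*2.+1 else (d + pickle (0%N, (x - n)%N)).*2.
apply: (@definable_ext _ _ (fun K S u => sat S (u \o r) φ)); last first.
  exact: (definable_rename r (definable_sat T φ)).
move=> K S _ u; suff -> : fcat (fun k : 'I_n => vsnd u k.+1) (cv (fun k => vfst u (d + k)%N)) = u \o r by [].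
apply/funext => x; rewrite /= /r; case: ltnP => xn; first by rewrite (fcat_lt _ _ (Ordinal xn)).
by rewrite -{1}(subnKC xn) fcat_ge.
Qed.

Lemma pv_ev2 (K E : fieldType) (h : {rmorphism K -> E}) (t : 'I_d -> E) s u :
  pv t s (map_poly (map_mpoly h) u) = ev2 h t s u.
Proof. by rewrite /pv -map_poly_comp. Qed.

End Fibre.

Section Theta.
Variables (I : finType) (L : I -> signature) (n d B m : nat).
Variables (D : nat -> nat) (B' : nat -> nat) (es : seq (term void)) (w : term void).
Variables (Ne Be : term void -> nat) (Nw Bw : nat) (γ : forall i, formula (L i) void) (g : formula (sig_union L) void).

(** The parameter [e] describes a variety with regular function field on which every literal chosen
    from g holds generically, while g has no solution in the field itself. [c] contains the
    coefficients of the moduli, and [γ i] expresses the density of the fibres for the i-th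
    language. *)
Definition theta (K : fieldType) (S : struct (sig_union L) void K) (c e : nat -> K) :=
  (forall j, (j < m.+1)%N -> forall n1, (n1 < m.+1)%N -> forall n2, (n2 < m.+1)%N ->
     [&& 0 < j, 0 < n1, 0 < n2 & n1 + n2 == m]%N ->
     ~ red_cert d B m (D j) n1 n2 (B' j) (slot j c) e) /\
  ((forall t, List.In t es -> eq_cert n d B m t (Ne t) (Be t) e) /\
   ((neq_cert n d B m w Nw Bw e /\ exists x : nat -> K, (cq d B e).@[fun i : 'I_d => x i] <> 0) /\
    ((forall i, sat S e (lembed void (γ i))) /\
     ~ exists a : nat -> K, sat S (fcat (fun k : 'I_n => a k) (cv e)) g))).

Lemma definable_all_in (R : signature) (T : theory R) (P : term void -> vpred R) s :
  (forall t, definable T (P t)) -> definable T (fun K S v => forall t, List.In t s -> P t K S v).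
Proof.
move=> dP; elim: s => [|t s IH].
  by apply: definable_ext (definable_true T) => K S _ v; split.
apply: definable_ext (definable_and (dP t) IH) => K S _ v.
by split=> [[Pt H] t' /= [<- //|/H]|H]; [|split=> [|t' ts]; apply: H; [left|right]].
Qed.

Lemma theta_definable (T : theory (sig_union L)) :
  definable T (fun K S c => exists e, theta S c e).
Proof.
apply: definable_exv; apply: definable_and; [|apply: definable_and; [|apply: definable_and; [|apply: definable_and]]].
- apply: definable_all_lt => j _; apply: definable_all_lt => n1 _; apply: definable_all_lt => n2 _.
  apply: definable_imp; first exact: definable_const.
  apply: definable_not.
  exact: (red_cert_definable T d B m (D j) n1 n2 (B' j) (fun k => (pickle (j, k)).*2) (fun k => k.*2.+1)).
- apply: definable_all_in => t.
  exact: (eq_cert_definable T n d B m t (Ne t) (Be t) (fun k => k.*2.+1)).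
- apply: definable_and; first exact: (neq_cert_definable T n d B m w Nw Bw (fun k => k.*2.+1)).
  apply: definable_exv; apply: definable_not; apply: definable_eq; last exact: tdefinable0.
  exact: (tdefinable_q d B (fun k => k.*2.+1.*2) (fun i => i.*2.+1)).
- apply: definable_all_fin => i.
  exact: (definable_rename (fun k => k.*2.+1) (definable_sat T (lembed void (γ i)))).
apply: definable_not; apply: definable_exv.
pose r x := if (x < n)%N then x.*2.+1 else (pickle (0%N, (x - n)%N)).*2.+1.*2.
apply: (@definable_ext _ _ (fun K S u => sat S (u \o r) g)); last first.
  exact: (definable_rename r (definable_sat T g)).
move=> K S _ u; suff -> : fcat (fun k : 'I_n => vsnd u k) (cv (vsnd (vfst u))) = u \o r by [].
apply/funext => x; rewrite /= /r; case: ltnP => xn; first by rewrite (fcat_lt _ _ (Ordinal xn)).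
by rewrite -{1}(subnKC xn) fcat_ge.
Qed.

End Theta.

Lemma definable_elementary (R : signature) (P : vpred R) (K M : fieldType) (SK : struct R void K)
    (SM : struct R void M) (κ : {rmorphism K -> M}) c :
  definable (fun _ => False) P -> elementary SK SM κ -> P K SK c <-> P M SM (κ \o c).
Proof. by move=> [f Hf] el; rewrite -!Hf //; apply: el. Qed.

Section Ev2.
Variables (K E : fieldType) (h : {rmorphism K -> E}) (d : nat) (t : 'I_d -> E) (s : E).
Implicit Types u c w : {poly {mpoly K[d]}}.

Lemma ev2_cert u c r w : u * c = r%:P + w -> ev2 h t s w = 0 -> ev2 h t s c = 0 -> ev h t r = 0.
Proof.
move=> H w0 c0; have : ev2 h t s r%:P = 0; last by rewrite map_polyC hornerC.
by rewrite -[r%:P](addrK w) -H rmorphB /= hornerD hornerN rmorphM /= hornerM w0 c0 mulr0 subr0.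
Qed.

End Ev2.

Lemma gp_large (K : fieldType) d (u : {poly {mpoly K[d]}}) : exists B0 N0, forall B N,
  (B0 <= B)%N -> (N0 <= N)%N -> exists e, gp d B N e = u.
Proof.
exists (\max_(j < size u) msize u`_j), (size u) => B N leB leN; apply: gp_onto => // j.
have [ju|ju] := ltnP j (size u); last by rewrite nth_default ?msize0.
apply: leq_trans leB; exact: (leq_bigmax (Ordinal ju)).
Qed.

Lemma irreducible_X (K : fieldType) : irreducible_poly ('X : {poly K}).
Proof.
apply: (irreducible_of_min (g := idfun) (x := 0)) => [||v v0].
- by rewrite size_polyX.
- by rewrite map_polyX rootX.
- rewrite size_polyX ltnS => /size1_polyC Dv; move: v0; rewrite {1}Dv map_polyC rootC => /eqP c0.
  by rewrite Dv (c0 : v`_0 = 0) polyC0.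
Qed.

Lemma elementary_extension (R : signature) (K M : fieldType) (SK : struct R void K) (SM : struct R void M)
    (κ : {rmorphism K -> M}) : elementary SK SM κ -> extension SK SM κ.
Proof.
move=> el; split=> [r a|[]]; pose v x := if insub x is Some j then a j else 0.
have va (j : 'I_(arity r)) : v j = a j by rewrite /v valK.
have := el (frel (fun j : 'I_(arity r) => tvar void j)) v; rewrite /=.
have -> : (fun j : 'I_(arity r) => v j) = a by apply/funext.
by have -> : (fun j : 'I_(arity r) => κ (v j)) = (fun j => κ (a j)) by apply/funext => j; rewrite va.
Qed.

Lemma elementary_models (I : finType) (L : I -> signature) (K M : fieldType)
    (SK : struct (sig_union L) void K) (SM : struct (sig_union L) void M) (κ : {rmorphism K -> M}) i
    (Th : theory (L i)) :
  elementary SK SM κ -> models (reduct_i SK i) Th -> models (reduct_i SM i) Th.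
Proof.
move=> el mK f Tf v; have := mK f Tf (fun=> 0).
move/(sat_lembed (C := void)); rewrite (el _ _) => /(sat_lembed (C := void)).
by apply: (proj1 (sat_free _ _)) => x fx; case: (proj2_sig f x fx).
Qed.

(** * Elementary extensions of PIC fields *)

Section Crux.
Variables (I : finType) (L : I -> signature) (T T' : forall i, theory (L i)) (Itau : {set I}).
Hypothesis hlarge : forall i, large_fields_theory (@T i).
Hypothesis hQE : forall i, elim_quantifiers (@T i).
Hypothesis hH : forall i, i \in Itau -> cond_H (@T i).
Hypothesis hZ : forall i, i \notin Itau -> cond_Z (@T i).
Hypothesis hT' : forall i, i \notin Itau ->
  (forall f, univ_conseq (@T i) f -> @T' i f) /\ dcl_algebraic (@T i) (@T' i).
Variable deg : posnat -> posnat.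

(* The models considered, with the constants replaced by the polynomials     *)
(* they define.                                                              *)
Definition good (K : fieldType) (S : struct (sig_union L) void K) (P : posnat -> {poly K}) :=
  [/\ perfect_field K, PIC T S, forall i, i \notin Itau -> models (reduct_i S i) (@T' i),
    forall n, [/\ P n \is monic, irreducible_poly (P n) & size (P n) = (val (deg n)).+1] &
    forall n q, irreducible_poly q -> size q = (val n).+1 -> exists r Q, q \Po r = P n * Q].

Definition pos_of (j : nat) : posnat := exist (fun n => (0 < n)%N) j.-1.+1 isT.

(** Index 1 receives X, which turns the condition of irreducibility modulo a polynomial into
    irreducibility over the field. *)
Definition modulus (K : fieldType) (P : posnat -> {poly K}) j := if (j <= 1)%N then 'X else P (pos_of j).

Definition moduli (K : fieldType) (P : posnat -> {poly K}) : nat -> K := glue (fun j k => (modulus P j)`_k).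

Lemma modulus_good (K : fieldType) (S : struct (sig_union L) void K) P j : good S P ->
  modulus P j \is monic /\ irreducible_poly (modulus P j).
Proof.
move=> [_ _ _ HP _]; rewrite /modulus; case: ifP => _; first by rewrite monicX; split=> //; apply: irreducible_X.
by have [] := HP (pos_of j).
Qed.

Section KSide.
Variables (K : fieldType) (SK : struct (sig_union L) void K) (P : posnat -> {poly K}).
Hypothesis goodK : good SK P.
Variables (n d B m : nat) (es : seq (term void)) (w : term void) (φ : forall i, formula (L i) void).
Variables (Ne Be : term void -> nat) (Nw Bw : nat) (γ : forall i, formula (L i) void).
Variable (g : formula (sig_union L) void).
Hypothesis m0 : (0 < m)%N.
Hypothesis qg : qf g.
Hypothesis qφ : forall i, qf (φ i).
Hypothesis qγ : forall i, qf (γ i).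
Hypothesis Hγ : forall i N (S : struct (L i) void N), models S (@T i) -> forall e,
  sat S e (γ i) <-> dense (fun x => fibre n B m (φ i) S x e : Prop) (n := d).
Hypothesis Hg : forall F (SF : struct (sig_union L) void F) v, literals SF v es w φ -> sat SF v g.

(** The function field of f is regular over K because f does not factor modulo the moduli. Density
    provides, in each language, a realisation of its generic point satisfying [φ i]; together they
    make it a model of T_I where g has a solution, which descends to K as K is PIC. *)
Lemma theta_false e : ~ theta n d B m (fun j => size (modulus P j))
  (fun j => red_bound B.+1 m (size (modulus P j))) es w Ne Be Nw Bw γ g SK (moduli P) e.
Proof.
move=> [Hred [Heq [[Hneq [x0 qx0]] [Hdense nosol]]]].
have [perfK picK mT' HP HW] := goodK; have infK := PIC_infinite hlarge picK.
set f := cF d B m e; set q := cq d B e.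
have mf : f \is monic by apply: cF_monic.
have sf : size f = m.+1 by apply: cF_size.
have fb j : (msize f`_j <= B.+1)%N by apply: cF_bound.
have nq : q != 0 by apply: contra_not_neq qx0; rewrite -/q => ->; rewrite meval0.
have nred j : (0 < j <= m)%N -> ~ red_mod (modulus P j) f m (red_bound B.+1 m (size (modulus P j))).
  move=> /andP[j0 jm]; have Hc k : (k < size (modulus P j))%N -> slot j (moduli P) k = (modulus P j)`_k.
    by rewrite slot_glue.
  move/(proj1 (red_certP d B m _ e infK (leqnn _) Hc)) => [n1 [n2 [p1 p2 Dm]]].
  apply: Hred; rewrite ?ltnS //.
  - by rewrite -Dm leq_addr.
  - by rewrite -Dm leq_addl.
  - by rewrite j0 p1 p2 Dm eqxx.
have nredX := nred 1%N; rewrite /modulus /= m0 in nredX; have {}nredX := nredX isT.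
have [E [h [t [s [it fs]]]]] : exists (E : fieldType) (h : {rmorphism K -> E}) (t : 'I_d -> E) s,
    alg_independent h t /\ ev2 h t s f = 0 by apply: generic_solution; rewrite // sf ltnS.
have gr := generic_of_irreducible infK it mf sf fb fs nredX.
have ideal (E1 : fieldType) (h1 : {rmorphism K -> E1}) (t1 : 'I_d -> E1) s1 p : generic_root h1 t1 s1 m f ->
    ev h1 (snoc t1 s1) p = 0 <-> exists u, muni p = f * u.
  by move=> gr1; rewrite -(generic_dvd _ gr1) ev_muni snoc_widen snoc_max.
have pvE (E1 : fieldType) (h1 : {rmorphism K -> E1}) (t1 : 'I_d -> E1) s1 k :
    pv t1 s1 (cp d B m (h1 \o e) k) = ev2 h1 t1 s1 (cp d B m e k).
  by rewrite -pv_ev2 /cp gp_map.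
have qE (E1 : fieldType) (h1 : {rmorphism K -> E1}) (t1 : 'I_d -> E1) : (cq d B (h1 \o e)).@[t1] = ev h1 t1 q.
  by rewrite /q /cq gmp_map.
(* The density formula, being quantifier free, passes from K to a model of T_i; a generic x there
   has a point s of the hypersurface above it, with the same ideal as (t,s) by irreducibility of
   f. *)
have /choice_dep[r Hr] : forall i, exists r : realisation T SK h (snoc t s) i, exists a : 'I_n -> rN r,
    (forall k, ev (rh r) (ra r \o @widen1 d) q * a k = ev2 (rh r) (ra r \o @widen1 d) (ra r ord_max) (cp d B m e k)) /\
    sat (rS r) (fcat a (rh r \o cv e)) (φ i).
  move=> i; have [N0 [S0 [h0 [mS0 ext0]]]] := univ_model (picK.1 i).
  have [ψ [_ Hψ]] := fibre_formula (@hQE i) (fibre_definable n d B m (@T i) (φ i)).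
  have d0 : dense (fun x : 'I_d -> N0 => sat S0 (fcat x (h0 \o e)) ψ).
    have : sat S0 (h0 \o e) (γ i).
      by apply/(extension_sat e ext0 (qγ i)); have := Hdense i; rewrite sat_lembed.
    rewrite Hγ // => dx p Hp; apply: dx => x; rewrite -Hψ //; exact: Hp.
  have [N [SN [h1 [t1 [mN ext1 it1]]]]] := generic_point mS0 ext0 d0.
  rewrite Hψ // => -[w1 [[w0 wq] [wp wφ]]].
  have gr1 : generic_root h1 t1 (w1 0%N) m f.
    by apply: generic_of_irreducible infK it1 mf sf fb _ nredX; rewrite -pv_ev2 cF_map.
  exists (@Realisation I L T K SK E h d.+1 (snoc t s) i N SN h1 (snoc t1 (w1 0%N)) mN ext1
    (fun p => iff_trans (ideal _ _ _ _ p gr) (iff_sym (ideal _ _ _ _ p gr1)))).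
  exists (fun k => w1 k.+1) => /=; rewrite snoc_widen snoc_max; split=> // k.
  by rewrite -qE wp pvE.
have [κL HκL] : exists κ : {rmorphism K -> sftype (gen h (snoc t s))}, forall c, sfval _ (κ c) = h c.
  by apply: rmorph_lift => c; apply/sfvalP/gen_base.
have regL : regular_extension κL.
  apply: (function_field_regular it gr HκL (P := modulus P) (b := B.+1)) => // j /andP[j1 jm].
  have [mP irrP] := modulus_good j goodK; split=> //.
    by apply: nred; rewrite jm ltnW.
  move=> u irru _ su; rewrite /modulus leqNgt j1 /=; apply: HW => //.
  by rewrite su /=; case: j j1 {jm mP irrP su} => // -[].
have [SL [b [ψ [Hb Hec extψ ψb ψκ]]]] := function_field_ec picK r HκL regL.
pose tL := b \o @widen1 d; pose sL := b ord_max.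
have ψev i p : ψ i (ev κL tL p) = ev (rh (r i)) (ra (r i) \o @widen1 d) p.
  rewrite -ev_comp (ev_ext _ _ (h' := rh (r i))); last exact: (ψκ i).
  by congr (meval _ _); apply/funext => j; apply: ψb.
have ψev2 i u : ψ i (ev2 κL tL sL u) = ev2 (rh (r i)) (ra (r i) \o @widen1 d) (ra (r i) ord_max) u.
  rewrite -horner_map ψb -map_poly_comp; congr (_.[_]); apply: eq_map_poly => p; exact: ψev.
have sev p : sfval _ (ev κL tL p) = ev h t p.
  rewrite -ev_comp (ev_ext _ _ (h' := h)); last exact: HκL.
  congr (meval _ _); apply/funext => j.
  by rewrite /= Hb /snoc unlift_widen1.
have sev2 u : sfval _ (ev2 κL tL sL u) = ev2 h t s u.
  rewrite -horner_map Hb snoc_max -map_poly_comp; congr (_.[_]); apply: eq_map_poly => p; exact: sev.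
have qL p : p != 0 -> ev κL tL p != 0.
  by move=> np; rewrite -(fmorph_eq0 (sfval (gen h (snoc t s)))) sev; apply: contraNneq np => /it ->.
pose aL (k : 'I_n) := ev2 κL tL sL (cp d B m e k) / ev κL tL q.
have HaL k : ev κL tL q * aL k = ev2 κL tL sL (cp d B m e k) by rewrite mulrC divfK ?qL.
have fL u : ev2 κL tL sL (f * u) = 0.
  by apply: (fmorph_inj (sfval (gen h (snoc t s)))); rewrite sev2 rmorph0; apply/(generic_dvd _ gr); exists u.
have xE (x : 'I_d -> K) y : exists z : nat -> K, (fun i : 'I_d => z i) = x /\ z d = y.
  exists (fcat x (fun=> y)); split; first by apply/funext => i; rewrite fcat_lt.
  by have := fcat_ge x (fun=> y) 0; rewrite addn0.
have hatL τ : ev κL tL q ^+ (hat n q (cp d B m e) (cv e) τ).1 * teval (of_void _) (fcat aL (κL \o cv e)) τ =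
    ev2 κL tL sL (chat n d B m e τ) := hatP (cv e) (of_void _) τ HaL.
have lits : literals SL (fcat aL (κL \o cv e)) es w φ.
  split.
  - move=> τ /Heq[u Hu]; have Du : chat n d B m e τ = f * gp d (Be τ) (Ne τ) u.
      by apply: pv_inj => // x y; rewrite pvM; have [z [<- <-]] := xE x y.
    have := hatL τ; rewrite Du fL => /eqP; rewrite mulf_eq0 => /orP[|/eqP //].
    by rewrite expf_eq0 (negPf (qL _ nq)) andbF.
  - have [u [[x ux] Hu]] := Hneq; move=> w0.
    have Du : gp d Bw Nw (slot 0 u) * chat n d B m e w = (gmp d Bw (slot 2 u))%:P + f * gp d Bw Nw (slot 1 u).
      apply: pv_inj => // x' y; rewrite pvM [RHS]pvD pvC [X in _ + X]pvM.
      by have [z [<- <-]] := xE x' y.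
    have c0 : ev2 κL tL sL (chat n d B m e w) = 0 by rewrite -hatL w0 mulr0.
    have := ev2_cert Du (fL _) c0; apply/eqP/qL.
    by apply: contra_not_neq ux => ->; rewrite meval0.
  - move=> i; have [a [Ha sa]] := Hr i.
    rewrite (extension_sat _ (extψ i) (qφ i)) fcat_comp.
    have -> : ψ i \o (κL \o cv e) = rh (r i) \o cv e by apply/funext => k; apply: ψκ.
    suff -> : ψ i \o aL = a by [].
    apply/funext => k /=; have nqi : ev (rh (r i)) (ra (r i) \o @widen1 d) q != 0.
      by rewrite -ψev fmorph_eq0 qL.
    by apply: (mulfI nqi); rewrite Ha -ψev -rmorphM HaL ψev2.
have [|a Ha] := Hec g n (cv e) qg; first by exists aL; apply: Hg.
apply: nosol; exists (fcat a (fun=> 0)).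
by have -> : (fun k : 'I_n => fcat a (fun=> 0) k) = a by apply/funext => k; rewrite fcat_lt.
Qed.

End KSide.
Section MSide.
Variables (K M : fieldType) (SK : struct (sig_union L) void K) (SM : struct (sig_union L) void M).
Variables (κ : {rmorphism K -> M}) (P : posnat -> {poly K}).
Hypothesis goodK : good SK P.
Hypothesis el : elementary SK SM κ.
Hypothesis perfM : perfect_field M.
Hypothesis irrM : forall n, irreducible_poly (map_poly κ (P n)).

Lemma density_formula n d B m i (φ : formula (L i) void) : exists γ, qf γ /\
  forall N (S : struct (L i) void N), models S (@T i) -> forall e,
  sat S e γ <-> dense (fun x => fibre n B m φ S x e : Prop) (n := d).
Proof.
have dfib := fibre_definable n d B m (@T i) φ.
have [iI|iI] := boolP (i \in Itau).
  have [γ [qγ Hγ]] := definable_qf (@hQE i) (dense_definable_H (@hQE i) dfib (hH iI)).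
  by exists γ; split=> // N S mS e; apply: Hγ.
have [γ [qγ Hγ]] := definable_qf (@hQE i) (dense_definable_Z (@hQE i) dfib (hZ iI)).
by exists γ; split=> // N S mS e; apply: Hγ.
Qed.

(** For i outside I_tau, T'_i controls the definable closure of M directly. For i in I_tau, it is
    the definable closure of the PIC field K that is controlled, and the parameters from M are dealt
    with by [generic_dense_H]. *)
Lemma fibre_dense n d B m i (φ : formula (L i) void) (N : fieldType) (SN : struct (L i) void N)
    (h : {rmorphism M -> N}) (t : 'I_d -> N) (e : nat -> M) :
  models SN (@T i) -> extension (reduct_i SM i) SN h -> alg_independent h t ->
  fibre n B m φ SN t (h \o e) -> dense (fun x => fibre n B m φ SN x (h \o e) : Prop) (n := d).
Proof.
move=> mN ext it Yt; have [perfK picK _ _ _] := goodK; have dfib := fibre_definable n d B m (@T i) φ.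
have [iI|iI] := boolP (i \in Itau).
  apply: (generic_dense_H (@hQE i) (hH iI) dfib (κ := κ)) it Yt => // x.
  apply: (dcl_PIC hlarge picK) mN _; have [r0 c0] := elementary_extension el.
  have [r1 c1] := ext; split=> [s a|[]].
  exact: (iff_trans (r0 (Tagged (fun i => rsym (L i)) s) a) (r1 s (fun j => κ (a j)))).
apply: (dense_of_generic (@hQE i) dfib) Yt it => // x.
have [_ dclT'] := hT' iI; apply: (dclT' M (reduct_i SM i)) => //.
by apply: elementary_models el _; have [_ _ HT' _ _] := goodK; apply: HT'.
Qed.

(** A regular extension F where g has a solution, while M has none, yields coefficients in M
    satisfying [theta]; by elementarity there are some in K, contrary to [theta_false]. *)
Theorem elementary_PIC : PIC T SM.
Proof.
have [perfK picK mT' HP HW] := goodK; have infK := PIC_infinite hlarge picK.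
have infM := infinite_extension κ infK.
split=> [i|F SF h extF mF regF]; first by apply: elementary_models el (picK.1 i).
apply/exist_closed_ec => g n v qg [a Ha]; apply: contrapT => nosol.
have [es [w [φ [qφ lit Hlit]]]] := decompose SF (fcat a (h \o v)) qg.
have [d [t [s [m [f [[it gr Hrep] Hgen]]]]]] := normal_form h a perfM infM.
have [mf sf f0 Hf] := gr.
have m0 : (0 < m)%N.
  rewrite lt0n; apply/eqP => m0; have /size1_polyC Df : (size f <= 1)%N by rewrite sf m0.
  move: f0 (monicP mf); rewrite lead_coefE sf m0 Df coefC /= => + f1; rewrite f1 rmorph1 hornerC => /eqP.
  by rewrite oner_eq0.
have /choice[qp Hqp] : forall k : 'I_n, exists qp, ev h t qp.1 != 0 /\ ev h t qp.1 * a k = ev2 h t s qp.2.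
  by move=> k; have [q [p [nq Hq]]] := Hrep _ (Hgen k); exists (q, p).
(* A common denominator for all coordinates; the numerators are then reduced modulo f. *)
pose q := \prod_k (qp k).1.
have nq : ev h t q != 0.
  rewrite -[ev _ _ _]/(evr h t q) rmorph_prod; apply/prodf_neq0 => k _; exact: (Hqp k).1.
have /choice[p Hp] : forall k, exists p : {poly {mpoly M[d]}}, (size p <= m)%N /\ ev2 h t s p = ev h t q * a k.
  move=> k; pose q' := \prod_(i | i != k) (qp i).1.
  have [r [sr Hr]] := ev2_mod (q'%:P * (qp k).2) mf sf f0; exists r; split=> //.
  rewrite Hr rmorphM /= hornerM map_polyC hornerC -(Hqp k).2 /q (bigD1 k) //= evM.
  by rewrite -[RHS]mulrA; apply: mulrCA.
pose Bf := \max_(j < m) msize f`_j; pose Bp := \max_k \max_(j < m) msize (p k)`_j.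
pose B := maxn (msize q) (maxn Bf Bp).
have [eq Heq] : exists e, gmp d B e = q by apply: gmp_onto; apply: leq_maxl.
have [ef Hef] : exists e, gp d B m e = \poly_(k < m) f`_k.
  apply: gp_onto; first exact: size_poly.
  move=> j; rewrite coef_poly; case: ltnP => jm; last by rewrite msize0.
  rewrite !leq_max; apply/orP; right; apply/orP; left; exact: (leq_bigmax (Ordinal jm)).
have /choice[ep Hep] : forall k, exists e, gp d B m e = p k.
  move=> k; apply: gp_onto; first exact: (Hp k).1.
  move=> j; have [jm|jm] := ltnP j m; last by rewrite nth_default ?msize0 // (leq_trans (Hp k).1).
  rewrite !leq_max; apply/orP; right; apply/orP; right; apply: leq_trans (leq_bigmax k).
  exact: (leq_bigmax (Ordinal jm)).
(* The slots follow the layout read by [cv], [cF], [cq] and [cp]; of f, only the part below its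
   leading term is stored. *)
pose e := glue (fun l => match l with
  | 0%N => v | 1%N => ef | 2%N => eq | k.+3 => if insub k is Some k' then ep k' else fun=> 0 end).
have cvE : cv e = v by rewrite /cv slot_glue.
have cqE : cq d B e = q by rewrite /cq slot_glue.
have cFE : cF d B m e = f.
  by rewrite /cF slot_glue Hef [RHS](monic_top mf) sf.
have cpE (k : 'I_n) : cp d B m e k = p k by rewrite /cp slot_glue valK.
have Hcp (k : 'I_n) : ev h t q * a k = ev2 h t s (cp d B m e k) by rewrite cpE (Hp k).2.
have hatE τ : ev h t q ^+ (hat n q (cp d B m e) v τ).1 * teval (of_void F) (fcat a (h \o v)) τ =
    ev2 h t s (chat n d B m e τ) by rewrite /chat cqE cvE; apply: hatP.
have [lit_es lit_w lit_φ] := lit.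
have /choice[NB HNB] : forall τ, exists NB, List.In τ es -> eq_cert n d B m τ NB.1 NB.2 e.
  move=> τ; have [ts|nts] := pselect (List.In τ es); last by exists (0%N, 0%N) => /nts.
  have : ev2 h t s (chat n d B m e τ) = 0 by rewrite -hatE lit_es // mulr0.
  move=> /(generic_dvd _ gr)[u Du]; pose B' := \max_(j < size u) msize u`_j.
  have [wu Hu] : exists wu, gp d B' (size u) wu = u.
    apply: gp_onto => // j; have [ju|ju] := ltnP j (size u); last by rewrite nth_default ?msize0.
    exact: (leq_bigmax (Ordinal ju)).
  by exists (size u, B') => _; exists wu => x; rewrite Hu cFE Du pvM.
(* The value of the numerator is invertible in M(t,s); writing its inverse with a denominator in
   M[t] gives the certificate. *)
have [Nw [Bw Hw]] : exists Nw Bw, neq_cert n d B m w Nw Bw e.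
  set c := chat n d B m e w.
  have nc : ev2 h t s c != 0 by rewrite -hatE mulf_neq0 ?expf_neq0 //; apply/eqP.
  have genc : gen h (snoc t s) (ev2 h t s c).
    have <- : ev h (snoc t s) (mback c) = ev2 h t s c by rewrite ev_muni mbackK snoc_widen snoc_max.
    exact: gen_ev.
  have [r [u [nr Hu]]] := Hrep _ (sfmem_div (sfmem1 _) genc).
  have /(generic_dvd _ gr)[u' Du] : ev2 h t s (u * c - r%:P) = 0.
    have hc : ev2 h t s r%:P = ev h t r by rewrite map_polyC hornerC.
    by rewrite rmorphB rmorphM /= hornerD hornerN hornerM -Hu hc div1r mulfVK // subrr.
  have {}Du : u * c = r%:P + f * u' by rewrite -Du addrC subrK.
  have [B1 [N1 H1]] := gp_large u; have [B2 [N2 H2]] := gp_large u'.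
  pose B' := maxn (msize r) (maxn B1 B2); pose N' := maxn N1 N2.
  have le1 : (B1 <= B')%N by rewrite !leq_max leqnn orbT.
  have le2 : (B2 <= B')%N by rewrite !leq_max leqnn !orbT.
  have [wu Hwu] := H1 B' N' le1 (leq_maxl _ _); have [wu' Hwu'] := H2 B' N' le2 (leq_maxr _ _).
  have [wr Hwr] : exists wr, gmp d B' wr = r by apply: gmp_onto; apply: leq_maxl.
  exists N', B', (glue (fun k => nth wr [:: wu; wu'] k)); rewrite !slot_glue /= Hwu Hwu' Hwr cFE.
  have nr0 : r != 0 by apply: contraNneq nr => ->; rewrite ev0.
  split; last by move=> x; rewrite -!pvM -/c Du pvD pvC.
  have [x nx] := mpoly_infinite_neq infM nr0; exists (fcat x (fun=> 0)).
  have -> : (fun i : 'I_d => fcat x (fun=> 0) i) = x by apply/funext => i; rewrite fcat_lt.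
  exact/eqP.
have /choice_dep[γ Hγ] : forall i, exists γ, qf γ /\ forall N (S : struct (L i) void N),
    models S (@T i) -> forall e, sat S e γ <-> dense (fun x => fibre n B m (φ i) S x e : Prop) (n := d).
  by move=> i; apply: density_formula.
have Hg F' (SF' : struct (sig_union L) void F') v' : literals SF' v' es w φ -> sat SF' v' g.
  by move=> /Hlit <-.
(* The only parameters left are the moduli, which come from K; the existence of [e] therefore
   transfers to K. *)
suff : exists e, theta n d B m (fun j => size (modulus P j))
    (fun j => red_bound B.+1 m (size (modulus P j))) es w (fun τ => (NB τ).1) (fun τ => (NB τ).2)
    Nw Bw γ g SM (κ \o moduli P) e.
  move/(definable_elementary _ (theta_definable _ _ _ _ _ _ _ _ _ _ _ _ _ _ _) el) => [e'].
  apply: (theta_false goodK m0 qg qφ (fun i => (Hγ i).1) (fun i => (Hγ i).2) Hg).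
exists e; split; [|split; [exact: HNB|split; [split=> //|split]]].
- move=> j jm n1 _ n2 _ /and4P[j0 p1 p2 /eqP Dm] Hc.
  have irrj : irreducible_poly (map_poly κ (modulus P j)).
    by rewrite /modulus; case: ifP => _; [rewrite map_polyX; apply: irreducible_X | apply: irrM].
  have Hcj k : (k < size (modulus P j))%N -> slot j (κ \o moduli P) k = (map_poly κ (modulus P j))`_k.
    move=> _; rewrite coef_map; apply: (congr1 κ).
    by have := congr1 (fun c : nat -> K => c k) (slot_glue (fun j k => (modulus P j)`_k) j).
  have sj : (size (map_poly κ (modulus P j)) <= size (modulus P j))%N by rewrite size_map_poly.
  apply: (regular_not_red_mod regF gr irrj (B := red_bound B.+1 m (size (modulus P j)))).
  by rewrite -cFE; apply/(red_certP d B m _ e infM sj Hcj); exists n1, n2.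
- have nq0 : q != 0 by apply: contraNneq nq => ->; rewrite ev0.
  have [x nx] := mpoly_infinite_neq infM nq0; exists (fcat x (fun=> 0)); rewrite cqE.
  have -> : (fun i : 'I_d => fcat x (fun=> 0) i) = x by apply/funext => i; rewrite fcat_lt.
  exact/eqP.
(* F embeds into a model of T_i, where t stays independent over M and belongs to the fibre set by
   means of s and a; so that set is dense. *)
- move=> i; apply/sat_lembed; have [N [SN [h' [mN ext']]]] := univ_model (mF i).
  have extM : extension (reduct_i SM i) SN (h' \o h).
    have [r0 _] := extF; have [r1 _] := ext'; split=> [s' b|[]].
    exact: (iff_trans (r0 (Tagged (fun i => rsym (L i)) s') b) (r1 s' (fun j => h (b j)))).
  apply/(extension_sat e extM (Hγ i).1)/((Hγ i).2 _ _ mN).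
  apply: (@fibre_dense n d B m i (φ i) N SN _ (h' \o t) e mN extM (indep_ext it)).
  have pvE u : pv (h' \o t) (h' s) (map_poly (map_mpoly (h' \o h)) u) = h' (ev2 h t s u).
    rewrite /pv -map_poly_comp -horner_map -map_poly_comp; congr (_.[_]); apply: eq_map_poly => r.
    exact: ev_comp.
  exists (fun k => if k is k'.+1 then (if insub k' is Some j then h' (a j) else 0) else h' s); split; [split|split].
  + by rewrite -cF_map cFE pvE f0 rmorph0.
  + rewrite /cq -[slot 2 _]/((h' \o h) \o slot 2 e) -gmp_map -/(cq d B e) cqE.
    move=> q0; move/eqP: nq; case; apply: (fmorph_inj h'); rewrite rmorph0 -[RHS]q0.
    by symmetry; apply: ev_comp.
  + move=> k; rewrite /cq /cp -[slot 2 _]/((h' \o h) \o slot 2 e) -gmp_map -/(cq d B e) cqE.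
    rewrite -[slot k.+3 _]/((h' \o h) \o slot k.+3 e) -gp_map pvE -/(cp d B m e k) -Hcp rmorphM valK.
    by congr (_ * _); apply: ev_comp.
  + have := lit_φ i; rewrite (extension_sat _ ext' (qφ i)) fcat_comp.
    have -> : (fun k : 'I_n => (if insub (k : nat) is Some j then h' (a j) else 0)) = h' \o a.
      by apply/funext => k; rewrite valK.
    by rewrite -cvE.
- by move=> [a' Ha']; apply: nosol; exists (fun k => a' k); rewrite -cvE.
Qed.

End MSide.
End Crux.

(** * First-order form of the conditions on the moduli *)

Lemma irreducible_separable (K : fieldType) (q : {poly K}) :
  perfect_field K -> irreducible_poly q -> separable_poly q.
Proof.
move=> perfK irr; have [E [g [x qx]]] : exists (E : fieldType) (g : {rmorphism K -> E}) x, root (map_poly g q) x.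
  by apply: root_extension; rewrite gtn_eqF // irr.1.
have algx : algebraicOver g x by exists q; rewrite ?irredp_neq0.
have [m [mm mi mx Hm]] := minimal_polynomial algx.
have [s [seps sx]] := perfect_separable_root perfK algx.
have mq : m %= q by apply: irr.2; [rewrite gtn_eqF // mi.1 | apply: Hm].
by rewrite -(eqp_separable mq); apply: dvdp_separable (Hm _ sx) seps.
Qed.

Definition pnat (K : fieldType) N (c : nat -> K) : {poly K} := \poly_(k < N) c k.

Lemma pnat_horner (K : fieldType) N (c : nat -> K) x : (pnat N c).[x] = \sum_(k < N) c k * x ^+ k.
Proof.
rewrite (horner_coef_wide _ (size_poly _ _)); apply: eq_bigr => k _.
by rewrite coef_poly ltn_ord.
Qed.

Lemma pnat_onto (K : fieldType) N (p : {poly K}) : (size p <= N)%N -> exists c, pnat N c = p.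
Proof.
move=> pN; exists (fun k => p`_k); apply/polyP => k; rewrite coef_poly; case: ltnP => // Nk.
by rewrite nth_default // (leq_trans pN).
Qed.

Lemma poly_pointwise (K : fieldType) (p q : {poly K}) : infinite K -> (forall x, p.[x] = q.[x]) -> p = q.
Proof.
move=> infK H; apply/eqP; rewrite -subr_eq0; apply/eqP.
by apply: (poly_infinite (h := id) _ infK) => // x; rewrite hornerD hornerN H subrr.
Qed.

Definition factor_cert n1 n2 (K : fieldType) (c : nat -> K) := exists w : nat -> K, forall x : nat -> K,
  x 0%N ^+ (n1 + n2) + \sum_(k < n1 + n2) c k * x 0%N ^+ k =
  (x 0%N ^+ n1 + \sum_(k < n1) slot 0 w k * x 0%N ^+ k) * (x 0%N ^+ n2 + \sum_(k < n2) slot 1 w k * x 0%N ^+ k).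

Lemma size_top (K : fieldType) n (p : {poly K}) : (size p <= n)%N -> size ('X^n + p) = n.+1.
Proof. by move=> pn; rewrite size_polyDl size_polyXn. Qed.

Lemma factor_certP (K : fieldType) n1 n2 (c : nat -> K) : infinite K ->
  factor_cert n1 n2 c <-> exists G1 G2 : {poly K}, [/\ (size G1 <= n1)%N, (size G2 <= n2)%N &
    'X^(n1 + n2) + pnat (n1 + n2) c = ('X^n1 + G1) * ('X^n2 + G2)].
Proof.
move=> infK; split=> [[w Hw]|[G1 [G2 [s1 s2 D]]]].
  exists (pnat n1 (slot 0 w)), (pnat n2 (slot 1 w)); split; try exact: size_poly.
  apply: poly_pointwise => // x; rewrite hornerM !hornerD !hornerXn !pnat_horner.
  exact: (Hw (fun=> x)).
have [c1 H1] := pnat_onto s1; have [c2 H2] := pnat_onto s2.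
exists (glue (fun k => nth c2 [:: c1] k)) => x; rewrite !slot_glue /=.
have := congr1 (fun p : {poly K} => p.[x 0%N]) D.
by rewrite hornerM !hornerD !hornerXn -H1 -H2 !pnat_horner.
Qed.

Lemma irreducible_certP (K : fieldType) n (c : nat -> K) : infinite K -> (0 < n)%N ->
  irreducible_poly ('X^n + pnat n c) <->
  forall n1, (n1 < n.+1)%N -> forall n2, (n2 < n.+1)%N -> [&& 0 < n1, 0 < n2 & n1 + n2 == n]%N ->
    ~ factor_cert n1 n2 c.
Proof.
move=> infK n0; set p := _ + _; have sp : size p = n.+1 by rewrite size_top // size_poly.
have mp : p \is monic.
  by rewrite monicE lead_coefE sp coefD coefXn eqxx coef_poly ltnn addr0.
split=> [irr n1 _ n2 _ /and3P[p1 p2 /eqP Dn]|H].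
  rewrite -Dn in p sp mp irr *.
  move/(factor_certP _ _ _ infK) => [G1 [G2 [s1 s2 D]]].
  have : ('X^n1 + G1) %| p by rewrite /p D dvdp_mulr.
  move/(irr.2 _ _); rewrite size_top // => /(_ _)/eqp_size; rewrite size_top // sp => H.
  have /eqP : n1.+1 = (n1 + n2).+1 by apply: H; rewrite eqSS -lt0n.
  by rewrite eqSS -{1}[n1]addn0 eqn_add2l eq_sym -leqn0 leqNgt p2.
split=> [|q sq /dvdpP[r D]]; first by rewrite sp.
have nq : q != 0 by apply: contraNneq (monic_neq0 mp) => q0; rewrite D q0 mulr0.
have nr : r != 0 by apply: contraNneq (monic_neq0 mp) => r0; rewrite D r0 mul0r.
have [/eqP/size_poly1P[a na Da]|sr] := eqVneq (size r) 1%N.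
  by rewrite D Da mul_polyC eqp_sym eqp_scale.
have lq : lead_coef q != 0 by rewrite lead_coef_eq0.
pose q1 := (lead_coef q)^-1 *: q; pose r1 := lead_coef q *: r.
have D1 : p = r1 * q1 by rewrite /r1 /q1 -scalerAl -scalerAr scalerA mulfV // scale1r.
have mq1 : q1 \is monic by rewrite monicE lead_coefZ mulVf.
have mr1 : r1 \is monic by rewrite monicE -(lead_coef_Mmonic r1 mq1) -D1 -monicE.
have sq1 : (1 < size q1)%N by rewrite size_scale ?invr_eq0 // ltn_neqAle eq_sym sq size_poly_gt0.
have sr1 : (1 < size r1)%N by rewrite size_scale // ltn_neqAle eq_sym sr size_poly_gt0.
have Dn : ((size r1).-1 + (size q1).-1)%N = n.
  by move: sp sq1 sr1; rewrite D1 size_Mmonic ?monic_neq0 //; move: (size _) (size _) => x y; lia.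
case: (H (size r1).-1 _ (size q1).-1 _ _).
- by rewrite ltnS -Dn leq_addr.
- by rewrite ltnS -Dn leq_addl.
- by rewrite Dn eqxx !ltn_predRL sq1 sr1.
apply/factor_certP => //; exists (\poly_(k < (size r1).-1) r1`_k), (\poly_(k < (size q1).-1) q1`_k).
by split; try exact: size_poly; rewrite Dn -monic_top // -monic_top // -D1.
Qed.

Lemma dvdp_comp_sub (K : fieldType) (P q r r' : {poly K}) : P %| r - r' -> P %| (q \Po r) - (q \Po r').
Proof.
move=> Pr; elim/poly_ind: q => [|q c IH]; first by rewrite !comp_poly0 subrr; apply: dvdp0.
rewrite !comp_poly_MXaddC.
have -> : (q \Po r) * r + c%:P - ((q \Po r') * r' + c%:P) =
    ((q \Po r) - (q \Po r')) * r + (q \Po r') * (r - r').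
  by move: (q \Po r) (q \Po r') c%:P => x y z; ring.
by apply: dvdp_add; [apply: dvdp_mulr | apply: dvdp_mull].
Qed.

(* Every monic irreducible polynomial of degree [n] acquires a root modulo   *)
(* the monic polynomial with lower coefficients [c 0, ..., c (D - 1)].       *)
Definition root_cert n D (K : fieldType) (c : nat -> K) := forall w : nat -> K,
  (forall n1, (n1 < n.+1)%N -> forall n2, (n2 < n.+1)%N -> [&& 0 < n1, 0 < n2 & n1 + n2 == n]%N ->
    ~ factor_cert n1 n2 w) ->
  exists u : nat -> K, forall x : nat -> K,
    let y := \sum_(k < D) slot 0 u k * x 0%N ^+ k in
    y ^+ n + \sum_(k < n) w k * y ^+ k =
    (x 0%N ^+ D + \sum_(k < D) c k * x 0%N ^+ k) * \sum_(k < (n * D).+1) slot 1 u k * x 0%N ^+ k.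

Lemma root_certP (K : fieldType) n D (c : nat -> K) : infinite K -> (0 < n)%N -> (0 < D)%N ->
  root_cert n D c <-> forall q, irreducible_poly q -> size q = n.+1 ->
    exists r Q, q \Po r = ('X^D + pnat D c) * Q.
Proof.
move=> infK n0 D0; set P := _ + _; have sP : size P = D.+1 by rewrite size_top // size_poly.
split=> [H q irr sq|H w irr].
  have nl : lead_coef q != 0 by rewrite lead_coef_eq0 irredp_neq0.
  pose q1 := (lead_coef q)^-1 *: q.
  have Dq : q = lead_coef q *: q1 by rewrite scalerA mulfV // scale1r.
  have mq1 : q1 \is monic by rewrite monicE lead_coefZ mulVf.
  have sq1 : size q1 = n.+1 by rewrite size_scale ?invr_eq0.
  have [w Hw] : exists w, pnat n w = \poly_(k < n) q1`_k by apply: pnat_onto; apply: size_poly.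
  have Dq1 : q1 = 'X^n + pnat n w by rewrite Hw [LHS](monic_top mq1) sq1.
  have irr1 : irreducible_poly ('X^n + pnat n w).
    rewrite -Dq1; split; first by rewrite sq1.
    move=> s ss /dvdpP[s' Ds]; have : s %= q.
      by apply: irr.2 => //; rewrite Dq dvdpZr // Ds dvdp_mull.
    by move=> /eqp_trans; apply; rewrite eqp_sym eqp_scale ?invr_eq0.
  have [u Hu] := H w (proj1 (irreducible_certP w infK n0) irr1).
  exists (pnat D (slot 0 u)), (lead_coef q *: pnat (n * D).+1 (slot 1 u)).
  rewrite [X in X \Po _]Dq comp_polyZ -scalerAr; congr (_ *: _).
  rewrite Dq1; apply: poly_pointwise => // x.
  rewrite horner_comp hornerM !hornerD !hornerXn !pnat_horner.
  exact: (Hu (fun=> x)).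
have [r [Q HQ]] := H _ (proj2 (irreducible_certP w infK n0) irr) (size_top (size_poly _ _)).
set q := 'X^n + pnat n w in HQ; have sq : size q = n.+1 by rewrite size_top // size_poly.
have nP : P != 0 by rewrite -size_poly_eq0 sP.
(* Reducing r modulo P bounds its degree, and that of the quotient, in terms of n and D, as the
   certificate requires. *)
have : P %| q \Po (r %% P).
  rewrite -(subKr (q \Po r) (q \Po _)) dvdp_sub //; first by rewrite HQ dvdp_mulr.
  by apply: dvdp_comp_sub; rewrite {1}(divp_eq r P) addrK dvdp_mull.
move=> /dvdpP[Q' HQ'].
have sr : (size (r %% P)%R <= D)%N by rewrite -ltnS -sP ltn_modp.
have [u0 Hu0] := pnat_onto sr.
have sQ' : (size Q' <= (n * D).+1)%N.
  have [->|nQ'] := eqVneq Q' 0; first by rewrite size_poly0.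
  have := size_comp_poly_leq q (r %% P); rewrite HQ' size_mul // sP sq /= addnS /=.
  have : (n * (size (r %% P)%R).-1 <= n * D)%N by rewrite leq_mul2l (leq_trans (leq_pred _) sr) orbT.
  by move: (size Q') (n * D)%N (n * _)%N => x y z; lia.
have [u1 Hu1] := pnat_onto sQ'.
exists (glue (fun k => nth u1 [:: u0] k)) => x; rewrite !slot_glue /=.
have := congr1 (fun p : {poly K} => p.[x 0%N]) HQ'.
by rewrite horner_comp mulrC hornerM !hornerD !hornerXn -Hu0 -Hu1 !pnat_horner.
Qed.

Lemma tdefinable_psum N (x : nat) (c : nat -> nat) :
  tdefinable (fun K v => \sum_(k < N) v (c k) * v x ^+ k).
Proof.
apply: tdefinable_sum => k; apply: tdefinableM; first exact: tdefinable_var.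
by apply: tdefinableX; apply: tdefinable_var.
Qed.

Section CertDefinable.
Variables (R : signature) (T : theory R).

Lemma perfect_definable p : definable T (fun K S v => forall x : nat -> K, exists y : nat -> K, y 0%N ^+ p = x 0%N).
Proof.
apply: definable_allv; apply: definable_exv; apply: definable_eq; last exact: tdefinable_var.
by apply: tdefinableX; apply: tdefinable_var.
Qed.

Lemma factor_cert_definable n1 n2 ρ : definable T (fun K S v => factor_cert n1 n2 (v \o ρ)).
Proof.
apply: definable_exv; apply: definable_allv; apply: definable_eq.
  apply: tdefinableD; first by apply: tdefinableX; apply: (tdefinable_var 1).
  exact: (tdefinable_psum _ 1 (fun k => (ρ k).*2.*2)).
apply: tdefinableM; (apply: tdefinableD; first by apply: tdefinableX; apply: (tdefinable_var 1)).
  exact: (tdefinable_psum _ 1 (fun k => (pickle (0%N, k)).*2.+1.*2)).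
exact: (tdefinable_psum _ 1 (fun k => (pickle (1%N, k)).*2.+1.*2)).
Qed.

Lemma irreducible_cert_definable n ρ : definable T (fun K S v =>
  forall n1, (n1 < n.+1)%N -> forall n2, (n2 < n.+1)%N -> [&& 0 < n1, 0 < n2 & n1 + n2 == n]%N ->
    ~ factor_cert n1 n2 (v \o ρ)).
Proof.
apply: definable_all_lt => n1 _; apply: definable_all_lt => n2 _.
apply: definable_imp; first exact: definable_const.
by apply: definable_not; apply: factor_cert_definable.
Qed.

Lemma root_cert_definable n D : definable T (fun K S v => root_cert n D v).
Proof.
apply: definable_allv; apply: definable_imp; first exact: (irreducible_cert_definable n (fun k => k.*2.+1)).
apply: definable_exv; apply: definable_allv.
have dy : tdefinable (fun K v => \sum_(k < D) v (pickle (0%N, k : nat)).*2.+1.*2 * v 1%N ^+ k).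
  exact: (tdefinable_psum D 1 (fun k => (pickle (0%N, k)).*2.+1.*2)).
apply: definable_eq.
  apply: tdefinableD; first exact: (tdefinableX n dy).
  apply: tdefinable_sum => k; apply: tdefinableM; first exact: (tdefinable_var (k : nat).*2.+1.*2.*2).
  exact: (tdefinableX k dy).
apply: tdefinableM; last exact: (tdefinable_psum (n * D).+1 1 (fun k => (pickle (1%N, k)).*2.+1.*2)).
apply: tdefinableD; first by apply: tdefinableX; apply: (tdefinable_var 1).
exact: (tdefinable_psum D 1 (fun k => k.*2.*2.*2)).
Qed.

End CertDefinable.

(** * Model completeness *)

Section Final.
Variables (I : finType) (L : I -> signature) (T T' : forall i, theory (L i)) (Itau : {set I}).
Hypothesis hlarge : forall i, large_fields_theory (@T i).
Hypothesis hQE : forall i, elim_quantifiers (@T i).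
Hypothesis hH : forall i, i \in Itau -> cond_H (@T i).
Hypothesis hZ : forall i, i \notin Itau -> cond_Z (@T i).
Hypothesis hT' : forall i, i \notin Itau ->
  (forall f, univ_conseq (@T i) f -> @T' i f) /\ dcl_algebraic (@T i) (@T' i).
Variable deg : posnat -> posnat.
Notation good := (good T T' Itau deg).

Lemma good_infinite (K : fieldType) (S : struct (sig_union L) void K) P : good S P -> infinite K.
Proof. by move=> [_ picK _ _ _]; exact: (PIC_infinite hlarge picK). Qed.

Lemma monic_pnat (K : fieldType) (p : {poly K}) D : p \is monic -> size p = D.+1 ->
  p = 'X^D + pnat D (fun k => p`_k).
Proof. by move=> mp sp; rewrite {1}(monic_top mp) sp. Qed.

(** Perfectness, irreducibility of the moduli and the existence of roots modulo them are definable
    conditions, and the theories T'_i consist of sentences. PIC is provided by [elementary_PIC]. *)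
Lemma good_elementary (K M : fieldType) (SK : struct (sig_union L) void K) (SM : struct (sig_union L) void M)
    (κ : {rmorphism K -> M}) P : good SK P -> elementary SK SM κ -> good SM (fun n => map_poly κ (P n)).
Proof.
move=> gK el; have infK := good_infinite gK; have infM := infinite_extension κ infK.
have [perfK picK mT' HP HW] := gK.
have perfM : perfect_field M.
  move=> p; rewrite (fmorph_pchar κ) => pK x.
  have [HK|y Hy] := proj1 (definable_elementary (fun=> 0) (perfect_definable _ p) el) _ (fun=> x).
    by have [y Hy] := perfK p pK (HK 0%N); exists (fun=> y).
  by exists (y 0%N).
have DM n : map_poly κ (P n) = 'X^(val (deg n)) + pnat (val (deg n)) (κ \o (fun k => (P n)`_k)).
  have [mP _ sP] := HP n; rewrite {1}(monic_pnat mP sP) rmorphD /= map_polyXn; congr (_ + _).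
  by apply/polyP => k; rewrite coef_map !coef_poly; case: ifP => _ //=; apply: rmorph0.
have irrM n : irreducible_poly (map_poly κ (P n)).
  have [mP irrP sP] := HP n; rewrite DM; apply/irreducible_certP => //; first exact: (valP (deg n)).
  apply/(definable_elementary _ (irreducible_cert_definable _ (val (deg n)) id) el).
  apply/irreducible_certP => //; first exact: (valP (deg n)).
  by rewrite -[_ + _](monic_pnat mP sP).
have mTM i : i \notin Itau -> models (reduct_i SM i) (@T' i).
  by move=> iI; apply: elementary_models el (mT' i iI).
split=> //.
- exact: (elementary_PIC hlarge hQE hH hZ hT' gK el perfM irrM).
- move=> n; have [mP irrP sP] := HP n; split=> //; first by rewrite monic_map.
  by rewrite size_map_poly.
move=> n q; rewrite DM; move: q; apply/root_certP => //; [exact: (valP n)|exact: (valP (deg n))|].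
apply/(definable_elementary _ (root_cert_definable _ (val n) (val (deg n))) el).
apply/root_certP => //; [exact: (valP n)|exact: (valP (deg n))|].
have [mP irrP sP] := HP n; rewrite -(monic_pnat mP sP); exact: HW.
Qed.

(** An element algebraic over K, of degree n, has its minimal polynomial acquiring a root modulo
    P_n; as P_n stays irreducible over M, the element lies in K. *)
Lemma good_regular (K M : fieldType) (SK : struct (sig_union L) void K) (h : {rmorphism K -> M}) P :
  good SK P -> (forall n, irreducible_poly (map_poly h (P n))) -> regular_extension h.
Proof.
move=> gK irrM; have infK := good_infinite gK; have [perfK picK _ HP HW] := gK.
apply: regular_of_closed => // x algx; have [q [mq irrq qx _]] := minimal_polynomial algx.
have s1 := irrq.1; have p0 : (0 < (size q).-1)%N by rewrite ltn_predRL.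
have [r [Q Dr]] := HW (exist (fun n : nat => (0 < n)%N) _ p0) q irrq (esym (ltn_predK s1)).
exact: closed_of_root (irrM _) irrq Dr qx.
Qed.

Lemma upd_map (K M : Type) (h : K -> M) (v : nat -> K) x a : h \o upd v x a = upd (h \o v) x (h a).
Proof. by apply/funext => y; rewrite /upd /=; case: eqP. Qed.

(** The extension is regular, so the PIC field A is existentially closed in B and B embeds in an
    elementary extension of A, which is good. *)
Lemma good_above (A B : fieldType) (SA : struct (sig_union L) void A) (SB : struct (sig_union L) void B)
    (h : {rmorphism A -> B}) P :
  good SA P -> good SB (fun n => map_poly h (P n)) -> extension SA SB h ->
  exists (N : fieldType) (SN : struct (sig_union L) void N) (k : {rmorphism B -> N}),
    [/\ extension SB SN k, elementary SA SN (k \o h) &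
      good SN (fun n => map_poly k (map_poly h (P n)))].
Proof.
move=> gA gB ext; have [_ picA _ _ _] := gA; have [_ picB _ HPB _] := gB.
have regh : regular_extension h by apply: (good_regular gA) => n; have [] := HPB n.
have ecAB : ec SA SB h by apply/exist_closed_ec; apply: picA.2 => //; exact: picB.1.
have [N [SN [k [extk elk]]]] := ec_embed ecAB; exists N, SN, k; split=> //.
have -> : (fun n => map_poly k (map_poly h (P n))) = (fun n => map_poly (k \o h) (P n)).
  by apply/funext => n; rewrite map_poly_comp.
exact: good_elementary gA elk.
Qed.

(** Induction on the formula, for all good extensions simultaneously: a quantifier is tested in some
    N above B that is elementary over A, and the induction hypothesis for B <= N brings the instance
    back to B. *)
Theorem good_extension_elementary (A B : fieldType) (SA : struct (sig_union L) void A)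
    (SB : struct (sig_union L) void B) (h : {rmorphism A -> B}) P :
  good SA P -> good SB (fun n => map_poly h (P n)) -> extension SA SB h -> elementary SA SB h.
Proof.
move=> gA gB ext f; elim: f A B SA SB h P gA gB ext => [t1 t2|r ts|f IH|f1 IH1 f2 IH2|x f IH|x f IH]
  A B SA SB h P gA gB ext v.
- exact: (extension_sat v (f := feq _ t1 t2) ext).
- exact: (extension_sat v (f := frel ts) ext).
- by rewrite /= (IH _ _ _ _ _ _ gA gB ext).
- by rewrite /= (IH1 _ _ _ _ _ _ gA gB ext) (IH2 _ _ _ _ _ _ gA gB ext).
- split=> /= [H b|H a]; last first.
    by apply/(IH _ _ _ _ _ _ gA gB ext); rewrite -[fun y => _]/(h \o _) upd_map; apply: H.
  (* The universal formula holds in N because N is elementary over A; it is instantiated at the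
     image of b. *)
  have [N [SN [k [extk elk gN]]]] := good_above gA gB ext.
  apply/(IH _ _ _ _ _ _ gB gN extk); rewrite -[fun y => _]/(k \o _) upd_map.
  exact: (proj1 (elk (fall x f) v) H (k b)).
split=> /= [[a /(IH _ _ _ _ _ _ gA gB ext)]|[b Hb]].
  by rewrite -[fun y => _]/(h \o _) upd_map => H; exists (h a).
have [N [SN [k [extk elk gN]]]] := good_above gA gB ext.
apply: (proj2 (elk (fex x f) v)); exists (k b).
by have := proj1 (IH _ _ _ _ _ _ gB gN extk _) Hb; rewrite -[fun y => _]/(k \o _) upd_map.
Qed.

(** Over a perfect field irreducible polynomials are separable, so q splits modulo P_n. A single
    root r(α), with α a root of P_n, shows that P_n divides the composite of q and r. *)
Lemma good_PIC_d (K : fieldType) (S : struct (sig_union L) (cst_d deg) K) :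
  perfect_field K -> PIC_d T T' Itau S -> good (reduct_I S) (P_ S).
Proof.
move=> perfK [picK mTd mT']; split=> // n.
  have [irrP _] := mTd n; have E : P_ S n = 'X^(val (deg n)) +
      \poly_(j < val (deg n)) oapp (fun j' => cint S (existT (fun n : posnat => 'I_(val (deg n))) n j')) 0 (insub j).
    rewrite /P_; congr (_ + _); rewrite poly_def; apply: eq_bigr => j _.
    by rewrite valK /= mul_polyC.
  have sP : size (P_ S n) = (val (deg n)).+1 by rewrite E size_top // size_poly.
  split=> //; rewrite monicE lead_coefE sP E coefD coefXn eqxx coef_poly ltnn addr0 //.
move=> q irrq sq; have [irrP split_n] := mTd n.
have [E [g [α Pα]]] : exists (E : fieldType) (g : {rmorphism K -> E}) x, root (map_poly g (P_ S n)) x.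
  by apply: root_extension; rewrite gtn_eqF // irrP.1.
have [rs Drs] := split_n q (irreducible_separable perfK irrq) sq E g α Pα.
case: rs Drs => [|r rs] Drs.
  have := congr1 (fun p : {poly E} => size p) Drs; rewrite size_map_poly sq big_nil mulr1.
  by move=> H; have := size_polyC_leq1 (g (lead_coef q)); rewrite -H ltnS leqNgt (valP n).
exists r, ((q \Po r) %/ P_ S n); rewrite mulrC divpK //.
rewrite /dvdp; apply/eqP; apply: (min_of_irreducible irrP Pα); last by rewrite ltn_modp irredp_neq0.
have : root (map_poly g (q \Po r)) α.
  rewrite map_comp_poly rootE horner_comp -rootE Drs rootM; apply/orP; right.
  by rewrite big_cons rootM root_XsubC eqxx.
by rewrite {1}(divp_eq (q \Po r) (P_ S n)) rmorphD rmorphM /= rootE hornerD hornerM (rootP Pα) mulr0 add0r.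
Qed.

End Final.

Theorem corollary6p8
    (I : finType) (L : I -> signature) (T T' : forall i, theory (L i))
    (Itau : {set I})
    (hlarge : forall i, large_fields_theory (@T i))
    (hQE : forall i, elim_quantifiers (@T i))
    (hH : forall i, i \in Itau -> cond_H (@T i))
    (hZ : forall i, i \notin Itau -> cond_Z (@T i))
    (hT' : forall i, i \notin Itau ->
      (forall f, univ_conseq (@T i) f -> T' i f) /\
      dcl_algebraic (@T i) (@T' i))
    (d : posnat -> posnat)
    (K M : fieldType)
    (SK : struct (sig_union L) (cst_d d) K)
    (SM : struct (sig_union L) (cst_d d) M)
    (h : {rmorphism K -> M})
    (hext : extension SK SM h)
    (hKperf : perfect_field K) (hMperf : perfect_field M)
    (hK : PIC_d T T' Itau SK) (hM : PIC_d T T' Itau SM) :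
  elementary SK SM h.
Proof.
(* The embedding preserves the constants, so both fields define the same polynomials; that their
   images are irreducible over M is part of the hypothesis on M. *)
have DP n : P_ SM n = map_poly h (P_ SK n).
  rewrite /P_ rmorphD /= map_polyXn rmorph_sum; congr (_ + _); apply: eq_bigr => j _.
  by rewrite rmorphM /= map_polyC map_polyXn hext.2.
apply: (elementary_reduct (C := {n : posnat & 'I_(val (d n))}) hext).
apply: (good_extension_elementary hlarge hQE hH hZ hT' (good_PIC_d hKperf hK)).
  have -> : (fun n => map_poly h (P_ SK n)) = P_ SM by apply/funext => n; rewrite DP.
  exact: good_PIC_d.
by split=> [r a|[]]; apply: hext.1.
Qed.
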